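(* Assume that $K=F(\sqrt{-q})$ with $q$ a positive rational number and $[F:\mathbb Q]=e/2>1$. Let $\alpha_0$ be a non-zero rational class in $P=B_0\oplus B_{e/2}$, let $\beta$ be a rational class in $B$, and for $0\le i\le e/4$ let $\beta_i$ be the component of $\beta$ in $B_i+B_{e/2-i}$, so that $\beta=\sum_{0\le i\le e/4}\beta_i$. Assume that $\beta_0\neq0$, $\beta_1\neq0$, and $\check\phi(\alpha_0\otimes\beta_0)_0\neq0$. Then the class $c:=\alpha_0\otimes\beta\in B\otimes B$ satisfies $\check\phi(c)_0\neq0$, and its component $c_1\in BB_1$ does not belong to $KB_1$.
   Context: $K$ is a CM-field, $F$ its maximal totally real subfield, $\iota$ the generator of $\mathrm{Gal}(K/F)$, $e=[K:\mathbb Q]$, $\Sigma$ the set of embeddings $K\to\mathbb C$, $\hat\Sigma$ the set of embeddings $F\to\mathbb R$. A CM-type is a map $T:\hat\Sigma\to\Sigma$ with $T(\hat\sigma)|_F=\hat\sigma$; $|T\cap T'|$ is the number of $\hat\sigma$ with $T(\hat\sigma)=T'(\hat\sigma)$. $d$ is a positive even integer, $X$ is a simple complex abelian variety of dimension $n=de/4$ with an isomorphism $\hat\eta:F\to\mathrm{End}_{\mathbb Q}(X)=\mathrm{End}(X)\otimes\mathbb Q$; $\hat X$ is the dual abelian variety. $V=H^1(X,\mathbb Z)\oplus H^1(\hat X,\mathbb Z)=H^1(X\times\hat X,\mathbb Z)$ with $H^1(\hat X,\mathbb Z)=H^1(X,\mathbb Z)^*$; $V_{\mathbb Q}=V\otimes\mathbb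 Q$ and $H^*(X\times\hat X,\mathbb Q)=\wedge^*V_{\mathbb Q}$. $\Theta\in H^{1,1}(X,\mathbb Q)$ is a polarization; it lies in $\wedge^2_FH^1(X,\mathbb Q)$, the subspace of classes which, as alternating forms on $H_1(X,\mathbb Q)$, satisfy $\gamma(ax,y)=\gamma(x,ay)$ for $a\in F$. Write $\Theta=\sum_{\hat\sigma\in\hat\Sigma}\Theta_{\hat\sigma}$ with $\Theta_{\hat\sigma}\in\wedge^2H^1_{\hat\sigma}(X)$, where $H^1_{\hat\sigma}(X)\subset H^1(X,\mathbb R)$ is the subspace on which $F$ acts via $\hat\sigma$. For a CM-type $T$, $\ell_T\subset H^{ev}(X,\mathbb C)$ is the line spanned by $\exp\left(\sum_{\hat\sigma}T(\hat\sigma)(\sqrt{-q})\Theta_{\hat\sigma}\right)$. These lines are linearly independent, and their span is $B\otimes_{\mathbb Q}\mathbb C$ for a rational subspace $B\subset H^{ev}(X,\mathbb Q)$. $T_1$ is the CM-type such that $T_1(\hat\sigma)(\sqrt{-q})$ is in the upper half plane for all $\hat\sigma$. $B_i\subset B\otimes\mathbb C$ is the span of $\{\ell_T:|T\cap T_1|=i\}$, $0\le i\le e/2$; each $B_i+B_{e/2-i}$ is defined over $\mathbb Q$, and $P=B_0\oplus B_{e/2}$ is the plane spanned by $\exp(\sqrt{-q}\Theta)$ and its complex conjugate. A class is rational if it lies in $H^{ev}(X,\mathbb Q)$. $BB_k\subset B\otimes_{\mathbb Q}B$ is the rational subspace with $BB_k\otimes\mathbb C=\bigoplus_{|T\cap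 T'|=k}\ell_T\otimes\ell_{T'}$, so $B\otimes B=\bigoplus_{k=0}^{e/2}BB_k$; $c_1$ denotes the component of $c$ in $BB_1$. $\mathcal P$ is the normalized Poincaré bundle on $\hat X\times X$; $\phi_{\mathcal P}:H^*(\hat X,\mathbb Q)\to H^*(X,\mathbb Q)$, $\gamma\mapsto\pi_{X,*}(\pi_{\hat X}^*\gamma\cup ch(\mathcal P))$; $\mu(x,y)=(x+y,y)$ on $X\times X$; $\phi:H^*(X\times X,\mathbb Q)\to H^*(X\times\hat X,\mathbb Q)$ is the inverse of $\mu_*\circ(id\otimes\phi_{\mathcal P})$. $\tau$ acts on $H^i(X)$ by $(-1)^{i(i-1)/2}$, $\check\phi=\phi\circ(id\otimes\tau)$, and $\check\phi(c)_0$ is the component of $\check\phi(c)$ in $\wedge^0V_{\mathbb Q}=\mathbb Q$. $KB_1$ is the kernel of the composition of $\check\phi:BB_1\to\wedge^*V_{\mathbb Q}$ with the projection to $\wedge^dV_{\mathbb Q}$. *)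

(* Defs.v *)
(* The real numbers are [R : realType] and the complex numbers are [R[i]]. *)
From mathcomp Require Import all_boot all_order all_algebra all_field.
From mathcomp Require Import complex.
From mathcomp Require Import boolp reals.
Set Implicit Arguments.
Unset Strict Implicit.
Unset Printing Implicit Defensive.
Import Order.TTheory GRing.Theory Num.Theory.
Local Open Scope ring_scope.
Local Open Scope complex_scope.

(* [ext k m] is the exterior algebra of the dual of k^m.  The coordinate
   functionals e_0, ..., e_(m-1) give the basis e_A = e_a1 /\ ... /\ e_aj, where
   A = {a1 < ... < aj}; [x A] is the coefficient of e_A in x.
   For a real torus with H_1 = Z^m this is its cohomology ring with
   coefficients in k. *)
Definition ext (k : fieldType) (m : nat) := {ffun {set 'I_m} -> k^o}.

Definition ebase (k : fieldType) (m : nat) (A : {set 'I_m}) : ext k m :=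
  [ffun C => (C == A)%:R].

(* The sign in e_A /\ e_B = (shuffle_sign A B) e_(A :|: B), A and B disjoint. *)
Definition shuffle_sign (k : fieldType) (m : nat) (A B : {set 'I_m}) : k :=
  (-1) ^+ #|[set p : 'I_m * 'I_m | [&& p.1 \in A, p.2 \in B & (p.2 < p.1)%N]]|.

Definition wedge (k : fieldType) (m : nat) (x y : ext k m) : ext k m :=
  [ffun C : {set 'I_m} =>
     \sum_(A : {set 'I_m} | A \subset C)
        shuffle_sign k A (C :\: A) * (x A * y (C :\: A))].

(* The series stops at m because it is only used on the ideal of elements of
   positive degree. *)
Definition ext_exp (k : fieldType) (m : nat) (x : ext k m) : ext k m :=
  \sum_(j < m.+1) (j`!%:R)^-1 *: iter j (wedge x) (ebase k set0).

Definition degree_part (k : fieldType) (m j : nat) (x : ext k m) : ext k m :=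
  [ffun A : {set 'I_m} => if #|A| == j then x A else 0].

Definition ext_map (k l : fieldType) (m : nat) (f : k -> l) (x : ext k m) :
  ext l m := [ffun A => f (x A)].

(* The functional u |-> u *m xi on row vectors, as an element of degree 1. *)
Definition functional (k : fieldType) (m : nat) (xi : 'cV[k]_m) : ext k m :=
  \sum_(i < m) xi i 0 *: ebase k [set i].

(* The alternating form attached to the degree 2 part of x, where
   xi /\ xi' corresponds to (u, v) |-> xi(u) xi'(v) - xi(v) xi'(u). *)
Definition form2 (k : fieldType) (m : nat) (x : ext k m) (u v : 'rV[k]_m) : k :=
  \sum_(i < m) \sum_(j < m | (i < j)%N)
     x [set i; j] * (u 0 i * v 0 j - u 0 j * v 0 i).

(* Pullback along the map k^p -> k^q, u |-> u *m G ([enum A] is increasing). *)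
Definition pullback (k : fieldType) (p q : nat) (G : 'M[k]_(p, q))
    (x : ext k q) : ext k p :=
  \sum_(A : {set 'I_q})
     x A *: \big[@wedge k p/ebase k set0]_(j <- enum A) functional (col j G).

(* A complex torus is given in a basis of its lattice H_1(-, Z) = Z^m: the
   complex structure on H_1(-, R) is u |-> u *m J, where J *m J = -1. *)

(* Whether e_0 /\ ... /\ e_(m-1) is negative for the complex orientation, in
   which the bases v_0, i v_0, v_1, i v_1, ... are positive. *)
Definition negative_basis (R : realType) (m : nat) (J : 'M[R]_m) : bool :=
  ~~ `[< exists v : nat -> 'rV[R]_m,
          0 < \det (\matrix_(i < m) (if odd i then v i./2 *m J else v i./2)) >].

Definition integral (R : realType) (k : fieldType) (m : nat) (J : 'M[R]_m)
    (x : ext k m) : k := (-1) ^+ negative_basis J * x setT.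

(* The Gysin map of the homomorphism of tori u |-> u *m G with source (p, J) and
   target (q, J'): the map f_* with
     integral J' (wedge (f_* x) y) = integral J (wedge x (f^* y))  for all y,
   as seen by taking y = e_(~: A). *)
Definition gysin (R : realType) (k : fieldType) (p q : nat) (J : 'M[R]_p)
    (J' : 'M[R]_q) (G : 'M[k]_(p, q)) (x : ext k p) : ext k q :=
  [ffun A : {set 'I_q} =>
     (-1) ^+ negative_basis J' * shuffle_sign k A (~: A)
       * integral J (wedge x (pullback G (ebase k (~: A))))].

Definition product_cs (R : realType) (p q : nat) (J : 'M[R]_p) (J' : 'M[R]_q) :
  'M[R]_(p + q) := block_mx J 0 0 J'.

(* The complex structure of the dual torus, on H_1 = H^1(X, Z) = Hom(Z^m, Z) with
   its dual basis.  It is the one for which the class [poincare_c1] below has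
   type (1,1): it maps f to - f \o J. *)
Definition dual_cs (R : realType) (m : nat) (J : 'M[R]_m) : 'M[R]_m := - J^T.

(* [0 < Theta(u, iu)] is the sign for which Kaehler forms are positive. *)
Definition is_polarization (R : realType) (m : nat) (J : 'M[R]_m)
    (Theta : ext rat m) : Prop :=
  let ThetaR := ext_map (@ratr R) Theta in
  [/\ degree_part 2 Theta = Theta,
      forall u v : 'rV[R]_m, form2 ThetaR (u *m J) (v *m J) = form2 ThetaR u v
    & forall u : 'rV[R]_m, u != 0 -> 0 < form2 ThetaR u (u *m J)].

Record abelian_variety (R : realType) (n : nat) := AbelianVariety {
  cs : 'M[R]_(n.*2);
  cs_square : cs *m cs = - 1%:M;
  cs_polarizable : exists Theta : ext rat n.*2, is_polarization cs Theta
}.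

(* Complex subtori of X (all of which are abelian subvarieties) correspond to the
   rational subspaces of H_1(X, Q) that are stable under the complex structure. *)
Definition simple_av (R : realType) (n : nat) (X : abelian_variety R n) : Prop :=
  (0 < n)%N /\
  forall U : 'M[rat]_(n.*2),
    (map_mx (@ratr R) U *m cs X <= map_mx (@ratr R) U)%MS ->
    U = 0 \/ row_full U.

(* End(X) (x) Q, acting on the row vectors H_1(X, Q) from the right. *)
Definition in_EndQ (R : realType) (n : nat) (X : abelian_variety R n)
    (A : 'M[rat]_(n.*2)) : Prop :=
  map_mx (@ratr R) A *m cs X = cs X *m map_mx (@ratr R) A.

Definition iso_EndQ (R : realType) (n : nat) (X : abelian_variety R n)
    (L : fieldType) (eta : {rmorphism L -> 'M[rat]_(n.*2)}) : Prop :=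
  injective eta /\ forall A, in_EndQ X A <-> exists a, eta a = A.

Definition totally_real (R : realType) (L : fieldType) : Prop :=
  forall (f : {rmorphism L -> R[i]}) (a : L), complex.Im (f a) = 0.

Definition totally_imaginary (R : realType) (L : fieldType) : Prop :=
  forall f : {rmorphism L -> R[i]}, exists a : L, complex.Im (f a) <> 0.

Definition CM_field (R : realType) (K : fieldExtType rat) (F : {subfield K}) :
    Prop :=
  [/\ totally_imaginary R K, totally_real R (subvs_of F),
      \dim {:K} = (2 * \dim F)%N
    & forall E : {subfield K}, totally_real R (subvs_of E) -> (E <= F)%VS].

(* The finite set of embeddings L -> M is handled through an indexing type S. *)
Definition lists_embeddings (L M : fieldType) (S : finType)
    (emb : S -> {rmorphism L -> M}) : Prop :=
  (forall s t, emb s =1 emb t -> s = t) /\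
  (forall f : {rmorphism L -> M}, exists s, emb s =1 f).

Definition CM_type (R : realType) (K : fieldExtType rat) (F : {subfield K})
    (S hS : finType) (emb : S -> {rmorphism K -> R[i]})
    (hemb : hS -> {rmorphism subvs_of F -> R}) (T : {ffun hS -> S}) : bool :=
  `[< forall (s : hS) (a : subvs_of F), emb (T s) (vsval a) = (hemb s a)%:C >].

Definition meet_number (S hS : finType) (T T' : {ffun hS -> S}) : nat :=
  #|[set s | T s == T' s]|.

(* Theta lies in /\^2_F H^1(X, Q). *)
Definition F_bilinear (n : nat) (L : fieldType)
    (eta : {rmorphism L -> 'M[rat]_(n.*2)}) (Theta : ext rat n.*2) : Prop :=
  degree_part 2 Theta = Theta /\
  forall (a : L) (u v : 'rV[rat]_(n.*2)),
    form2 Theta (u *m eta a) v = form2 Theta u (v *m eta a).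

(* xi lies in the subspace of H^1(X, R) on which L acts via s. *)
Definition in_H1_eigen (R : realType) (n : nat) (L : fieldType)
    (eta : {rmorphism L -> 'M[rat]_(n.*2)}) (s : {rmorphism L -> R})
    (xi : 'cV[R]_(n.*2)) : Prop :=
  forall a : L, map_mx (@ratr R) (eta a) *m xi = s a *: xi.

(* x lies in the second exterior power of that subspace. *)
Definition in_wedge2_H1_eigen (R : realType) (n : nat) (L : fieldType)
    (eta : {rmorphism L -> 'M[rat]_(n.*2)}) (s : {rmorphism L -> R})
    (x : ext R n.*2) : Prop :=
  exists (N : nat) (xi xi' : 'I_N -> 'cV[R]_(n.*2)),
    (forall j, in_H1_eigen eta s (xi j) /\ in_H1_eigen eta s (xi' j)) /\
    x = \sum_j wedge (functional (xi j)) (functional (xi' j)).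

(* The spanning vector of ell_T; [sq] is the square root of -q in K and
   [Theta_ s] is the component of Theta at the embedding s. *)
Definition ell (R : realType) (K : fieldExtType rat) (S hS : finType)
    (emb : S -> {rmorphism K -> R[i]}) (sq : K) (m : nat)
    (Theta_ : hS -> ext R m) (T : {ffun hS -> S}) : ext R[i] m :=
  ext_exp (\sum_(s : hS)
     emb (T s) sq *: ext_map (fun r : R => r%:C) (Theta_ s)).

Definition to_C (R : realType) (m : nat) (x : ext rat m) : ext R[i] m :=
  ext_map (@ratr R[i]) x.

Definition tensor_C (R : realType) (m : nat) (U : {vspace ext rat m}) :
  {vspace ext R[i] m} := <<[seq to_C R x | x <- vbasis U]>>%VS.

(* The component of v in V_i, for v in the direct sum of V_0, ..., V_N. *)
Definition component (m N : nat) (V : nat -> {vspace ext rat m}) (i : nat)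
    (v : ext rat m) : ext rat m :=
  sumv_pi (\sum_(0 <= j < N.+1) V j)%VS i v.

Definition pr1 (k : fieldType) (p q : nat) : 'M[k]_(p + q, p) := col_mx 1%:M 0.
Definition pr2 (k : fieldType) (p q : nat) : 'M[k]_(p + q, q) := col_mx 0 1%:M.

(* Tensor products are taken inside the cohomology of the product (Kuenneth). *)
Definition tens (k : fieldType) (p q : nat) (x : ext k p) (y : ext k q) :
    ext k (p + q) :=
  wedge (pullback (pr1 k p q) x) (pullback (pr2 k p q) y).

(* id (x) f, from e_A (x) e_B = e_(A + B) where A + B is the disjoint union. *)
Definition id_tens (k : fieldType) (p q q' : nat) (f : ext k q -> ext k q')
    (x : ext k (p + q)) : ext k (p + q') :=
  \sum_(A : {set 'I_p}) \sum_(B : {set 'I_q})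
     x (@lshift p q @: A :|: @rshift p q @: B) *: tens (ebase k A) (f (ebase k B)).

(* c_1 of the normalized Poincare bundle on X^ x X: the canonical element of
   H^1(X^) (x) H^1(X), where H^1(X^) = H^1(X)^* has the basis dual to e_i. *)
Definition poincare_c1 (k : fieldType) (m : nat) : ext k (m + m) :=
  \sum_(i < m) tens (ebase k [set i]) (ebase k [set i]).

Definition phi_P (R : realType) (k : fieldType) (m : nat) (J : 'M[R]_m)
    (x : ext k m) : ext k m :=
  gysin (product_cs (dual_cs J) J) J (pr2 k m m)
    (wedge (pullback (pr1 k m m) x) (ext_exp (poincare_c1 k m))).

Definition mu_mx (k : fieldType) (m : nat) : 'M[k]_(m + m) :=
  block_mx 1%:M 0 1%:M 1%:M. (* (x, y) |-> (x + y, y) *)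

(* mu_* \o (id (x) phi_P) : H^*(X x X^) -> H^*(X x X) *)
Definition phi_inv (R : realType) (k : fieldType) (m : nat) (J : 'M[R]_m)
    (x : ext k (m + m)) : ext k (m + m) :=
  gysin (product_cs J J) (product_cs J J) (mu_mx k m)
    (id_tens (p := m) (phi_P J) x).

(* [linfun f] is f when f is linear, and [g^-1] is the inverse of g when g is
   bijective. *)
Definition phi (R : realType) (k : fieldType) (m : nat) (J : 'M[R]_m) :
  'End(ext k (m + m)) := (linfun (@phi_inv R k m J))^-1%VF.

Definition tau (k : fieldType) (m : nat) (x : ext k m) : ext k m :=
  [ffun A : {set 'I_m} => (-1) ^+ (#|A| * #|A|.-1)./2 * x A].

Definition check_phi (R : realType) (k : fieldType) (m : nat) (J : 'M[R]_m)
    (x : ext k (m + m)) : ext k (m + m) :=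
  phi k J (id_tens (p := m) (@tau k m) x).

(* Main.v *)
Require Import Defs.
From HB Require Import structures.
From mathcomp Require Import all_boot all_order all_algebra all_field.
From mathcomp Require Import complex.
From mathcomp Require Import boolp reals.
From mathcomp Require Import ring zify.
Import Order.TTheory GRing.Theory Num.Theory.
Set Implicit Arguments.
Unset Strict Implicit.
Unset Printing Implicit Defensive.
Local Open Scope ring_scope.

(** Let g = [F : Q], d = 2(r+1) and n = (r+1)g.  The form Theta_s lives on the
    s-eigenspace of F, which has dimension at most d, so Theta_s^(r+2) = 0; on
    the other hand Theta^n is not 0, because Theta is nondegenerate.  Hence there
    are exactly g embeddings s of F, and the product of the Theta_s^(r+1) spans
    the top degree.  Put t = T1(s)(sqrt(-q)), a number with conjugate -t that
    does not depend on s.  A CM type T is recorded by the set D of those s at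
    which it agrees with T1, and l_T = exp (sum_s (+t or -t) Theta_s), with sign
    + exactly for s in D.

    Up to nonzero scalars that depend only on B, the coefficient of
    check_phi(x) at A + B is the coefficient of mu^* (id (x) tau)(x) at A + ~B
    ([check_phi_coef]).  For x = l_T (x) l_T' the latter class is
    exp (sum_s (eps_s t (X_s + M_s) + (eps_s - eps'_s) t Y_s)), where X_s + M_s + Y_s
    is the pullback of Theta_s along (x, y) |-> x + y, split by bidegree
    ([sheared_exp]).

    Degree 0.  At a common point s of T and T' the form Y_s is absent from the
    exponent, and then the part of bidegree (0, 2n) vanishes, because
    Y_s^(r+2) = 0 and all the Y_s^(r+1) are needed ([sheared_cross]).  A type in
    the support of alpha_0 is T1 or its conjugate; a type in the support of
    beta_i with 0 < i <= g/2 agrees with either of them somewhere.  So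
    check_phi(c)_0 = check_phi(alpha_0 (x) beta_0)_0.

    Degree d.  The pairing of l_T and l_T' in the top degree vanishes exactly for
    T <> T'.  This gives the independence of the l_T and of the l_T (x) l_T', so
    that coefficients can be compared.  As alpha_0 is rational and nonzero, it is
    a l_T1 plus its conjugate, with a <> 0, and
    c_1 = sum_s (a b_s l_T1 (x) l_{s} + conj(a) b'_s l_conj(T1) (x) l_{~s}),
    where b_s and b'_s are the coefficients of beta_1 at the types {s} and ~{s}.
    Suppose that check_phi(c_1) has no part of degree d.  The bidegree
    (0, 2n - d) of mu^* (id (x) tau)(c_1), paired with a suitable class, gives
    a b_s t^N + conj(a) b'_s (-t)^N = 0 with N = (r+1)(g-1), and the bidegree
    (1, 2n - d + 1) gives the same equation with N + 1 in place of N.  The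
    powers of t and of -t have different relative signs in the two equations, so
    b_s = b'_s = 0 for all s ([degree_d_part_injective]) and beta_1 = 0.  That the
    second pairing is not zero rests on the identity
    (r+1) M_s^2 X_s^r Y_s^r = -2 X_s^(r+1) Y_s^(r+1), which is all that
    (X_s + M_s + Y_s)^(r+2) = 0 says after multiplication by X_s^r
    ([middle_square]). *)

(** * The exterior algebra as a ring *)

(** [ext k m] is a type of finite functions, which already carries a pointwise
    structure; the ring structure given by the wedge product is put on this
    alias. *)
Definition exterior (k : fieldType) (m : nat) := ext k m.
HB.instance Definition _ (k : fieldType) m := GRing.Lmodule.on (exterior k m).
HB.instance Definition _ (k : fieldType) m := Vector.on (exterior k m).

Section Ring.
Variables (k : fieldType) (m : nat).
Implicit Types (A B C D : {set 'I_m}) (x y z : exterior k m).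

Local Notation sgn := (@shuffle_sign k m).

Lemma shuffle_sign0l A : sgn set0 A = 1.
Proof.
by rewrite /shuffle_sign eq_card0 // => p; rewrite !inE.
Qed.

Lemma shuffle_sign0r A : sgn A set0 = 1.
Proof.
by rewrite /shuffle_sign eq_card0 // => p; rewrite !inE /= andbF.
Qed.

Lemma shuffle_signUl A B C :
  [disjoint A & B] -> sgn (A :|: B) C = sgn A C * sgn B C.
Proof.
move=> dAB; rewrite /shuffle_sign -exprD -cardsUI; congr (_ ^+ _).
rewrite [X in (_ + X)%N]eq_card0 ?addn0.
  by apply: eq_card => p; rewrite !inE andb_orl.
move=> p; rewrite !inE; apply/negP => /andP[/andP[pA _] /andP[pB _]].
by move/pred0P/(_ p.1): dAB; rewrite /= pA pB.
Qed.

Lemma shuffle_signUr A B C :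
  [disjoint A & B] -> sgn C (A :|: B) = sgn C A * sgn C B.
Proof.
move=> dAB; rewrite /shuffle_sign -exprD -cardsUI; congr (_ ^+ _).
rewrite [X in (_ + X)%N]eq_card0 ?addn0.
  by apply: eq_card => p; rewrite !inE -andb_orr -andb_orl.
move=> p; rewrite !inE.
apply/negP => /andP[/and3P[_ pA _] /and3P[_ pB _]].
by move/pred0P/(_ p.2): dAB; rewrite /= pA pB.
Qed.

Lemma shuffle_sign_neq0 A B : sgn A B != 0.
Proof. by rewrite signr_eq0. Qed.

Lemma shuffle_signC A B : [disjoint A & B] ->
  sgn A B = (-1) ^+ (#|A| * #|B|)%N * sgn B A.
Proof.
move=> dAB.
have -> : (#|A| * #|B|)%N =
   (#|[set p : 'I_m * 'I_m | [&& p.1 \in A, p.2 \in B & (p.2 < p.1)%N]]|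
    + #|[set p : 'I_m * 'I_m | [&& p.1 \in B, p.2 \in A & (p.2 < p.1)%N]]|)%N.
  rewrite -(cardsX A B) -[X in (_ + X)%N](card_imset _ (can_inj (@swap_pairK _ _))) -cardsUI.
  rewrite [X in (_ + X)%N]eq_card0 ?addn0.
    apply: eq_card => -[a b]; rewrite !inE /=; apply/andP/orP => [[aA bB]|].
      have [lt|gt|eq] := ltngtP b a; first by left; rewrite aA bB.
        right; apply/imsetP; exists (b, a) => //; rewrite inE /= aA bB /=.
        by rewrite gt.
      by move/pred0P/(_ a): dAB; rewrite /= aA -(val_inj eq) bB.
    case=> [/and3P[-> ->] //|/imsetP[[c d]]].
    by rewrite inE /= => /and3P[? ? _] [-> ->].
  move=> -[a b]; rewrite !inE /=; apply/negP => /andP[/and3P[_ _ lt]].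
  case/imsetP=> -[c d]; rewrite inE /= => /and3P[_ _ gt] [eqa eqb].
  by move: lt gt; rewrite eqa eqb => /ltn_trans h /h; rewrite ltnn.
by rewrite exprD -mulrA -exprD addnn -mul2n exprM sqrrN !expr1n mulr1.
Qed.

Lemma extZE a x C : (a *: x) C = a * x C. Proof. by rewrite ffunE. Qed.
Lemma extDE x y C : (x + y) C = x C + y C. Proof. by rewrite ffunE. Qed.
Lemma extNE x C : (- x) C = - x C. Proof. by rewrite ffunE. Qed.
Lemma ext0E C : (0 : exterior k m) C = 0. Proof. by rewrite ffunE. Qed.
Lemma ext_sumE (I : Type) (r : seq I) (P : pred I) (F : I -> exterior k m) C :
  (\sum_(i <- r | P i) F i) C = \sum_(i <- r | P i) F i C.
Proof. by elim/big_rec2: _ => [|i a y _ <-]; rewrite ?ext0E ?extDE. Qed.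

Lemma wedgeDl x y z : wedge (x + y) z = wedge x z + wedge y z :> exterior k m.
Proof.
apply/ffunP=> C; rewrite extDE !ffunE -big_split; apply: eq_bigr => A _ /=.
by rewrite extDE; ring.
Qed.

Lemma wedgeDr x y z : wedge x (y + z) = wedge x y + wedge x z :> exterior k m.
Proof.
apply/ffunP=> C; rewrite extDE !ffunE -big_split; apply: eq_bigr => A _ /=.
by rewrite extDE; ring.
Qed.

Lemma wedgeZl a x y : a *: (wedge x y : exterior k m) = wedge (a *: x) y.
Proof.
apply/ffunP=> C; rewrite extZE !ffunE mulr_sumr; apply: eq_bigr => A _ /=.
by rewrite extZE; ring.
Qed.

Lemma wedgeZr a x y : a *: (wedge x y : exterior k m) = wedge x (a *: y).
Proof.
apply/ffunP=> C; rewrite extZE !ffunE mulr_sumr; apply: eq_bigr => A _ /=.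
by rewrite extZE; ring.
Qed.

Lemma wedge1l x : wedge (ebase k set0) x = x.
Proof.
apply/ffunP=> C; rewrite !ffunE (bigD1 set0) ?sub0set //= big1 ?addr0.
  by rewrite shuffle_sign0l ffunE eqxx setD0 !mul1r.
by move=> A /andP[_ /negbTE A0]; rewrite ffunE A0 mul0r mulr0.
Qed.

Lemma wedge1r x : wedge x (ebase k set0) = x.
Proof.
apply/ffunP=> C; rewrite !ffunE (bigD1 C) //= big1 ?addr0.
  by rewrite setDv shuffle_sign0r ffunE eqxx mulr1 mul1r.
move=> A /andP[sAC neA]; rewrite ffunE.
case: eqP => [/eqP|]; last by rewrite !mulr0.
by rewrite setD_eq0 => sCA; case/eqP: neA; apply/eqP; rewrite eqEsubset sAC.
Qed.

(** Both sides expand over the ordered partitions of an index set C into three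
    parts; the signs agree because the shuffle sign is multiplicative in each
    argument. *)
Lemma wedgeA x y z : wedge x (wedge y z) = wedge (wedge x y) z.
Proof.
apply/ffunP=> D; rewrite !ffunE.
under eq_bigr => A _ do rewrite ffunE !mulr_sumr.
under [RHS]eq_bigr => C _ do rewrite ffunE mulr_suml mulr_sumr.
rewrite [RHS](exchange_big_dep (fun A => A \subset D)) /=; last first.
  by move=> C A sCD sAC; apply: subset_trans sAC sCD.
apply: eq_bigr => A sAD.
rewrite [RHS](reindex_onto (fun B => A :|: B) (fun C => C :\: A)) /=; last first.
  by move=> C /andP[_ sAC]; rewrite -{1}(setIidPr sAC) setID.
apply: eq_big => [B|B sB].
  rewrite subUset sAD subsetUl /= andbT setDUl setDv set0U subsetD.
  by rewrite eqEsubset subsetDl /= subsetD subxx disjoint_sym.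
have dAB : [disjoint A & B].
  by rewrite disjoint_sym; move: sB; rewrite subsetD => /andP[].
have -> : (A :|: B) :\: A = B by rewrite setDUl setDv set0U; apply/setDidPl; rewrite disjoint_sym.
rewrite setDDl shuffle_signUl //.
have -> : sgn A (D :\: A) = sgn A B * sgn A (D :\: (A :|: B)).
  rewrite -shuffle_signUr; last first.
    by rewrite -setI_eq0 -subset0; apply/subsetP=> i; rewrite !inE; case: (i \in B); rewrite ?orbT.
  congr (shuffle_sign _ _ _); apply/setP=> i; move/subsetP/(_ i): sB; rewrite !inE.
  by case: (i \in B) => [->|_] //; case: (i \in A).
ring.
Qed.

Lemma ebase_neq0 A : ebase k A != 0.
Proof.
apply/eqP=> /ffunP/(_ A); rewrite !ffunE eqxx => /eqP.
by rewrite oner_eq0.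
Qed.
End Ring.

HB.instance Definition _ (k : fieldType) m := GRing.Zmodule_isNzRing.Build (exterior k m)
  (@wedgeA k m) (@wedge1l k m) (@wedge1r k m) (@wedgeDl k m) (@wedgeDr k m)
  (ebase_neq0 k set0).
HB.instance Definition _ (k : fieldType) m :=
  GRing.Lmodule_isLalgebra.Build k (exterior k m) (@wedgeZl k m).
HB.instance Definition _ (k : fieldType) m :=
  GRing.Lalgebra_isAlgebra.Build k (exterior k m) (@wedgeZr k m).

Section Basis.
Variables (k : fieldType) (m : nat).
Implicit Types (A B C D : {set 'I_m}) (x y z : exterior k m).
Local Notation sgn := (@shuffle_sign k m).
Local Notation e_ A := (ebase k A : exterior k m).

Lemma ebaseE A C : e_ A C = (C == A)%:R.
Proof. by rewrite ffunE. Qed.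

Lemma ext_basis x : x = \sum_A x A *: e_ A.
Proof.
apply/ffunP=> C; rewrite ext_sumE (bigD1 C) //= big1 => [|A neA].
  by rewrite extZE ebaseE eqxx mulr1 addr0.
by rewrite extZE ebaseE eq_sym (negbTE neA) mulr0.
Qed.

Lemma wedgeE x y C :
  (x * y) C = \sum_(A : {set 'I_m} | A \subset C) sgn A (C :\: A) * (x A * y (C :\: A)).
Proof. by rewrite ffunE. Qed.

Lemma ebaseM A B : [disjoint A & B] -> e_ A * e_ B = sgn A B *: e_ (A :|: B).
Proof.
move=> dAB; apply/ffunP=> C; rewrite wedgeE extZE ebaseE.
have [->|neC] := eqVneq C (A :|: B).
  rewrite (bigD1 A) ?subsetUl //= big1 ?addr0 => [|D /andP[_ /negbTE neD]].
    rewrite !ebaseE eqxx setDUl setDv set0U.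
    by move: dAB; rewrite disjoint_sym => /setDidPl ->; rewrite eqxx !mulr1.
  by rewrite ebaseE neD mul0r mulr0.
rewrite mulr0 big1 // => D sDC; rewrite !ebaseE.
case: eqP => [eD|]; last by rewrite mul0r mulr0.
case: eqP => [eB|]; last by rewrite !mulr0.
case/eqP: neC; rewrite -eD -eB; apply/setP=> i; move/subsetP/(_ i): sDC.
by rewrite !inE; case: (i \in D) => //= ->.
Qed.

Lemma ebaseM0 A B : ~~ [disjoint A & B] -> e_ A * e_ B = 0.
Proof.
move=> dAB; apply/ffunP=> C; rewrite wedgeE ext0E big1 // => D sDC; rewrite !ebaseE.
case: eqP => [eD|]; last by rewrite mul0r mulr0.
case: eqP => [eB|]; last by rewrite !mulr0.
case/negP: dAB; rewrite -eD -eB -setI_eq0; apply/eqP/setP=> i.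
by rewrite !inE; case: (i \in D).
Qed.

Lemma shuffle_sign_sqr A B : sgn A B * sgn A B = 1.
Proof. by rewrite -expr2 sqrr_sign. Qed.
End Basis.

(** * Ordered products of anticommuting elements *)

Section Product.
Variables (k : fieldType) (q : nat) (E : algType k) (f : 'I_q -> E).
Hypothesis f_anti : forall i j, f i * f j = - (f j * f i).
Hypothesis f_sq : forall i, f i * f i = 0.
Implicit Types (A B : {set 'I_q}).
Local Notation sgn := (@shuffle_sign k q).

Definition oprod A : E := \prod_(j <- enum A) f j.

Lemma oprod_cond A : oprod A = \prod_(j <- enum 'I_q | j \in A) f j.
Proof. rewrite /oprod /enum_mem big_filter big_filter_cond /=.
by []. Qed.

Lemma gen_mul_prod (s : seq 'I_q) (P : pred 'I_q) i :
  f i * (\prod_(j <- s | P j) f j) =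
  (-1) ^+ count P s *: ((\prod_(j <- s | P j) f j) * f i).
Proof.
elim: s => [|j s IH]; first by rewrite !big_nil mulr1 mul1r scale1r.
rewrite !big_cons /=; case: ifP => _; last by rewrite IH.
rewrite mulrA f_anti mulNr -[in LHS]mulrA IH -scalerAr -scaleNr -mulN1r -exprS mulrA.
by [].
Qed.

Lemma shuffle_sign1l i B : sgn [set i] B = (-1) ^+ #|[set b in B | (b < i)%N]|.
Proof.
have pI : injective (pair i : 'I_q -> 'I_q * 'I_q) by move=> x y [].
rewrite /shuffle_sign -(card_imset _ pI).
congr (_ ^+ _); apply: eq_card => -[a b]; rewrite !inE /=.
apply/and3P/imsetP => [[/eqP -> bB lt]|[c]]; first by exists b; rewrite ?inE ?bB.
by rewrite inE => /andP[cB lt] [-> ->]; rewrite eqxx.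
Qed.

Lemma oprodU1 i B : i \notin B ->
  f i * oprod B = sgn [set i] B *: oprod (i |: B).
Proof.
move=> iB; rewrite !oprod_cond shuffle_sign1l.
have cE : #|[set b in B | (b < i)%N]| = count (fun b => (b \in B) && (b < i)%N) (enum 'I_q).
  by rewrite cardE -size_filter /enum_mem -filter_predI; congr (size _);
     rewrite -enumT; apply: eq_filter => b; rewrite /= !inE andbT.
have srt : pairwise (fun a b : 'I_q => (a < b)%N) (enum 'I_q).
  rewrite -(pairwise_map _ ltn) val_enum_ord -sorted_pairwise ?iota_ltn_sorted //.
  exact: ltn_trans.
rewrite {}cE; have := mem_enum 'I_q i; rewrite inE.
move: srt; move: (enum 'I_q) => s srt /splitPr sP; case: sP srt => s1 s2.
rewrite pairwise_cat /= allrel_consr => /and3P[/andP[/allP lt1 _] _ /andP[/allP lt2 _]].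
rewrite !big_cat !big_cons (negbTE iB) setU11 /= count_cat /= (negbTE iB) /= add0n.
rewrite (eq_in_count (a2 := mem B)); last by move=> j /lt1 /= ->; rewrite andbT.
rewrite [X in (_ + X)%N](eq_in_count (a2 := pred0)); last first.
  by move=> j /lt2 /= lt; rewrite ltnNge ltnW // andbF.
rewrite count_pred0 addn0 mulrA gen_mul_prod -scalerAl -mulrA; congr (_ *: (_ * (_ * _))).
  rewrite [LHS]big_seq_cond [RHS]big_seq_cond; apply: eq_bigl => j.
  by case: (boolP (j \in s1)) => //= /lt1 lt; rewrite !inE -val_eqE /= ltn_eqF.
rewrite [LHS]big_seq_cond [RHS]big_seq_cond; apply: eq_bigl => j.
by case: (boolP (j \in s2)) => //= /lt2 lt; rewrite !inE -val_eqE /= gtn_eqF.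
Qed.

Lemma oprodD1 i A : i \in A ->
  oprod A = sgn [set i] (A :\ i) *: (f i * oprod (A :\ i)).
Proof.
move=> iA; rewrite oprodU1 ?setD11 // scalerA shuffle_sign_sqr scale1r.
by rewrite setD1K.
Qed.

Lemma oprod0 : oprod set0 = 1.
Proof. by rewrite /oprod enum_set0 big_nil. Qed.

Lemma mul_gen_oprod0 i B : i \in B -> f i * oprod B = 0.
Proof.
by move=> iB; rewrite (oprodD1 iB) -scalerAr mulrA f_sq mul0r scaler0.
Qed.

(** Any family of anticommuting elements of square zero multiplies like the
    basis e_A: this is the universal property of the exterior algebra, and the
    reason why pullbacks are ring morphisms. *)
Lemma oprodM A B : oprod A * oprod B =
  if [disjoint A & B] then sgn A B *: oprod (A :|: B) else 0.
Proof.
have [n] := ubnP #|A|; elim: n A => // n IH A; rewrite ltnS => leA.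
have [->|[i iA]] := set_0Vmem A.
  by rewrite oprod0 mul1r set0U shuffle_sign0l scale1r -setI_eq0 set0I eqxx.
set A' := A :\ i; have eA : A = i |: A' by rewrite setD1K.
have iA' : i \notin A' by rewrite setD11.
rewrite (oprodD1 iA) -/A' -scalerAl -mulrA IH; last first.
  by move: leA; rewrite (cardsD1 i A) iA.
have dE : [disjoint A & B] = (i \notin B) && [disjoint A' & B].
  by rewrite eA disjoints_subset subUset sub1set inE -disjoints_subset.
rewrite dE; case: (boolP [disjoint A' & B]) => dA'; last by rewrite andbF mulr0 scaler0.
rewrite andbT; case: (boolP (i \in B)) => iB /=.
  by rewrite -scalerAr mul_gen_oprod0 ?scaler0 // inE iB orbT.
rewrite -scalerAr oprodU1; last by rewrite inE negb_or iA'.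
rewrite !scalerA setUA -eA; congr (_ *: _).
have d1 : [disjoint [set i] & A'] by rewrite disjoints1.
have -> : sgn A B = sgn [set i] B * sgn A' B by rewrite eA shuffle_signUl.
rewrite shuffle_signUr //.
by rewrite -[RHS]mul1r -(shuffle_sign_sqr k [set i] A'); ring.
Qed.

End Product.

(** * Linear forms and pullbacks *)

Section Functional.
Variables (k : fieldType) (m : nat).
Local Notation E := (exterior k m).
Local Notation e1 i := (ebase k [set i] : E).
Implicit Types (A B : {set 'I_m}) (x y : E).

Definition linform (xi : 'cV[k]_m) : E := functional xi.

Lemma linformE xi : linform xi = \sum_i xi i 0 *: e1 i.
Proof. by []. Qed.

Lemma linform_is_linear : linear linform.
Proof.
move=> a x y; rewrite !linformE scaler_sumr -big_split; apply: eq_bigr => i _ /=.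
by rewrite !mxE scalerA scalerDl.
Qed.
HB.instance Definition _ := GRing.isLinear.Build k 'cV[k]_m E _ linform linform_is_linear.

Lemma linformD xi xi' : linform (xi + xi') = linform xi + linform xi'. Proof. exact: linearD. Qed.
Lemma linformB xi xi' : linform (xi - xi') = linform xi - linform xi'. Proof. exact: linearB. Qed.
Lemma linformZ a xi : linform (a *: xi) = a *: linform xi. Proof. exact: linearZ. Qed.
Lemma linform_sum (I : Type) (r : seq I) (P : pred I) (F : I -> 'cV[k]_m) :
  linform (\sum_(i <- r | P i) F i) = \sum_(i <- r | P i) linform (F i).
Proof. exact: linear_sum. Qed.

Lemma ebase1_sq i : e1 i * e1 i = 0.
Proof. by rewrite ebaseM0 // -setI_eq0 setIid; apply/set0Pn; exists i; rewrite inE. Qed.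

Lemma ebase1_anti i j : e1 i * e1 j = - (e1 j * e1 i).
Proof.
have [->|ne] := eqVneq i j; first by rewrite ebase1_sq oppr0.
have d1 : [disjoint [set i] & [set j]] by rewrite disjoints1 inE.
have d2 : [disjoint [set j] & [set i]] by rewrite disjoint_sym.
rewrite !ebaseM // (shuffle_signC k d1) !cards1 expr1 setUC -scaleNr.
by rewrite mulN1r.
Qed.

Lemma oprod_ebase A : oprod (fun i => e1 i) A = ebase k A.
Proof.
have [n] := ubnP #|A|; elim: n A => // n IH A; rewrite ltnS => leA.
have [->|[i iA]] := set_0Vmem A; first by rewrite oprod0.
rewrite (oprodD1 ebase1_anti iA) IH; last first.
  by move: leA; rewrite (cardsD1 i A) iA.
rewrite ebaseM ?disjoints1 ?setD11 // scalerA shuffle_sign_sqr scale1r.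
by rewrite setD1K.
Qed.

Lemma linform_sq xi : linform xi * linform xi = 0.
Proof.
have neg : forall (c : 'I_m -> 'I_m -> E), (forall i j, c i j = - c j i) ->
    (forall i, c i i = 0) -> \sum_i \sum_j c i j = 0.
  move=> c ca c0.
  rewrite (eq_bigr (fun i : 'I_m => \sum_(j : 'I_m | (j < i)%N) c i j + \sum_(j : 'I_m | (i < j)%N) c i j)).
    rewrite big_split /= [X in _ + X](exchange_big_dep predT) //= -big_split /=.
    rewrite big1 // => i _; rewrite -big_split big1 //= => j _.
    by rewrite (ca j i) addrN.
  move=> i _; rewrite (bigID (fun j : 'I_m => (j < i)%N)) /=; congr (_ + _).
  rewrite (bigD1 i) ?ltnn //= c0 add0r; apply: eq_bigl => j.
  by rewrite -leqNgt [RHS]ltn_neqAle andbC eq_sym.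
rewrite !linformE mulr_suml; under eq_bigr => i _ do rewrite mulr_sumr.
apply: neg => [i j|i]; rewrite -!(scalerAl, scalerAr).
  by rewrite ebase1_anti !scalerN !scalerA mulrC.
by rewrite ebase1_sq !scaler0.
Qed.

Lemma linform_anti xi xi' : linform xi * linform xi' = - (linform xi' * linform xi).
Proof.
have := linform_sq (xi + xi'); rewrite linearD mulrDl !mulrDr !linform_sq add0r addr0.
by move/eqP; rewrite addr_eq0 => /eqP.
Qed.
End Functional.

Section Pullback.
Variables (k : fieldType) (p q : nat) (G : 'M[k]_(p, q)).

Definition pull (x : exterior k q) : exterior k p := pullback G x.

Lemma pullE x : pull x = \sum_A x A *: oprod (fun j => linform (col j G)) A.
Proof. by []. Qed.

Lemma pull_is_linear : linear pull.
Proof.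
move=> a x y; rewrite !pullE scaler_sumr -big_split; apply: eq_bigr => A _ /=.
by rewrite extDE extZE scalerA scalerDl.
Qed.
HB.instance Definition _ := GRing.isLinear.Build k (exterior k q) (exterior k p) _ pull pull_is_linear.

Lemma pull_ebase A : pull (ebase k A) = oprod (fun j => linform (col j G)) A.
Proof.
rewrite pullE (bigD1 A) //= big1 => [|B neB].
  by rewrite ebaseE eqxx scale1r addr0.
by rewrite ebaseE (negbTE neB) scale0r.
Qed.

Lemma pull_is_monoid_morphism : monoid_morphism pull.
Proof.
split=> [|x y]; first by rewrite [LHS]pull_ebase oprod0.
rewrite (ext_basis x) (ext_basis y) mulr_suml !linear_sum mulr_suml.
apply: eq_bigr => A _; rewrite mulr_sumr linear_sum linearZ /=.
rewrite mulr_sumr; apply: eq_bigr => B _; rewrite -scalerAl -scalerAr !linearZ /=.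
rewrite -scalerAl -scalerAr; congr (_ *: (_ *: _)).
rewrite !pull_ebase oprodM; first last.
- by move=> i; apply: linform_sq.
- by move=> i j; apply: linform_anti.
case: ifP => dAB; first by rewrite ebaseM // linearZ /= pull_ebase.
by rewrite ebaseM0 ?dAB // linear0.
Qed.
HB.instance Definition _ :=
  GRing.isMonoidMorphism.Build (exterior k q) (exterior k p) pull pull_is_monoid_morphism.

Lemma pullM x y : pull (x * y) = pull x * pull y. Proof. exact: rmorphM. Qed.
Lemma pullX x n : pull (x ^+ n) = pull x ^+ n. Proof. exact: rmorphXn. Qed.
Lemma pullB x y : pull (x - y) = pull x - pull y. Proof. exact: linearB. Qed.
Lemma pullZ a x : pull (a *: x) = a *: pull x. Proof. exact: linearZ. Qed.
Lemma pull_sum (I : Type) (r : seq I) (P : pred I) (F : I -> exterior k q) :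
  pull (\sum_(i <- r | P i) F i) = \sum_(i <- r | P i) pull (F i).
Proof. exact: linear_sum. Qed.

Lemma pull_linform xi : pull (linform xi) = linform (G *m xi).
Proof.
rewrite linformE linear_sum.
have -> : G *m xi = \sum_i xi i 0 *: col i G.
  apply/colP=> j; rewrite mxE summxE; apply: eq_bigr => i _.
  by rewrite !mxE mulrC.
rewrite linear_sum; apply: eq_bigr => i _; rewrite !linearZ /= pull_ebase.
by rewrite /oprod enum_set1 big_seq1.
Qed.
End Pullback.

Lemma rmorph_oprod (k l : fieldType) (q : nat) (E : algType k) (E' : algType l) (f : 'I_q -> E)
   (h : {rmorphism E -> E'}) A : h (oprod f A) = oprod (fun i => h (f i)) A.
Proof. by rewrite /oprod rmorph_prod. Qed.

Lemma ext_lin_eq (k : fieldType) (q : nat) (V : lmodType k)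
    (f g : {linear exterior k q -> V}) :
  (forall A, f (ebase k A) = g (ebase k A)) -> f =1 g.
Proof.
move=> h x; rewrite (ext_basis x) !linear_sum; apply: eq_bigr => A _.
by rewrite !linearZ h.
Qed.

Lemma pull_comp (k : fieldType) (p q r : nat) (G : 'M[k]_(p, q)) (H : 'M[k]_(q, r)) x :
  pull G (pull H x) = pull (G *m H) x.
Proof.
apply: (ext_lin_eq (f := pull G \o pull H)) x => A /=.
rewrite !pull_ebase rmorph_oprod /oprod.
by apply: eq_bigr => i _; rewrite !colE -mulmxA; apply: pull_linform.
Qed.

Lemma linform_delta (k : fieldType) m (i : 'I_m) : linform (delta_mx i 0) = ebase k [set i].
Proof.
rewrite linformE (bigD1 i) //= big1 => [|j ne]; first by rewrite mxE !eqxx scale1r addr0.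
by rewrite mxE (negbTE ne) scale0r.
Qed.

Lemma pull_id (k : fieldType) p x : pull (1%:M : 'M[k]_p) x = x.
Proof.
rewrite [RHS](ext_basis x) pullE; apply: eq_bigr => A _; congr (_ *: _).
rewrite -oprod_ebase /oprod; apply: eq_bigr => i _; rewrite -linform_delta; congr linform.
by apply/colP=> j; rewrite !mxE eqxx andbT.
Qed.

(** * Homogeneous elements *)

Section Homog.
Variables (k : fieldType) (m : nat).
Local Notation E := (exterior k m).
Implicit Types (A B : {set 'I_m}) (x y : E) (w : 'I_m -> nat).

(** With weight 1 everywhere this is the degree; with weights 0 and 1 it is one of
    the two degrees of a bigrading. *)
Definition weight w A := (\sum_(i in A) w i)%N.
Definition homog w j x := forall A, x A != 0 -> weight w A = j.

Lemma weightU w A B : [disjoint A & B] -> weight w (A :|: B) = (weight w A + weight w B)%N.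
Proof. by move=> d; rewrite /weight -bigU //; apply: eq_bigl => i; rewrite inE. Qed.

Lemma weight_card A : weight (fun=> 1%N) A = #|A|.
Proof. by rewrite /weight sum1_card. Qed.

Lemma homog0 w j : homog w j 0.
Proof. by move=> A; rewrite ext0E eqxx. Qed.

Lemma homogD w j x y : homog w j x -> homog w j y -> homog w j (x + y).
Proof.
move=> hx hy A; rewrite extDE; have [->|/hx -> //] := eqVneq (x A) 0.
by rewrite add0r => /hy.
Qed.

Lemma homogZ w j a x : homog w j x -> homog w j (a *: x).
Proof. by move=> hx A; rewrite extZE mulf_eq0 negb_or => /andP[_ /hx]. Qed.

Lemma homogN w j x : homog w j x -> homog w j (- x).
Proof. by rewrite -scaleN1r; apply: homogZ. Qed.

Lemma homog_sum w j (I : Type) (r : seq I) (P : pred I) (F : I -> E) :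
  (forall i, P i -> homog w j (F i)) -> homog w j (\sum_(i <- r | P i) F i).
Proof.
by move=> h; elim/big_ind: _ => //; [apply: homog0 | move=> x y; apply: homogD].
Qed.

Lemma homog_ebase w A : homog w (weight w A) (ebase k A : E).
Proof. by move=> B; rewrite ebaseE; have [->//|_] := eqVneq B A; rewrite eqxx. Qed.

Lemma homogM w i j x y : homog w i x -> homog w j y -> homog w (i + j) (x * y).
Proof.
move=> hx hy C; rewrite wedgeE => h.
have [A /andP[sAC] ] : exists A, (A \subset C) && (x A * y (C :\: A) != 0).
  apply/existsP; apply: contraNT h; rewrite negb_exists => /forallP h.
  rewrite big1 // => A sA; have := h A; rewrite sA /= negbK => /eqP ->.
  by rewrite mulr0.
rewrite mulf_eq0 negb_or => /andP[/hx <- /hy <-].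
rewrite -weightU; last by rewrite disjoints_subset setCD subsetUr.
by congr weight; rewrite -{1}(setIidPr sAC) setID.
Qed.

Lemma homog1 w : homog w 0 1.
Proof.
have -> : 0%N = weight w set0 by rewrite /weight big_set0.
exact: homog_ebase.
Qed.

Lemma homogX w i x n : homog w i x -> homog w (n * i) (x ^+ n).
Proof.
move=> hx; elim: n => [|n IH]; first by rewrite expr0; apply: homog1.
by rewrite exprS mulSn; apply: homogM.
Qed.

Lemma homog_linform w j (xi : 'cV[k]_m) : (forall i, xi i 0 != 0 -> w i = j) -> homog w j (linform xi).
Proof.
move=> h; rewrite linformE; apply: homog_sum => i _.
have [->|/h <-] := eqVneq (xi i 0) 0; first by rewrite scale0r; apply: homog0.
apply: homogZ; have -> : w i = weight w [set i] by rewrite /weight big_set1.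
exact: homog_ebase.
Qed.

Lemma homog_above w j x : homog w j x -> (weight w setT < j)%N -> x = 0.
Proof.
move=> h lt; apply/ffunP=> A; rewrite ext0E; apply/eqP.
apply: contraTT lt => /h <-; rewrite -leqNgt -(setUCr A) weightU ?leq_addr //.
by rewrite -setI_eq0 setICr.
Qed.

Lemma homog_eq0 w j x A : homog w j x -> weight w A <> j -> x A = 0.
Proof. by move=> h ne; apply/eqP; apply: contra_notT ne => /h. Qed.
End Homog.

Lemma homog_deg_pull (k : fieldType) p q (G : 'M[k]_(p, q)) j x :
  homog (fun=> 1%N) j x -> homog (fun=> 1%N) j (pull G x).
Proof.
move=> h; rewrite pullE; apply: homog_sum => A _.
have [->|/h <-] := eqVneq (x A) 0; first by rewrite scale0r; apply: homog0.
apply: homogZ; rewrite weight_card cardE /oprod.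
elim: (enum A) => [|i s IH]; first by rewrite big_nil; apply: homog1.
rewrite big_cons /= -[(size s).+1]add1n; apply: (homogM _ IH).
by apply: homog_linform.
Qed.

(** * Cohomology of a product *)

Section DisjointSum.
Variables (p q : nat).
Implicit Types (A C : {set 'I_p}) (B D : {set 'I_q}).

Definition set_sum A B : {set 'I_(p + q)} :=
  @lshift p q @: A :|: @rshift p q @: B.

Lemma lshift_in_set_sum A B i : (lshift q i \in set_sum A B) = (i \in A).
Proof.
rewrite inE mem_imset; last exact: lshift_inj.
case: (i \in A) => //=; apply/negbTE/imsetP => -[j _] /eqP.
by rewrite eq_lrshift.
Qed.

Lemma rshift_in_set_sum A B i : (rshift p i \in set_sum A B) = (i \in B).
Proof.
rewrite inE mem_imset ?orbF; last exact: rshift_inj.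
case: (i \in B) => //=; rewrite ?orbT // orbF; apply/negbTE/imsetP => -[j _] /eqP.
by rewrite eq_rlshift.
Qed.

Lemma in_set_sum A B i : (i \in set_sum A B) =
  match split i with inl j => j \in A | inr j => j \in B end.
Proof. by case: split_ordP => j ->; rewrite ?lshift_in_set_sum ?rshift_in_set_sum. Qed.

Lemma set_sum_eq A B C D : (set_sum A B == set_sum C D) = (A == C) && (B == D).
Proof.
apply/eqP/andP=> [e|[/eqP -> /eqP ->] //]; split; apply/eqP/setP=> i.
  by rewrite -(lshift_in_set_sum A B) e lshift_in_set_sum.
by rewrite -(rshift_in_set_sum A B) e rshift_in_set_sum.
Qed.

Lemma set_sumP (U : {set 'I_(p + q)}) : exists A B, U = set_sum A B.
Proof.
exists (@lshift p q @^-1: U), (@rshift p q @^-1: U); apply/setP=> i.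
by rewrite in_set_sum; case: split_ordP => j ->; rewrite inE.
Qed.

Lemma set_sumC A B : ~: set_sum A B = set_sum (~: A) (~: B).
Proof.
by apply/setP=> i; rewrite inE !in_set_sum; case: splitP => j _; rewrite inE.
Qed.

Lemma set_sumU A B C D : set_sum A B :|: set_sum C D = set_sum (A :|: C) (B :|: D).
Proof.
by apply/setP=> i; rewrite inE !in_set_sum; case: splitP => j _; rewrite inE.
Qed.

Lemma set_sumI A B C D : set_sum A B :&: set_sum C D = set_sum (A :&: C) (B :&: D).
Proof.
by apply/setP=> i; rewrite inE !in_set_sum; case: splitP => j _; rewrite inE.
Qed.

Lemma set_sum0 : set_sum set0 set0 = set0.
Proof. by rewrite /set_sum !imset0 setU0. Qed.

Lemma set_sumT : set_sum setT setT = setT.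
Proof. by rewrite -[RHS]setC0 -set_sum0 set_sumC !setC0. Qed.

Lemma weight_set_sum (w : 'I_(p + q) -> nat) A B : weight w (set_sum A B) =
  (weight (fun i => w (lshift q i)) A + weight (fun i => w (rshift p i)) B)%N.
Proof.
rewrite /set_sum weightU; last first.
  rewrite -setI_eq0; apply/eqP/setP=> i; rewrite !inE; apply/negP => /andP[].
  by case/imsetP=> j _ -> /imsetP[l _ /eqP]; rewrite eq_lrshift.
rewrite /weight !big_imset //= => i j _ _; [exact: rshift_inj | exact: lshift_inj].
Qed.
End DisjointSum.

Section Kunneth.
Variables (k : fieldType) (p q : nat).
Implicit Types (A C : {set 'I_p}) (B D : {set 'I_q}).

Lemma oprod_mono m M (h : 'I_m -> 'I_M) (A : {set 'I_m}) :
    (forall i j, (h i < h j)%N = (i < j)%N) ->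
  oprod (fun j => ebase k [set h j] : exterior k M) A = ebase k (h @: A).
Proof.
move=> hm; have hI : injective h.
  move=> i j e; have [lt|lt|/val_inj //] := ltngtP i j.
    by rewrite -hm e ltnn in lt.
  by rewrite -hm e ltnn in lt.
have [n] := ubnP #|A|; elim: n A => // n IH A; rewrite ltnS => leA.
have [->|[i iA]] := set_0Vmem A; first by rewrite oprod0 imset0.
rewrite (oprodD1 (fun i j => ebase1_anti k (h i) (h j)) iA) IH; last first.
  by move: leA; rewrite (cardsD1 i A) iA.
have hiA : h i \notin h @: (A :\ i).
  by apply/imsetP=> -[j]; rewrite !inE => /andP[ne _] /hI e; rewrite e eqxx in ne.
rewrite ebaseM ?disjoints1 // scalerA -imsetU1 setD1K // !shuffle_sign1l.
have -> : #|[set b in h @: (A :\ i) | (b < h i)%N]| = #|[set b in A :\ i | (b < i)%N]|.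
  rewrite -(card_imset _ hI); apply: eq_card => b; rewrite !inE.
  apply/andP/imsetP => [[/imsetP[j jA ->] lt]|[j]].
    by exists j => //; rewrite inE jA -hm.
  rewrite inE => /andP[jA lt] ->; rewrite hm lt; split=> //.
  exact: imset_f.
by rewrite -expr2 sqrr_sign scale1r.
Qed.

Lemma pull_pr1_ebase A : pull (pr1 k p q) (ebase k A) = ebase k (@lshift p q @: A).
Proof.
rewrite pull_ebase -oprod_mono // /oprod; apply: eq_bigr => i _.
rewrite -linform_delta; congr linform; apply/colP=> j; rewrite !mxE.
case: split_ordP => l -> /=; rewrite !mxE ?eqxx ?andbT.
  by rewrite (inj_eq (@lshift_inj _ _)).
by rewrite eq_rlshift.
Qed.

Lemma pull_pr2_ebase B : pull (pr2 k p q) (ebase k B) = ebase k (@rshift p q @: B).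
Proof.
rewrite pull_ebase -oprod_mono // => [|i j]; last by rewrite ltn_add2l.
rewrite /oprod; apply: eq_bigr => i _.
rewrite -linform_delta; congr linform; apply/colP=> j; rewrite !mxE.
case: split_ordP => l -> /=; rewrite !mxE ?eqxx ?andbT.
  by rewrite eq_lrshift.
by rewrite (inj_eq (@rshift_inj _ _)).
Qed.

Definition tensor (x : exterior k p) (y : exterior k q) : exterior k (p + q) :=
  pull (pr1 k p q) x * pull (pr2 k p q) y.

Lemma tensor_ebase A B : tensor (ebase k A) (ebase k B) = ebase k (set_sum A B).
Proof.
rewrite /tensor pull_pr1_ebase pull_pr2_ebase ebaseM; last first.
  rewrite -setI_eq0; apply/eqP/setP=> i; rewrite !inE; apply/negP => /andP[].
  by case/imsetP=> j _ -> /imsetP[l _ /eqP]; rewrite eq_lrshift.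
rewrite /shuffle_sign eq_card0 ?scale1r // => -[a b]; rewrite !inE /=.
apply/negP=> /and3P[/imsetP[i _ ->] /imsetP[j _ ->]] /=.
by rewrite ltnNge (leq_trans (ltnW (ltn_ord i))) ?leq_addr.
Qed.

Lemma tensorDl x x' y : tensor (x + x') y = tensor x y + tensor x' y.
Proof. by rewrite /tensor linearD mulrDl. Qed.
Lemma tensorDr x y y' : tensor x (y + y') = tensor x y + tensor x y'.
Proof. by rewrite /tensor linearD mulrDr. Qed.
Lemma tensorZl a x y : tensor (a *: x) y = a *: tensor x y.
Proof. by rewrite /tensor linearZ scalerAl. Qed.
Lemma tensorZr a x y : tensor x (a *: y) = a *: tensor x y.
Proof. by rewrite /tensor linearZ scalerAr. Qed.
Lemma tensor_suml (I : Type) (r : seq I) (P : pred I) F y :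
  tensor (\sum_(i <- r | P i) F i) y = \sum_(i <- r | P i) tensor (F i) y.
Proof. by rewrite /tensor linear_sum mulr_suml. Qed.
Lemma tensor_sumr (I : Type) (r : seq I) (P : pred I) F x :
  tensor x (\sum_(i <- r | P i) F i) = \sum_(i <- r | P i) tensor x (F i).
Proof. by rewrite /tensor linear_sum mulr_sumr. Qed.
Lemma tensorE x y A B : tensor x y (set_sum A B) = x A * y B.
Proof.
have e C D : tensor (x C *: (ebase k C : exterior k p)) (y D *: (ebase k D : exterior k q)) (set_sum A B) =
    x C * (y D * ((A == C) && (B == D))%:R).
  by rewrite tensorZl tensorZr !extZE tensor_ebase ebaseE set_sum_eq.
rewrite {1}(ext_basis x) {1}(ext_basis y) tensor_suml ext_sumE (bigD1 A) //=.
rewrite tensor_sumr ext_sumE (bigD1 B) //= e !eqxx mulr1 big1 ?addr0; last first.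
  by move=> D ne; rewrite e (eq_sym B) (negbTE ne) andbF !mulr0.
rewrite big1 ?addr0 // => C ne; rewrite tensor_sumr ext_sumE big1 // => D _.
by rewrite e (eq_sym A) (negbTE ne) !mulr0.
Qed.

Lemma ext_eq_set_sum (x y : exterior k (p + q)) :
  (forall A B, x (set_sum A B) = y (set_sum A B)) -> x = y.
Proof. by move=> h; apply/ffunP=> U; have [A [B ->]] := set_sumP U. Qed.

End Kunneth.

Section IdTens.
Variables (k : fieldType) (p q q' : nat) (f : ext k q -> ext k q').

Lemma id_tensE (x : exterior k (p + q)) : id_tens (p := p) f x =
  \sum_A \sum_B x (set_sum A B) *: tensor (ebase k A) (f (ebase k B)).
Proof. by []. Qed.

Lemma id_tens_linear : linear (id_tens (p := p) f : exterior k (p + q) -> exterior k (p + q')).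
Proof.
move=> a x y; rewrite !id_tensE scaler_sumr -big_split; apply: eq_bigr => A _ /=.
rewrite scaler_sumr -big_split; apply: eq_bigr => B _ /=.
by rewrite extDE extZE scalerA scalerDl.
Qed.

(** Every map to which id (x) - is applied below permutes the monomials up to
    scalars, and so does the resulting map. *)
Lemma id_tens_monomial (u : {set 'I_q} -> k) (s : {set 'I_q} -> {set 'I_q'}) (x : exterior k (p + q)) A B :
    injective s -> (forall B, f (ebase k B) = u B *: (ebase k (s B) : exterior k q')) ->
  id_tens (p := p) f x (set_sum A (s B)) = u B * x (set_sum A B).
Proof.
move=> sI fE; rewrite id_tensE ext_sumE (bigD1 A) //= [X in _ + X]big1 ?addr0.
  rewrite ext_sumE (bigD1 B) //= [X in _ + X]big1 ?addr0.
    by rewrite fE extZE tensorE extZE !ebaseE !eqxx mulr1 mul1r mulrC.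
  by move=> D ne; rewrite fE extZE tensorE extZE !ebaseE (inj_eq sI) (eq_sym B) (negbTE ne) !mulr0.
move=> D ne; rewrite ext_sumE big1 // => C _.
by rewrite fE extZE tensorE extZE !ebaseE (eq_sym A) (negbTE ne) mul0r mulr0.
Qed.
End IdTens.

Section ExtMap.
Variables (k l : fieldType) (f : {rmorphism k -> l}).

Definition extmap m (x : exterior k m) : exterior l m := ext_map f x.

Lemma extmapE m (x : exterior k m) A : extmap x A = f (x A).
Proof. by rewrite ffunE. Qed.

Lemma extmap_is_zmod_morphism m : zmod_morphism (@extmap m).
Proof. by move=> x y; apply/ffunP=> A; rewrite !(extmapE, extDE, extNE) rmorphB. Qed.
HB.instance Definition _ m :=
  GRing.isZmodMorphism.Build (exterior k m) (exterior l m) (@extmap m) (@extmap_is_zmod_morphism m).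

Lemma extmap_ebase m (A : {set 'I_m}) : extmap (ebase k A) = ebase l A.
Proof. by apply/ffunP=> B; rewrite extmapE !ebaseE rmorph_nat. Qed.

Lemma extmap_is_monoid_morphism m : monoid_morphism (@extmap m).
Proof.
split=> [|x y]; first exact: extmap_ebase.
apply/ffunP=> C; rewrite extmapE !wedgeE rmorph_sum; apply: eq_bigr => A _ /=.
by rewrite !rmorphM !extmapE /shuffle_sign rmorphXn rmorphN rmorph1.
Qed.
HB.instance Definition _ m :=
  GRing.isMonoidMorphism.Build (exterior k m) (exterior l m) (@extmap m) (@extmap_is_monoid_morphism m).

Lemma extmapZ m a (x : exterior k m) : extmap (a *: x) = f a *: extmap x.
Proof. by apply/ffunP=> A; rewrite !(extmapE, extZE) rmorphM. Qed.

Lemma extmapX m (x : exterior k m) n : extmap (x ^+ n) = extmap x ^+ n. Proof. exact: rmorphXn. Qed.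
Lemma extmap0 m : extmap (0 : exterior k m) = 0. Proof. exact: rmorph0. Qed.
Lemma extmap_sum m (I : Type) (r : seq I) (P : pred I) (F : I -> exterior k m) :
  extmap (\sum_(i <- r | P i) F i) = \sum_(i <- r | P i) extmap (F i).
Proof. exact: rmorph_sum. Qed.

Lemma extmap_linform m (xi : 'cV_m) : extmap (linform xi) = linform (map_mx f xi).
Proof.
rewrite !linformE rmorph_sum; apply: eq_bigr => i _ /=.
by rewrite extmapZ extmap_ebase mxE.
Qed.

Lemma extmap_pull p q (G : 'M_(p, q)) x : extmap (pull G x) = pull (map_mx f G) (extmap x).
Proof.
rewrite !pullE rmorph_sum; apply: eq_bigr => A _ /=.
rewrite extmapZ extmapE rmorph_oprod; congr (_ *: _); rewrite /oprod; apply: eq_bigr => i _.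
by rewrite -map_col; apply: extmap_linform.
Qed.

Lemma extmap_tensor p q (x : exterior k p) (y : exterior k q) : extmap (tensor x y) = tensor (extmap x) (extmap y).
Proof. by apply: ext_eq_set_sum => A B; rewrite extmapE !tensorE rmorphM !extmapE. Qed.

Lemma extmap_inj m : injective (@extmap m).
Proof.
move=> x y /ffunP e; apply/ffunP=> A; move: (e A); rewrite !extmapE.
exact: fmorph_inj.
Qed.
End ExtMap.

(** * The even subalgebra and exponentials *)

Section Even.
Variables (k : fieldType) (m : nat).
Local Notation E := (exterior k m).
Implicit Types (A B : {set 'I_m}) (x y : E).

Definition even_pred : {pred E} := [pred x : E | [forall A : {set 'I_m}, odd #|A| ==> (x A == 0)]].

Lemma even_extP x : reflect (forall A, odd #|A| -> x A = 0) (x \in even_pred).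
Proof.
apply: (iffP forallP) => [h A oA|h A]; last by apply/implyP => /h ->.
by apply/eqP; move/implyP: (h A); apply.
Qed.

Lemma homog_even j x : homog (fun=> 1%N) j x -> ~~ odd j -> x \in even_pred.
Proof.
move=> h ej; apply/even_extP => A oA; apply: (homog_eq0 h).
by rewrite weight_card => e; rewrite -e oA in ej.
Qed.

Lemma even_ext_subalg_closed : subalg_closed even_pred.
Proof.
split=> [|a x y /even_extP hx /even_extP hy|x y /even_extP hx /even_extP hy].
- exact: (homog_even (homog1 _)).
- by apply/even_extP=> A oA; rewrite extDE extZE hx // hy // mulr0 addr0.
apply/even_extP=> A oA; rewrite wedgeE big1 // => B sBA.
case: (boolP (odd #|B|)) => oB; first by rewrite hx // mul0r mulr0.
rewrite hy ?mulr0 // cardsD (setIidPr sBA) oddB ?subset_leq_card // oA.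
by rewrite (negbTE oB).
Qed.

(** Elements of even degree commute, so the binomial formula and identities
    between polynomials are available in this subalgebra. *)
Record even_exterior := EvenExterior { ev :> E; evP : ev \in even_pred }.
HB.instance Definition _ := [isSub for ev].
HB.instance Definition _ := [Choice of even_exterior by <:].
HB.instance Definition _ :=
  GRing.SubChoice_isSubAlgebra.Build k E even_pred even_exterior even_ext_subalg_closed.

Lemma even_mulC x y : x \in even_pred -> x * y = y * x.
Proof.
move=> /even_extP hx; rewrite {1}(ext_basis x) {2}(ext_basis x) mulr_suml mulr_sumr.
apply: eq_bigr => A _; rewrite -scalerAl -scalerAr.
case: (boolP (odd #|A|)) => oA; first by rewrite hx // !scale0r.
congr (_ *: _); rewrite (ext_basis y) mulr_suml mulr_sumr.
apply: eq_bigr => B _; rewrite -scalerAl -scalerAr; congr (_ *: _).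
case: (boolP [disjoint A & B]) => d; last first.
  by rewrite !ebaseM0 // disjoint_sym.
rewrite !ebaseM // 1?disjoint_sym // (shuffle_signC k d) setUC -signr_odd oddM.
by rewrite (negbTE oA) expr0 mul1r.
Qed.

Lemma evext_mulC : commutative (@GRing.mul even_exterior).
Proof. by move=> x y; apply: val_inj; rewrite !rmorphM /=; apply: even_mulC; apply: evP. Qed.
HB.instance Definition _ := GRing.PzRing_hasCommutativeMul.Build even_exterior evext_mulC.

Lemma ev_is_linear : linear (@ev : even_exterior -> E).
Proof. by move=> a x y; apply: (linearP (val : {linear even_exterior -> E})). Qed.
HB.instance Definition _ := GRing.isLinear.Build k even_exterior E _ ev ev_is_linear.
Lemma ev_is_monoid_morphism : monoid_morphism (@ev : even_exterior -> E).
Proof. split=> [|x y]; first exact: (rmorph1 (val : {rmorphism even_exterior -> E})).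
exact: (rmorphM (val : {rmorphism even_exterior -> E})). Qed.
HB.instance Definition _ := GRing.isMonoidMorphism.Build even_exterior E ev ev_is_monoid_morphism.

Lemma evM (x y : even_exterior) : ev (x * y) = ev x * ev y. Proof. exact: rmorphM. Qed.
Lemma evX (x : even_exterior) n : ev (x ^+ n) = ev x ^+ n. Proof. exact: rmorphXn. Qed.
Lemma evD (x y : even_exterior) : ev (x + y) = ev x + ev y. Proof. exact: linearD. Qed.
Lemma evZ a (x : even_exterior) : ev (a *: x) = a *: ev x. Proof. exact: linearZ. Qed.
Lemma ev0 : ev (0 : even_exterior) = 0. Proof. exact: linear0. Qed.
Lemma ev1 : ev (1 : even_exterior) = 1. Proof. exact: rmorph1. Qed.
Lemma ev_sum (I : Type) (r : seq I) (P : pred I) (F : I -> even_exterior) :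
  ev (\sum_(i <- r | P i) F i) = \sum_(i <- r | P i) ev (F i).
Proof. exact: linear_sum. Qed.

Lemma ev_inj : injective ev.
Proof. exact: val_inj. Qed.
End Even.

Section TruncatedExp.
Variable k : numFieldType.

Definition trunc_exp (E : algType k) M (x : E) : E := \sum_(j < M) (j`!%:R)^-1 *: x ^+ j.

Lemma trunc_exp_morph (E E' : algType k) (h : {lrmorphism E -> E'}) M x :
  h (trunc_exp M x) = trunc_exp M (h x).
Proof.
rewrite /trunc_exp linear_sum; apply: eq_bigr => j _.
by rewrite linearZ rmorphXn.
Qed.

Lemma trunc_exp_widen (E : algType k) M N (x : E) :
  x ^+ M = 0 -> (M <= N)%N -> trunc_exp N x = trunc_exp M x.
Proof.
move=> x0 leMN; rewrite /trunc_exp.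
rewrite -[LHS](big_mkord predT (fun j => (j`!%:R)^-1 *: x ^+ j)) (big_cat_nat (leq0n M) leMN) //=.
rewrite big_mkord [X in _ + X]big_nat_cond [X in _ + X]big1 ?addr0 // => j /andP[/andP[leMj _] _].
by rewrite -(subnK leMj) exprD x0 mulr0 scaler0.
Qed.

(** The usual proof of the functional equation; the hypothesis makes the terms
    that the truncation at M treats differently on the two sides vanish. *)
Lemma trunc_exp_add (E : comAlgType k) M (x y : E) :
    (forall i j, (M <= i + j)%N -> x ^+ i * y ^+ j = 0) ->
  trunc_exp M (x + y) = trunc_exp M x * trunc_exp M y.
Proof.
move=> xy0; pose F i j : E := (i`!%:R)^-1 *: x ^+ i * ((j`!%:R)^-1 *: y ^+ j).
rewrite /trunc_exp mulr_suml; under [RHS]eq_bigr => i _ do rewrite mulr_sumr.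
have -> : \sum_(n < M) (n`!%:R)^-1 *: (x + y) ^+ n = \sum_(0 <= n < M) \sum_(0 <= i < M | (i <= n)%N) F i (n - i)%N.
  rewrite big_mkord; apply: eq_bigr => n _.
  rewrite addrC exprDn scaler_sumr -(big_mkord predT (fun i => (n`!%:R)^-1 *: (y ^+ (n - i) * x ^+ i *+ 'C(n, i)))).
  rewrite (@big_nat_widen _ _ _ 0 n.+1 M) //=.
  apply: eq_bigr => i; rewrite ltnS => lein.
  rewrite /F -scalerAl -scalerAr scalerA mulrC -scaler_nat scalerA; congr (_ *: _).
  rewrite -(bin_fact lein) !natrM.
  have nz j : (j`!%:R : k) != 0 by rewrite pnatr_eq0 -lt0n fact_gt0.
  have cz : ('C(n, i)%:R : k) != 0 by rewrite pnatr_eq0 -lt0n bin_gt0.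
  by rewrite !invfM mulrAC mulVf // mul1r.
rewrite (exchange_big_dep predT) //= big_mkord; apply: eq_bigr => i _.
have leiM := ltnW (ltn_ord i).
rewrite -[RHS](big_mkord predT (F i)) [RHS](big_cat_nat (leq0n (M - i)) (leq_subr i M)) /=.
rewrite [X in _ = _ + X]big_nat_cond [X in _ = _ + X]big1 ?addr0; last first.
  move=> j /andP[/andP[le _] _]; rewrite /F -scalerAl -scalerAr xy0 ?scaler0 //.
  by rewrite -leq_subLR.
rewrite [LHS](big_cat_nat (leq0n i) leiM) /= [X in X + _]big_nat_cond [X in X + _]big1 ?add0r.
  have -> : \sum_(i <= n < M | (i <= n)%N) F i (n - i)%N = \sum_(i <= n < M) F i (n - i)%N.
    rewrite [LHS]big_nat_cond [RHS]big_nat_cond; apply: eq_bigl => n.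
    by case: (leqP i n); rewrite ?andbF ?andbT.
  rewrite -{1}[nat_of_ord i]add0n big_addn; apply: eq_bigr => j _.
  by rewrite addnK.
by move=> n /andP[/andP[_ lt] le]; rewrite leqNgt lt in le.
Qed.
End TruncatedExp.

Section Positive.
Variables (k : numFieldType) (m : nat).
Local Notation E := (exterior k m).
Implicit Types (A B : {set 'I_m}) (x y : E).

Definition deg_ge j x := forall A, x A != 0 -> (j <= #|A|)%N.

Lemma deg_ge0 j : deg_ge j 0.
Proof. by move=> A; rewrite ext0E eqxx. Qed.

Lemma deg_geD j x y : deg_ge j x -> deg_ge j y -> deg_ge j (x + y).
Proof.
move=> hx hy A; rewrite extDE; have [->|/hx -> //] := eqVneq (x A) 0.
by rewrite add0r => /hy.
Qed.

Lemma deg_ge_sum j (I : Type) (r : seq I) (P : pred I) (F : I -> E) :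
  (forall i, P i -> deg_ge j (F i)) -> deg_ge j (\sum_(i <- r | P i) F i).
Proof.
by move=> h; elim/big_ind: _ => //; [apply: deg_ge0 | move=> x y; apply: deg_geD].
Qed.

Lemma deg_geM i j x y : deg_ge i x -> deg_ge j y -> deg_ge (i + j) (x * y).
Proof.
move=> hx hy C; rewrite wedgeE => h.
have [A /andP[sAC] ] : exists A, (A \subset C) && (x A * y (C :\: A) != 0).
  apply/existsP; apply: contraNT h; rewrite negb_exists => /forallP h.
  rewrite big1 // => A sA; have := h A; rewrite sA /= negbK => /eqP ->.
  by rewrite mulr0.
rewrite mulf_eq0 negb_or => /andP[/hx lx /hy ly].
by rewrite -(cardsID A C) (setIidPr sAC) leq_add.
Qed.

Lemma deg_geX x n : deg_ge 1 x -> deg_ge n (x ^+ n).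
Proof.
move=> hx; elim: n => [|n IH]; first by move=> A.
by rewrite exprS -add1n; apply: deg_geM.
Qed.

Lemma deg_ge_above j x : deg_ge j x -> (m < j)%N -> x = 0.
Proof.
move=> h lt; apply/ffunP=> A; rewrite ext0E; apply/eqP.
apply: contraTT lt => /h le; rewrite -leqNgt (leq_trans le) //.
by rewrite -[m in (_ <= m)%N]card_ord max_card.
Qed.

Lemma homog_deg_ge j x : (0 < j)%N -> homog (fun=> 1%N) j x -> deg_ge 1 x.
Proof. by move=> j0 h A /h; rewrite weight_card => ->. Qed.

Lemma ext_expE x : ext_exp x = trunc_exp m.+1 x.
Proof.
rewrite /ext_exp /trunc_exp; apply: eq_bigr => j _; congr (_ *: _).
by elim: (nat_of_ord j) => [|n IH] //=; rewrite exprS -IH.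
Qed.

Lemma trunc_exp_positive M x : deg_ge 1 x -> (m < M)%N -> trunc_exp M x = ext_exp x.
Proof.
move=> lx leM; rewrite ext_expE; apply: trunc_exp_widen => //.
exact: (deg_ge_above (deg_geX (n := m.+1) lx)).
Qed.

Lemma ev_trunc_exp M (x : even_exterior k m) : ev (trunc_exp M x) = trunc_exp M (ev x).
Proof. exact: (trunc_exp_morph (@ev k m)). Qed.

Lemma ext_exp_add (x y : E) : x \in @even_pred k m -> y \in @even_pred k m -> deg_ge 1 x -> deg_ge 1 y ->
  ext_exp (x + y) = (ext_exp x : E) * ext_exp y.
Proof.
move=> ex ey lx ly; rewrite !ext_expE.
have h : trunc_exp m.+1 (EvenExterior ex + EvenExterior ey) =
    trunc_exp m.+1 (EvenExterior ex) * trunc_exp m.+1 (EvenExterior ey).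
  apply: trunc_exp_add => i j le; apply: ev_inj.
  rewrite evM !evX ev0; apply: (deg_ge_above (j := (i + j)%N)) => //.
  by apply: deg_geM; apply: deg_geX.
by move/(congr1 (@ev _ _)): h; rewrite rmorphM /= !ev_trunc_exp linearD.
Qed.

Lemma ext_exp0 : ext_exp (0 : E) = 1 :> E.
Proof.
rewrite ext_expE /trunc_exp big_ord_recl big1 ?addr0; first by rewrite expr0 invr1 scale1r.
by move=> i _; rewrite expr0n scaler0.
Qed.

(** Only one term of the exponential of a 2-form has the degree that completes Q
    to the top degree. *)
Lemma ext_exp_top (z Q : E) j c :
    homog (fun=> 1%N) 2 z -> homog (fun=> 1%N) c Q -> (2 * j + c = m)%N ->
  ((ext_exp z : E) * Q) setT = (j`!%:R)^-1 * (z ^+ j * Q) setT.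
Proof.
move=> hz hQ e; rewrite ext_expE mulr_suml ext_sumE.
have ltj : (j < m.+1)%N by lia.
rewrite (bigD1 (Ordinal ltj)) //= [X in _ + X]big1 ?addr0.
  by rewrite -scalerAl extZE.
move=> i ne; rewrite -scalerAl extZE (homog_eq0 (homogM (homogX (n := i) hz) hQ)) ?mulr0 //.
rewrite weight_card cardsT card_ord; move/eqP: ne => ne eq; apply: ne; apply: val_inj => /=.
by lia.
Qed.

End Positive.

Lemma pull_ext_exp (k : numFieldType) p q (G : 'M[k]_(p, q)) (x : exterior k q) :
  deg_ge 1 x -> deg_ge 1 (pull G x) -> pull G (ext_exp x) = ext_exp (pull G x).
Proof.
move=> lx lpx; rewrite -(@trunc_exp_positive _ _ (maxn p q).+1 x) ?ltnS ?leq_maxr //.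
by rewrite trunc_exp_morph trunc_exp_positive ?ltnS ?leq_maxl.
Qed.

(** * The Poincare bundle and Orlov's isomorphism *)

Section TopCoef.
Variables (k : fieldType) (m : nat).
Implicit Types (A B P Q : {set 'I_m}) (x y : exterior k m).

Lemma mul_ebase_top x Q : (x * ebase k Q) setT = shuffle_sign k (~: Q) Q * x (~: Q).
Proof.
rewrite wedgeE (bigD1 (~: Q)) ?subsetT //= big1 => [|A /andP[_ ne]].
  by rewrite setTD setCK ebaseE eqxx mulr1 addr0.
rewrite ebaseE setTD; case: eqP => [e|]; last by rewrite !mulr0.
by rewrite -e setCK eqxx in ne.
Qed.

Lemma ebase_mulE P x A : P \subset A ->
  ((ebase k P : exterior k m) * x) A = shuffle_sign k P (A :\: P) * x (A :\: P).
Proof.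
move=> sPA; rewrite wedgeE (bigD1 P) //= big1 => [|B /andP[_ ne]].
  by rewrite ebaseE eqxx mul1r addr0.
by rewrite ebaseE (negbTE ne) mul0r mulr0.
Qed.

Lemma homog_top x : homog (fun=> 1%N) m x -> x = x setT *: (ebase k setT : exterior k m).
Proof.
move=> h; apply/ffunP=> A; rewrite extZE ebaseE.
have [->|ne] := eqVneq A setT; first by rewrite mulr1.
rewrite mulr0; apply: (homog_eq0 h); rewrite weight_card => e.
by case/eqP: ne; apply/eqP; rewrite eqEcard subsetT cardsT card_ord e leqnn.
Qed.
End TopCoef.

Lemma pull_top (k : fieldType) m (G : 'M[k]_m) x :
  (pull G x) setT = (pull G (ebase k setT)) setT * x setT.
Proof.
rewrite {1}(ext_basis x) linear_sum ext_sumE (bigD1 setT) //= big1 ?addr0.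
  by rewrite linearZ extZE mulrC.
move=> A ne; rewrite linearZ extZE (homog_eq0 (homog_deg_pull (G := G) (homog_ebase _ (A := A)))) ?mulr0 //.
rewrite !weight_card cardsT card_ord => e.
by case/eqP: ne; apply/eqP; rewrite eqEcard subsetT cardsT card_ord -e leqnn.
Qed.

Section Poincare.
Variables (k : numFieldType) (m : nat).

Definition poincare : exterior k (m + m) := poincare_c1 k m.

Lemma poincareE : poincare = \sum_(i < m) ebase k (set_sum [set i] [set i]).
Proof. apply: eq_bigr => i _; exact: (tensor_ebase k [set i] [set i]). Qed.

Lemma diag_pair_even (i : 'I_m) :
  (ebase k (set_sum [set i] [set i]) : exterior k (m + m)) \in @even_pred k (m + m).
Proof.
apply: (homog_even (@homog_ebase _ _ (fun=> 1%N) _)).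
by rewrite weight_set_sum !weight_card !cards1.
Qed.

Definition diag_pair i := EvenExterior (diag_pair_even i).

Lemma diag_pair_sq i : diag_pair i * diag_pair i = 0.
Proof.
apply: ev_inj; rewrite evM ev0 ebaseM0 // -setI_eq0 setIid.
by apply/set0Pn; exists (lshift m i); rewrite lshift_in_set_sum inE.
Qed.

Lemma diag_pair_prod (A : {set 'I_m}) : exists2 s : k, s != 0 &
  ev (\prod_(i in A) diag_pair i) = s *: (ebase k (set_sum A A) : exterior k (m + m)).
Proof.
have [n] := ubnP #|A|; elim: n A => // n IH A; rewrite ltnS => leA.
have [->|[i iA]] := set_0Vmem A.
  by exists 1; rewrite ?oner_neq0 // big_set0 set_sum0 scale1r.
have [|s s0 es] := IH (A :\ i); first by move: leA; rewrite (cardsD1 i A) iA.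
exists (s * shuffle_sign k (set_sum [set i] [set i]) (set_sum (A :\ i) (A :\ i))).
  by rewrite mulf_neq0 ?shuffle_sign_neq0.
rewrite (big_setD1 i) //= es -scalerAr ebaseM; last first.
  rewrite -setI_eq0 set_sumI -set_sum0 set_sum_eq andbb; apply/eqP/setP=> j.
  by rewrite !inE; case: (j == i).
by rewrite scalerA set_sumU setD1K.
Qed.

Lemma trunc_exp_sum n (I : Type) (r : seq I) (F : I -> even_exterior k n) M : (n < M)%N ->
  (forall i, deg_ge 1 (ev (F i))) -> trunc_exp M (\sum_(i <- r) F i) = \prod_(i <- r) trunc_exp M (F i).
Proof.
move=> ltM h; elim: r => [|i r IH].
  rewrite !big_nil; apply: ev_inj; rewrite ev_trunc_exp ev0 ev1 trunc_exp_positive ?ext_exp0 //.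
  exact: deg_ge0.
rewrite !big_cons -IH trunc_exp_add // => a b le; apply: ev_inj.
rewrite evM !evX ev0 ev_sum; apply: (deg_ge_above (j := (a + b)%N)).
  by apply: deg_geM; apply: deg_geX => //; apply: deg_ge_sum.
exact: leq_trans le.
Qed.

(** The Poincare class is a sum of m commuting elements of square zero, so its
    exponential is the product of the factors 1 + f_i e_i; expanding the product
    leaves, up to sign, the sum over A of f_A e_A. *)
Lemma exp_poincare_coef : exists2 s : {set 'I_m} -> k, (forall A, s A != 0) &
  forall A B, (ext_exp poincare) (set_sum A B) = s A * (A == B)%:R.
Proof.
have [s sP] := choice (fun A =>
  let: ex_intro2 s p q := diag_pair_prod A in ex_intro (fun s => s != 0 /\ _) s (conj p q)).
exists s => [A|A B]; first by case: (sP A).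
have lg i : deg_ge 1 (ev (diag_pair i)).
  apply: (homog_deg_ge _ (@homog_ebase _ _ (fun=> 1%N) _)).
  by rewrite weight_set_sum !weight_card !cards1.
have ec : poincare = ev (\sum_i diag_pair i) by rewrite poincareE ev_sum.
have -> : ext_exp poincare = ev (trunc_exp (m + m).+1 (\sum_i diag_pair i)).
  by rewrite ev_trunc_exp -ec ext_expE.
rewrite trunc_exp_sum //.
have -> : \prod_i trunc_exp (m + m).+1 (diag_pair i) = \sum_(C : {set 'I_m}) \prod_(i in C) diag_pair i.
  rewrite (eq_bigr (fun i => diag_pair i + 1)) => [|i _].
    rewrite (bigA_distr (1 : even_exterior k (m + m)) (mul := *%R) +%R) /=; apply: eq_bigr => C _.
    by rewrite [RHS]big_mkcond.
  rewrite (@trunc_exp_widen _ _ 2); first 2 last.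
  - by have := ltn_ord i; lia.
  - by rewrite /trunc_exp !big_ord_recl big_ord0 /= expr0 expr1 invr1 !scale1r addr0 addrC.
  by rewrite expr2 diag_pair_sq.
rewrite ev_sum ext_sumE (bigD1 A) //= [X in _ + X]big1 ?addr0.
  by rewrite (sP A).2 extZE ebaseE set_sum_eq eqxx /= eq_sym.
move=> C /negbTE ne.
by rewrite (sP C).2 extZE ebaseE set_sum_eq (eq_sym A) ne mulr0.
Qed.
End Poincare.

Section Orlov.
Variables (R : realType) (k : numFieldType) (m : nat) (J : 'M[R]_m).

Local Notation us := (@set_sum m m).

(** The exponential of the Poincare class pairs f_A with e_A only, and the Gysin
    map along the projection takes complements. *)
Lemma phi_P_ebase : exists2 u : {set 'I_m} -> k, (forall B, u B != 0) &
  forall B, phi_P J (ebase k B) = u B *: (ebase k (~: B) : exterior k m).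
Proof.
have [s s0 es] := exp_poincare_coef k m.
pose v B : k := phi_P J (ebase k B) (~: B).
have key B D : exists2 c : k, c != 0 & phi_P J (ebase k B) D = c * (~: B == D)%:R.
  exists ((-1) ^+ negative_basis J * shuffle_sign k D (~: D) *
     ((-1) ^+ negative_basis (product_cs (dual_cs J) J) *
      (shuffle_sign k (~: us set0 (~: D)) (us set0 (~: D)) *
       (shuffle_sign k (us B set0) (us (~: B) D) * s (~: B))))).
    by rewrite !mulf_neq0 ?shuffle_sign_neq0 // signr_eq0.
  rewrite {1}/phi_P ffunE /integral -!mulrA; do 3 congr (_ * _).
  have -> : wedge (wedge (pullback (pr1 k m m) (ebase k B)) (ext_exp (poincare_c1 k m)))
     (pullback (pr2 k m m) (ebase k (~: D))) =
     (pull (pr1 k m m) (ebase k B) * ext_exp (poincare k m)) * pull (pr2 k m m) (ebase k (~: D)) by [].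
  have -> : pull (pr1 k m m) (ebase k B) = ebase k (us B set0).
    by rewrite pull_pr1_ebase /set_sum imset0 setU0.
  have -> : pull (pr2 k m m) (ebase k (~: D)) = ebase k (us set0 (~: D)).
    by rewrite pull_pr2_ebase /set_sum imset0 set0U.
  rewrite mul_ebase_top; congr (_ * _).
  have e : ~: us set0 (~: D) = us setT D by rewrite set_sumC setC0 setCK.
  have e2 : us setT D :\: us B set0 = us (~: B) D.
    by rewrite setDE set_sumC set_sumI setTI setC0 setIT.
  rewrite e ebase_mulE; last first.
    by apply/setIidPl; rewrite set_sumI setIT set0I.
  by rewrite e2 es.
exists v => [B|B]; first by rewrite /v; have [c c0 ->] := key B (~: B); rewrite eqxx mulr1.
apply/ffunP=> D; rewrite extZE ebaseE (eq_sym D).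
have [c _] := key B D; have [<- _|_ ->] := eqVneq (~: B) D; first by rewrite mulr1.
by rewrite !mulr0.
Qed.

Lemma shear_inverse :
  let nu := block_mx 1%:M 0 (- 1%:M) 1%:M : 'M[k]_(m + m) in
  (nu *m mu_mx k m = 1%:M) /\ (mu_mx k m *m nu = 1%:M).
Proof.
rewrite /mu_mx !mulmx_block !mulmx0 !mul0mx !mulmx1 !mul1mx !addr0 !add0r.
by rewrite addNr addrN -!scalar_mx_block.
Qed.

(** The map mu is an automorphism, so the Gysin map is the pullback along the
    inverse of mu, up to the determinant and a sign. *)
Lemma pull_mu_gysin : exists2 c : k, c != 0 & forall z : exterior k (m + m),
  pull (mu_mx k m) (gysin (product_cs J J) (product_cs J J) (mu_mx k m) z) = c *: z.
Proof.
set nu : 'M[k]_(m + m) := block_mx 1%:M 0 (- 1%:M) 1%:M.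
have [numu munu] := shear_inverse; rewrite -/nu in numu munu.
pose d := pull nu (ebase k setT) setT.
have d0 : d != 0.
  apply/eqP=> d0; have := pull_top (mu_mx k m) (pull nu (ebase k setT)).
  rewrite pull_comp munu pull_id -/d d0 mulr0 ebaseE eqxx => /eqP.
  by rewrite oner_eq0.
exists d^-1; first by rewrite invr_eq0.
move=> z; have -> : gysin (product_cs J J) (product_cs J J) (mu_mx k m) z = d^-1 *: pull nu z :> exterior k (m + m).
  apply/ffunP=> A; rewrite extZE /gysin ffunE /integral.
  have := pull_top nu (z * pull (mu_mx k m) (ebase k (~: A))).
  rewrite pullM pull_comp numu pull_id mul_ebase_top setCK -/d => e.
  have -> : pull nu z A = shuffle_sign k A (~: A) * (d * (z * pull (mu_mx k m) (ebase k (~: A))) setT).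
    by rewrite -e mulrA shuffle_sign_sqr mul1r.
  by rewrite (mulrCA d^-1) mulKf // mulrACA -expr2 sqrr_sign mul1r.
by rewrite pullZ pull_comp munu pull_id.
Qed.

Lemma phi_inv_linear : linear (@phi_inv R k m J : exterior k (m + m) -> exterior k (m + m)).
Proof.
move=> a x y; rewrite /phi_inv [X in gysin _ _ _ X](id_tens_linear (phi_P J) a x y).
apply/ffunP=> A; rewrite extDE extZE /gysin !ffunE /integral.
rewrite wedgeDl -wedgeZl extDE extZE.
have distr (b c v w : k) : b * (c * (a * v + w)) = a * (b * (c * v)) + b * (c * w) by ring.
exact: distr.
Qed.

(** Since phi is the inverse of mu_* \o (id (x) phi_P), it is the pullback along
    mu followed by the exchange of e_B and e_(~B) in the second factor, up to
    scalars; in particular the map that it inverts is injective. *)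
Lemma check_phi_coef : exists2 u : {set 'I_m} -> k, (forall B, u B != 0) &
  forall (x : exterior k (m + m)) A B,
    (pull (mu_mx k m) (id_tens (p := m) (@tau k m) x)) (us A (~: B)) = u B * (check_phi J x) (us A B).
Proof.
have [u u0 uE] := phi_P_ebase; have [c c0 cE] := pull_mu_gysin.
have muE y A B : pull (mu_mx k m) (phi_inv J y) (us A (~: B)) = c * u B * y (us A B).
  rewrite cE extZE -mulrA; congr (_ * _).
  by apply: (id_tens_monomial y A B _ uE); apply: can_inj setCK.
exists (fun B => c * u B) => [B|x A B]; first by rewrite mulf_neq0.
pose L := GRing.isLinear.Build k (exterior k (m + m)) (exterior k (m + m)) _ (@phi_inv R k m J) phi_inv_linear.
pose f : {linear exterior k (m + m) -> exterior k (m + m)} := HB.pack (@phi_inv R k m J) L.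
have ker0 : lker (linfun (@phi_inv R k m J)) == 0%VS.
  apply/lker0P => y z; rewrite (lfunE f) (lfunE f) /= => e.
  apply: ext_eq_set_sum => C D; have := muE y C D; rewrite e muE.
  by move/(mulfI (mulf_neq0 c0 (u0 D))).
rewrite -muE; congr (pull _ _ _).
by rewrite -[RHS](lfunE f) /check_phi /phi lker0_lfunVK.
Qed.
End Orlov.

(** * Powers of sums of commuting nilpotent elements *)

Section Nilpotent.
Variables (k : numFieldType) (E : comAlgType k).
Implicit Types (u v w Q : E).

Lemma annihil_add u v Q j : u * Q = 0 -> (u + v) ^+ j * Q = v ^+ j * Q.
Proof.
move=> uQ; elim: j => [|j IH]; first by rewrite !expr0.
rewrite exprSr -mulrA mulrDl uQ add0r mulrCA IH.
by rewrite exprS mulrA.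
Qed.

Lemma annihil_add3 u v Q j : u ^+ 3 * Q = 0 ->
  (v + u) ^+ j.+2 * Q = v ^+ j.+2 * Q + j.+2%:R * (u * v ^+ j.+1 * Q)
     + 'C(j.+2, 2)%:R * (u ^+ 2 * v ^+ j * Q).
Proof.
move=> uQ; elim: j => [|j IH]; first by rewrite binn expr0 expr1; ring.
have -> : j.+3%:R = 1 + j.+2%:R :> E by rewrite mulrS.
rewrite [in RHS]binS bin1 natrD exprS -mulrA IH.
have -> : (v + u) * (v ^+ j.+2 * Q + j.+2%:R * (u * v ^+ j.+1 * Q)
     + 'C(j.+2, 2)%:R * (u ^+ 2 * v ^+ j * Q)) =
   v * v ^+ j.+2 * Q + j.+2%:R * (u * (v * v ^+ j.+1) * Q)
     + 'C(j.+2, 2)%:R * (u ^+ 2 * (v * v ^+ j) * Q) + u * v ^+ j.+2 * Q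
     + j.+2%:R * (u ^+ 2 * v ^+ j.+1 * Q)
     + 'C(j.+2, 2)%:R * v ^+ j * (u ^+ 3 * Q) by ring.
by rewrite uQ mulr0 addr0 -!exprS; ring.
Qed.

Lemma annihil_add2 u v Q j : u ^+ 2 * Q = 0 ->
  (v + u) ^+ j.+1 * Q = v ^+ j.+1 * Q + j.+1%:R * (u * v ^+ j * Q).
Proof.
move=> uQ; elim: j => [|j IH]; first by rewrite expr0 !expr1; ring.
have -> : j.+2%:R = 1 + j.+1%:R :> E by rewrite mulrS.
rewrite exprS -mulrA IH.
have -> : (v + u) * (v ^+ j.+1 * Q + j.+1%:R * (u * v ^+ j * Q)) =
   v * v ^+ j.+1 * Q + j.+1%:R * (u * (v * v ^+ j) * Q)
     + u * v ^+ j.+1 * Q + j.+1%:R * v ^+ j * (u ^+ 2 * Q) by ring.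
by rewrite uQ mulr0 addr0 -!exprS; ring.
Qed.

Lemma pow_two u v a b : u ^+ a.+1 = 0 -> v ^+ b.+1 = 0 ->
  (u + v) ^+ (a + b) = (u ^+ a * v ^+ b) *+ 'C(a + b, b) /\ (u + v) ^+ (a + b).+1 = 0.
Proof.
move=> ua vb.
have u0 j : (a < j)%N -> u ^+ j = 0.
  by move=> lt; rewrite -(subnKC lt) exprD ua mul0r.
have v0 j : (b < j)%N -> v ^+ j = 0.
  by move=> lt; rewrite -(subnKC lt) exprD vb mul0r.
split; rewrite exprDn.
  have lt : (b < (a + b).+1)%N by lia.
  rewrite (bigD1 (Ordinal lt)) //= big1 ?addr0 ?addnK // => i ne.
  case: (ltngtP i b) => [lti|lti|e]; last by case/eqP: ne; apply: val_inj.
    by rewrite u0 ?mul0r ?mul0rn //; lia.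
  by rewrite v0 // mulr0 mul0rn.
rewrite big1 // => i _.
case: (leqP i b) => lti; last by rewrite v0 // mulr0 mul0rn.
by rewrite u0 ?mul0r ?mul0rn //; lia.
Qed.

(** In the multinomial expansion only the exponents (r, ..., r) avoid a factor
    x_i^(r+1).  The scalar is the same in all algebras and for all families. *)
Lemma pow_sum r n : exists2 c : k, c != 0 &
  forall (I : Type) (s : seq I) (x : I -> E), size s = n ->
    (forall i, x i ^+ r.+1 = 0) ->
  (\sum_(i <- s) x i) ^+ (r * n) = c *: \prod_(i <- s) x i ^+ r /\
  (\sum_(i <- s) x i) ^+ (r * n).+1 = 0.
Proof.
elim: n => [|n [c c0 IH]].
  exists 1; first exact: oner_neq0.
  by move=> I [|//] x _ _; rewrite !big_nil muln0 expr0 expr1 scale1r.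
exists (c * 'C(r + r * n, r * n)%:R).
  by rewrite mulf_neq0 // pnatr_eq0 -lt0n bin_gt0 leq_addl.
move=> I [//|i s] x [sz] x0; rewrite !big_cons mulnS.
have [IH1 IH2] := IH _ s x sz x0; have [-> ->] := pow_two (x0 i) IH2; split=> //.
by rewrite IH1 -scalerAr -scaler_nat scalerA mulrC.
Qed.
End Nilpotent.

(** The elements X_i, M_i and Y_i stand for the components of bidegree (2,0), (1,1)
    and (0,2) of the pullback of Theta_i along (x, y) |-> x + y.  The computations
    below use only the relations that these components satisfy. *)
Section ProductModel.
Variables (k : numFieldType) (E : comAlgType k) (I : finType) (r : nat).
Variables X M Y : I -> E.
Hypothesis X0 : forall i, X i ^+ r.+2 = 0.
Hypothesis Y0 : forall i, Y i ^+ r.+2 = 0.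
Hypothesis MX0 : forall i, M i * X i ^+ r.+1 = 0.
Hypothesis MY0 : forall i, M i * Y i ^+ r.+1 = 0.
Hypothesis M3X0 : forall i, M i ^+ 3 * X i ^+ r = 0.
Hypothesis XMY0 : forall i, (X i + M i + Y i) ^+ r.+2 = 0.

Local Notation n := (r.+1 * #|I|)%N.
Local Notation SX := (\sum_i X i).
Local Notation SM := (\sum_i M i).
Local Notation SY := (\sum_i Y i).
Local Notation vol := (SX ^+ n * SY ^+ n).

Lemma sum_pow_full : exists2 c : k, c != 0 & forall x : I -> E, (forall i, x i ^+ r.+2 = 0) ->
  (\sum_i x i) ^+ n = c *: \prod_i x i ^+ r.+1.
Proof.
have [c c0 h] := pow_sum E r.+1 #|I|; exists c => // x x0.
have sz : size (index_enum I) = #|I| by rewrite cardT enumT.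
by have [] := h _ (index_enum I) x sz x0.
Qed.

Lemma sum_pow_but_one : exists2 c : k, c != 0 & forall (x : I -> E) s, (forall i, x i ^+ r.+2 = 0) ->
  (\sum_(i | i != s) x i) ^+ (r.+1 * #|I|.-1) = c *: \prod_(i | i != s) x i ^+ r.+1 /\
  (\sum_(i | i != s) x i) ^+ (r.+1 * #|I|.-1).+1 = 0.
Proof.
have [c c0 h] := pow_sum E r.+1 #|I|.-1; exists c => // x s x0.
have sz : size [seq i <- index_enum I | i != s] = #|I|.-1.
  by rewrite -(cardC1 s) cardE /enum_mem; congr size; apply: eq_filter => i; rewrite inE.
by have := h _ [seq i <- index_enum I | i != s] x sz x0; rewrite !big_filter.
Qed.

(** The power SX^n is a multiple of the product of all the X_i^(r+1). *)
Lemma kill_by_top (f : I -> E) s : f s * X s ^+ r.+1 = 0 -> f s * SX ^+ n = 0.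
Proof.
move=> f0; have [c _ ->] // := sum_pow_full.
by rewrite -scalerAr (bigD1 s) //= mulrA f0 mul0r scaler0.
Qed.

(** The factor SX^n kills all the X_i and M_i, which leaves the n-th power of a sum
    of the Y_i; without Y_s that power is zero. *)
Lemma top_degenerate (a b : I -> k) s : b s = 0 ->
  (\sum_i (a i *: (X i + M i) + b i *: Y i)) ^+ n * SX ^+ n = 0.
Proof.
move=> bs; rewrite big_split /= annihil_add; last first.
  rewrite mulr_suml big1 // => i _; rewrite -scalerAl; apply/eqP; rewrite scaler_eq0.
  apply/orP; right; apply/eqP; apply: (kill_by_top (f := fun i => X i + M i)).
  by rewrite mulrDl MX0 -exprS X0 addr0.
have [c _ ->] := sum_pow_full; last by move=> i; rewrite exprZn Y0 scaler0.
by rewrite (bigD1 s) //= bs scale0r expr0n /= mul0r scaler0 mul0r.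
Qed.

Lemma prod_powD1 (x : I -> E) s :
  x s ^+ r.+1 * (\prod_(i | i != s) x i ^+ r.+1) = \prod_i x i ^+ r.+1.
Proof. by rewrite [RHS](bigD1 s). Qed.

Local Notation XC s := (\sum_(i | i != s) X i).
Local Notation YC s := (\sum_(i | i != s) Y i).

(** The factor SX^n kills SX + SM.  What is left is YC_s^N with
    N = (r+1)(#|I| - 1), a multiple of the product of the Y_i^(r+1) over i <> s;
    only Y_s^(r+1) can complete it. *)
Lemma degree0_detector : exists2 c : k, c != 0 & forall s s',
  (SX + SM + 2%:R *: YC s) ^+ (r.+1 * #|I|.-1) * (SX ^+ n * Y s' ^+ r.+1) =
  (c * (s == s')%:R) *: vol.
Proof.
have [c c0 cE] := sum_pow_full; have [c' c'0 c'E] := sum_pow_but_one.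
exists (2%:R ^+ (r.+1 * #|I|.-1) * c' / c) => [|s s'].
  by rewrite !mulf_neq0 ?invr_eq0 // expf_neq0 // pnatr_eq0.
rewrite [SX ^+ n * _]mulrC mulrCA annihil_add; last first.
  rewrite -big_split mulr_suml big1 // => i _.
  apply: (kill_by_top (f := fun i => X i + M i)).
  by rewrite mulrDl MX0 -exprS X0 addr0.
rewrite exprZn; have [-> _] := c'E Y s Y0.
rewrite -!scalerAl -!scalerAr scalerA mulrA.
have [->|ne] := eqVneq s s'; last first.
  rewrite (bigD1 s') /=; last by rewrite eq_sym.
  set P := \prod_(_ | _) _.
  have -> : Y s' ^+ r.+1 * (Y s' ^+ r.+1 * P) = Y s' ^+ r.+2 * (Y s' ^+ r * P).
    by rewrite !exprS; ring.
  by rewrite Y0 !mul0r mulr0 scaler0 scale0r.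
rewrite prod_powD1 mulr1 (cE _ Y0) -scalerAr scalerA divfK //.
by rewrite [_ * SX ^+ _]mulrC.
Qed.

(** After multiplication by X_i^r the expansion of (X_i + M_i + Y_i)^(r+2) = 0 has
    only two nonzero terms: those with M_i^2 Y_i^r and with X_i Y_i^(r+1). *)
Lemma middle_square i :
  (M i ^+ 2 * (X i ^+ r * Y i ^+ r)) *+ r.+1 = - (X i ^+ r.+1 * Y i ^+ r.+1) *+ 2.
Proof.
have := congr1 (fun z => z * X i ^+ r) (XMY0 i); rewrite mul0r addrC.
have u2 : (X i + M i) ^+ 2 * X i ^+ r = M i ^+ 2 * X i ^+ r.
  have -> : (X i + M i) ^+ 2 * X i ^+ r = X i ^+ r.+2 + 2%:R * (M i * X i ^+ r.+1) + M i ^+ 2 * X i ^+ r.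
    by rewrite !exprS; ring.
  by rewrite X0 MX0 mulr0 !add0r.
rewrite annihil_add3; last first.
  rewrite exprS -mulrA u2.
  have -> : (X i + M i) * (M i ^+ 2 * X i ^+ r) = M i * (M i * X i ^+ r.+1) + M i ^+ 3 * X i ^+ r.
    by rewrite !exprS; ring.
  by rewrite MX0 M3X0 mulr0 addr0.
rewrite Y0 mul0r add0r.
have -> : (X i + M i) * Y i ^+ r.+1 * X i ^+ r = X i ^+ r.+1 * Y i ^+ r.+1 + X i ^+ r * (M i * Y i ^+ r.+1).
  by rewrite !exprS; ring.
rewrite MY0 mulr0 addr0.
rewrite [(X i + M i) ^+ 2 * _]mulrC -mulrA u2.
have -> : Y i ^+ r * (M i ^+ 2 * X i ^+ r) = M i ^+ 2 * (X i ^+ r * Y i ^+ r) by ring.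
set A := M i ^+ 2 * _; set B := X i ^+ r.+1 * _ => e.
have c2 : 2%:R * 'C(r.+2, 2)%:R = r.+2%:R * r.+1%:R :> E.
  by rewrite -!natrM -mul_bin_diag bin1.
have e2 : r.+2%:R * (B *+ 2 + A *+ r.+1) = 0.
  rewrite -(mulr0 2%:R) -e [RHS]mulrDr [2%:R * ('C(_, _)%:R * A)]mulrA c2 -mulr_natl -[A *+ _]mulr_natl; ring.
have : (r.+2%:R : k)^-1 *: (r.+2%:R * (B *+ 2 + A *+ r.+1)) = 0 by rewrite e2 scaler0.
rewrite mulr_natl -scaler_nat scalerA mulVf ?pnatr_eq0 // scale1r => /eqP.
by rewrite addrC addr_eq0 mulNrn => /eqP.
Qed.

(** The multiplier Q is killed by SX and by M_i for i <> s', and M_s'^2 Q = 0.  So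
    the power contributes only the term of degree 1 in SM, which is
    (N+1) M_s' (2 YC_s)^N; the product is zero for s <> s' because
    M_s' Y_s'^(r+1) = 0, and for s = s' it is computed by [middle_square]. *)
Lemma degree1_detector : (0 < #|I|)%N -> exists2 c : k, c != 0 & forall s s',
  (SX + SM + 2%:R *: YC s) ^+ (r.+1 * #|I|.-1).+1 *
    (M s' * (X s' ^+ r * XC s' ^+ (r.+1 * #|I|.-1)) * Y s' ^+ r) =
  (c * (s == s')%:R) *: vol.
Proof.
move=> I0; have [c c0 cE] := sum_pow_full; have [c' c'0 c'E] := sum_pow_but_one.
set N := (r.+1 * #|I|.-1)%N in c'E *.
exists (N.+1%:R * 2%:R ^+ N * c' * c' * (- 2%:R / r.+1%:R) / c / c) => [|s s'].
  rewrite !mulf_neq0 ?invr_eq0 ?oppr_eq0 ?pnatr_eq0 //.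
  by rewrite expf_neq0 // pnatr_eq0.
have [XCE XC0] := c'E X s' X0; have [YCE YC0] := c'E Y s Y0.
rewrite XCE; set PX := \prod_(i | i != s') X i ^+ r.+1.
set Q := M s' * _ * _.
have offX f i : i != s' -> f i * X i ^+ r.+1 = 0 -> f i * Q = 0.
  move=> ne f0; rewrite /Q /PX (bigD1 i) //= -!scalerAr -scalerAl -scalerAr.
  set P := \prod_(_ | _) _.
  have -> : f i * (M s' * (X s' ^+ r * (X i ^+ r.+1 * P)) * Y s' ^+ r) =
     (f i * X i ^+ r.+1) * (M s' * X s' ^+ r * P * Y s' ^+ r) by ring.
  by rewrite f0 mul0r scaler0.
have SXQ : SX * Q = 0.
  rewrite mulr_suml big1 // => i _; have [->|ne] := eqVneq i s'; last first.
    by apply: offX => //; rewrite -exprS X0.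
  have -> : X s' * Q = (M s' * X s' ^+ r.+1) * ((c' *: PX) * Y s' ^+ r) by rewrite /Q exprS; ring.
  by rewrite MX0 mul0r.
have SMQ : SM * Q = M s' * Q.
  rewrite mulr_suml (bigD1 s') //= big1 ?addr0 // => i ne.
  by apply: offX => //; rewrite MX0.
have SM2Q : SM ^+ 2 * Q = 0.
  rewrite expr2 -mulrA SMQ mulrCA SMQ.
  have -> : M s' * (M s' * Q) = (M s' ^+ 3 * X s' ^+ r) * ((c' *: PX) * Y s' ^+ r) by rewrite /Q; ring.
  by rewrite M3X0 mul0r.
rewrite -addrA annihil_add // addrC annihil_add2 // exprZn YC0 scaler0 mul0r add0r.
rewrite (mulrC SM) -(mulrA _ SM) SMQ exprZn YCE.
have [->|ne] := eqVneq s s'; last first.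
  rewrite (bigD1 s') /=; last by rewrite eq_sym.
  set P := \prod_(_ | _) _.
  have -> : (2%:R ^+ N *: (c' *: (Y s' ^+ r.+1 * P))) * (M s' * Q) =
     2%:R ^+ N *: (c' *: ((M s' * Y s' ^+ r.+1) * (P * Q))).
    by rewrite -!scalerAl; congr (_ *: (_ *: _)); ring.
  by rewrite MY0 mul0r !scaler0 !mulr0 scale0r.
rewrite mulr1 -/PX; set PY := \prod_(i | i != s') Y i ^+ r.+1.
have -> : (2%:R ^+ N *: (c' *: PY)) * (M s' * Q) =
   (2%:R ^+ N * c' * c') *: (PX * PY * (M s' ^+ 2 * (X s' ^+ r * Y s' ^+ r))).
  rewrite /Q -!scalerA -!scalerAl -!scalerAr -!scalerAl -!scalerAr; congr (_ *: (_ *: (_ *: _))); ring.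
have -> : M s' ^+ 2 * (X s' ^+ r * Y s' ^+ r) = (- 2%:R / r.+1%:R) *: (X s' ^+ r.+1 * Y s' ^+ r.+1).
  have r0 : (r.+1%:R : k) != 0 by rewrite pnatr_eq0.
  apply: (scalerI r0); rewrite scalerA (mulrC r.+1%:R) divfK // scaler_nat middle_square.
  by rewrite scaleNr scaler_nat mulNrn.
rewrite mulr_natl -scaler_nat -scalerAr !scalerA.
rewrite (cE X X0) (cE Y Y0) -scalerAl -scalerAr !scalerA !(divfK c0) !mulrA.
congr (_ *: _); rewrite -(prod_powD1 X s') -(prod_powD1 Y s') /PX /PY; ring.
Qed.
End ProductModel.

(** * The top power of a nondegenerate 2-form *)

Lemma homog_ebase1 (k : fieldType) m (i : 'I_m) : homog (fun=> 1%N) 1 (ebase k [set i] : exterior k m).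
Proof. by have := @homog_ebase k m (fun=> 1%N) [set i]; rewrite weight_card cards1. Qed.

Section Nondegenerate.
Variables (k : numFieldType) (m : nat).
Local Notation E := (exterior k m).
Local Notation e1 i := (ebase k [set i] : exterior k m).
Variable Th : E.
Hypothesis Th2 : homog (fun=> 1%N) 2 Th.

Lemma ebase_pair (i j : 'I_m) : (i < j)%N -> ebase k [set i; j] = e1 i * e1 j.
Proof.
move=> lt; rewrite ebaseM ?disjoints1 ?inE ?shuffle_sign1l; last first.
  by rewrite -val_eqE /= ltn_eqF.
rewrite eq_card0 ?scale1r // => b; rewrite !inE; apply/negP=> /andP[/eqP -> lt'].
by have := ltn_trans lt lt'; rewrite ltnn.
Qed.

Lemma degree2_sum : Th = \sum_(i < m) \sum_(j < m | (i < j)%N) Th [set i; j] *: (e1 i * e1 j).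
Proof.
apply/ffunP=> A; rewrite ext_sumE.
have [e|ne] := eqVneq (Th A) 0.
  rewrite e big1 // => i _; rewrite ext_sumE big1 // => j lt.
  rewrite extZE -ebase_pair // ebaseE; case: eqP => [<-|_]; rewrite ?mulr0 //.
  by rewrite e mul0r.
have cA : #|A| == 2 by rewrite -weight_card (Th2 ne).
have [a [b [ab eA]]] := cards2P _ cA.
wlog lt : a b ab eA / (a < b)%N.
  move=> h; have [lt|lt|/val_inj e] := ltngtP a b; first exact: (h a b).
    by apply: (h b a) => //; rewrite 1?eq_sym // eA setUC.
  by rewrite e eqxx in ab.
have eset (i j : 'I_m) : (i < j)%N -> ([set a; b] == [set i; j]) = (i == a) && (j == b).
  move=> lij; apply/eqP/andP=> [/setP e|[/eqP -> /eqP ->] //].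
  have := e a; have := e b; rewrite !inE !eqxx /= orbT => /esym/orP h1 /esym/orP h2.
  case: h1 => /eqP h1; case: h2 => /eqP h2; subst; rewrite ?eqxx // in ab *.
  by have := ltn_trans lt lij; rewrite ltnn.
rewrite eA (bigD1 a) //= ext_sumE (bigD1 b) //= extZE -ebase_pair // ebaseE eqxx mulr1.
rewrite big1 ?addr0 => [|j /andP[lj ne']]; last first.
  by rewrite extZE -ebase_pair // ebaseE eset // (negbTE ne') andbF mulr0.
rewrite big1 ?addr0 // => i ne'; rewrite ext_sumE big1 // => j lj.
by rewrite extZE -ebase_pair // ebaseE eset // (negbTE ne') mulr0.
Qed.

Definition contraction (v : 'rV[k]_m) : 'cV[k]_m :=
  \sum_(i < m) \sum_(j < m | (i < j)%N) Th [set i; j] *: (v 0 i *: delta_mx j 0 - v 0 j *: delta_mx i 0).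

Lemma form2_contraction u v : form2 Th u v = (v *m contraction u) 0 0.
Proof.
rewrite mulmx_sumr summxE; apply: eq_bigr => i _; rewrite mulmx_sumr summxE.
apply: eq_bigr => j _; rewrite -scalemxAr mxE mulmxBr -!scalemxAr -!colE !mxE.
by congr (_ * _); rewrite mulrC; congr (_ - _); rewrite mulrC.
Qed.

Lemma contraction_linear : linear contraction.
Proof.
move=> a u v; rewrite /contraction scaler_sumr -big_split; apply: eq_bigr => i _ /=.
rewrite scaler_sumr -big_split; apply: eq_bigr => j _ /=.
rewrite scalerA mulrC -scalerA -scalerDr; congr (_ *: _).
by rewrite !mxE !scalerDl !scalerBr !scalerA; rewrite opprD addrACA.
Qed.

(** The map (x, u) |-> x v + u from k (+) k^m to k^m pulls Th back to
    Th + e_0 /\ i_v(Th).  As pullback is a ring morphism, powers of this element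
    give the derivation property of the contraction i_v on powers of Th. *)
Lemma pull_line v :
  pull (col_mx v 1%:M : 'M_(1 + m, m)) Th =
  pull (pr2 k 1 m) Th + (ebase k [set lshift m (0 : 'I_1)] : exterior k (1 + m)) *
    pull (pr2 k 1 m) (linform (contraction v)).
Proof.
set e0 : exterior k (1 + m) := ebase _ _; set Yp := pull (pr2 k 1 m).
have pbe i : pull (col_mx v 1%:M : 'M_(1 + m, m)) (e1 i) = v 0 i *: e0 + Yp (e1 i).
  rewrite -linform_delta pull_linform /Yp pull_linform /e0 -linform_delta -!linearZ -linearD; congr linform.
  rewrite /pr2 !mul_col_mx mul1mx mul0mx; apply/colP=> j; rewrite !mxE.
  case: split_ordP => l -> /=; rewrite !mxE ?ord1 ?eqxx ?mulr1 ?addr0.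
    by rewrite (bigD1 i) //= big1 ?addr0 => [|b ne]; rewrite ?mxE ?eqxx ?mulr1 // (negbTE ne) mulr0.
  by rewrite mulr0 add0r.
have pullTh p (G : 'M_(p, m)) : pull G Th =
    \sum_(i < m) \sum_(j < m | (i < j)%N) Th [set i; j] *: (pull G (e1 i) * pull G (e1 j)).
  rewrite {1}degree2_sum pull_sum; apply: eq_bigr => i _; rewrite pull_sum.
  by apply: eq_bigr => j _; rewrite pullZ pullM.
have pbc : Yp (linform (contraction v)) =
    \sum_(i < m) \sum_(j < m | (i < j)%N) Th [set i; j] *: (v 0 i *: Yp (e1 j) - v 0 j *: Yp (e1 i)).
  rewrite /Yp linform_sum pull_sum; apply: eq_bigr => i _; rewrite linform_sum pull_sum.
  apply: eq_bigr => j _; rewrite linformZ pullZ linformB !linformZ !linform_delta; congr (_ *: _).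
  by rewrite pullB !pullZ.
rewrite pbc /Yp !pullTh -/Yp mulr_sumr -big_split; apply: eq_bigr => i _ /=.
rewrite mulr_sumr -big_split; apply: eq_bigr => j lt /=.
rewrite -scalerAr -scalerDr; congr (_ *: _).
rewrite !pbe.
have anti : Yp (e1 i) * e0 = - (e0 * Yp (e1 i)).
  by rewrite /Yp /e0 -!linform_delta pull_linform linform_anti.
rewrite mulrDl !mulrDr -!scalerAl -!scalerAr ebase1_sq !scaler0 add0r anti.
by rewrite mulrN -!scalerAr scalerN [RHS]addrC addrA addrAC.
Qed.

Hypothesis nondeg : forall u, u != 0 -> exists v, form2 Th u v != 0.

Lemma contraction_surj (xi : 'cV_m) : exists v, contraction v = xi.
Proof.
pose L := GRing.isLinear.Build k 'rV[k]_m 'cV[k]_m _ contraction contraction_linear.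
pose f : {linear 'rV[k]_m -> 'cV[k]_m} := HB.pack contraction L.
pose g : 'Hom('rV[k]_m, 'cV[k]_m) := linfun f.
have ker0 : (lker g == 0)%VS.
  rewrite -subv0; apply/subvP=> u; rewrite memv_ker memv0 lfunE /=.
  apply: contraLR => /nondeg[v]; rewrite form2_contraction; apply: contraNneq => /= ->.
  by rewrite mulmx0 mxE.
have imT : limg g = fullv.
  apply/eqP; rewrite eqEdim subvf /=; have := limg_ker_dim g fullv.
  by rewrite capfv (eqP ker0) dimv0 add0n => ->; rewrite !dimvf /dim /= muln1 mul1n.
have : xi \in limg g by rewrite imT memvf.
by case/memv_imgP=> v _ ->; exists v; rewrite lfunE.
Qed.

(** Comparing the terms with e_0 in Th^(j+1) gives (j+1) i_v(Th) Th^j = 0.  Every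
    linear form is some i_v(Th), so e_i Th^j = 0 for all i, which is impossible
    below the top degree unless Th^j = 0. *)
Lemma pow_descent j : (2 * j < m)%N -> Th ^+ j.+1 = 0 -> Th ^+ j = 0.
Proof.
move=> lt Thj.
have hTj := homogX (n := j) Th2.
have e1T i : e1 i * Th ^+ j = 0.
  have [v cv] := contraction_surj (delta_mx i 0).
  have := pull_line v; rewrite cv linform_delta.
  set e0 : exterior k (1 + m) := ebase _ _; set Yp := pull (pr2 k 1 m) => pE.
  have e0h : homog (fun=> 1%N) 1 e0 by exact: homog_ebase1.
  have e1h : homog (fun=> 1%N) 1 (e1 i) by exact: homog_ebase1.
  have hU : e0 * Yp (e1 i) \in @even_pred k (1 + m).
    exact: (homog_even (homogM e0h (homog_deg_pull e1h))).
  have hV : Yp Th \in @even_pred k (1 + m) by apply: (homog_even (homog_deg_pull Th2)).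
  have anti : Yp (e1 i) * e0 = - (e0 * Yp (e1 i)).
    by rewrite /Yp /e0 -!linform_delta pull_linform linform_anti.
  have U2 : EvenExterior hU ^+ 2 * 1 = 0.
    apply: ev_inj; rewrite mulr1 expr2 evM ev0 /=.
    by rewrite mulrA -(mulrA e0) anti mulrN mulrA ebase1_sq mul0r oppr0 mul0r.
  have := annihil_add2 (EvenExterior hV) j U2; rewrite !mulr1.
  rewrite mulr_natl -scaler_nat => /(congr1 (@ev _ _)).
  rewrite evX !evD evZ evM !evX /= -pE -!pullX Thj !linear0 add0r => /esym.
  move/eqP; rewrite scaler_eq0 pnatr_eq0 /= => /eqP.
  rewrite -mulrA -pullM => e; apply/ffunP=> A.
  have := tensorE (ebase k [set (0 : 'I_1)]) (e1 i * Th ^+ j) [set (0 : 'I_1)] A.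
  rewrite /tensor pull_pr1_ebase imset_set1 -/e0 [e0 * _]e ext0E ebaseE eqxx mul1r => <-.
  by rewrite ext0E.
apply/ffunP=> A; rewrite ext0E.
have [eA|[i iA]] := set_0Vmem (~: A).
  have -> : A = setT by rewrite -[A]setCK eA setC0.
  by apply: (homog_eq0 hTj); rewrite weight_card cardsT card_ord mulnC; lia.
have iA' : i \notin A by rewrite inE in iA.
have := congr1 (fun z : exterior k m => z (i |: A)) (e1T i).
rewrite /= ebase_mulE ?sub1set ?setU11 // ext0E setU1K // => /eqP.
by rewrite mulf_eq0 (negbTE (shuffle_sign_neq0 _ _ _)) => /eqP.
Qed.

Lemma nondegenerate_pow n : (2 * n = m)%N -> Th ^+ n != 0.
Proof.
move=> e; have {e} le : (2 * n <= m)%N by rewrite e.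
elim: n le => [|n IH] le; first by rewrite expr0 oner_neq0.
apply: contra_neq (IH _) => [/pow_descent ->//|]; lia.
Qed.
End Nondegenerate.

(** * Bidegrees of a form pulled back along the addition map *)

Definition wt_left m n (i : 'I_(m + n)) : nat := if split i is inl _ then 1 else 0.
Definition wt_right m n (i : 'I_(m + n)) : nat := if split i is inl _ then 0 else 1.

Lemma weight_left m n (A : {set 'I_m}) (B : {set 'I_n}) : weight (@wt_left m n) (set_sum A B) = #|A|.
Proof.
rewrite weight_set_sum /weight.
rewrite (eq_bigr (fun=> 1%N)) => [|i _]; last by rewrite /wt_left (unsplitK (inl i)).
rewrite [X in (_ + X)%N](eq_bigr (fun=> 0%N)) => [|i _]; last by rewrite /wt_left (unsplitK (inr i)).
by rewrite [X in (_ + X)%N]big1 // sum1_card addn0.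
Qed.

Lemma weight_right m n (A : {set 'I_m}) (B : {set 'I_n}) : weight (@wt_right m n) (set_sum A B) = #|B|.
Proof.
rewrite weight_set_sum /weight.
rewrite (eq_bigr (fun=> 0%N)) => [|i _]; last by rewrite /wt_right (unsplitK (inl i)).
rewrite [X in (_ + X)%N](eq_bigr (fun=> 1%N)) => [|i _]; last by rewrite /wt_right (unsplitK (inr i)).
by rewrite [X in (X + _)%N]big1 // sum1_card.
Qed.

Section Mixed.
Variables (k : numFieldType) (m : nat).
Implicit Types (Th : exterior k m).

Definition fst_part Th := pull (pr1 k m m) Th.
Definition snd_part Th := pull (pr2 k m m) Th.
Definition mix_part Th := pull (col_mx 1%:M 1%:M : 'M[k]_(m + m, m)) Th - fst_part Th - snd_part Th.

Lemma parts_sum Th : fst_part Th + mix_part Th + snd_part Th = pull (col_mx 1%:M 1%:M) Th.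
Proof. by rewrite /mix_part -addrA subrK addrC subrK. Qed.

Variables (N : nat) (c c' : 'I_N -> 'cV[k]_m).
Local Notation Th := (\sum_j linform (c j) * linform (c' j) : exterior k m).

Let fx (a : 'cV_m) : exterior k (m + m) := linform (col_mx a 0).
Let fy (a : 'cV_m) : exterior k (m + m) := linform (col_mx 0 a).

Let fxy a : pull (col_mx 1%:M 1%:M : 'M[k]_(m + m, m)) (linform a) = fx a + fy a.
Proof. by rewrite pull_linform mul_col_mx mul1mx -linformD add_col_mx addr0 add0r. Qed.
Let fxE a : pull (pr1 k m m) (linform a) = fx a.
Proof. by rewrite pull_linform mul_col_mx mul1mx mul0mx. Qed.
Let fyE a : pull (pr2 k m m) (linform a) = fy a.
Proof. by rewrite pull_linform mul_col_mx mul1mx mul0mx. Qed.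

Lemma fst_partE : fst_part Th = \sum_j fx (c j) * fx (c' j).
Proof. by rewrite /fst_part pull_sum; apply: eq_bigr => j _; rewrite pullM !fxE. Qed.
Lemma snd_partE : snd_part Th = \sum_j fy (c j) * fy (c' j).
Proof. by rewrite /snd_part pull_sum; apply: eq_bigr => j _; rewrite pullM !fyE. Qed.
Lemma mix_partE : mix_part Th = \sum_j (fx (c j) * fy (c' j) + fy (c j) * fx (c' j)).
Proof.
rewrite /mix_part fst_partE snd_partE pull_sum -!sumrB; apply: eq_bigr => j _.
rewrite pullM !fxy mulrDl !mulrDr.
by apply/eqP; rewrite !subr_eq -addrA addrC addrA.
Qed.

Let fx_left a : homog (@wt_left m m) 1 (fx a).
Proof. by apply: homog_linform => i; rewrite mxE /wt_left; case: splitP => // j _; rewrite mxE eqxx. Qed.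
Let fx_right a : homog (@wt_right m m) 0 (fx a).
Proof. by apply: homog_linform => i; rewrite mxE /wt_right; case: splitP => // j _; rewrite mxE eqxx. Qed.
Let fy_left a : homog (@wt_left m m) 0 (fy a).
Proof. by apply: homog_linform => i; rewrite mxE /wt_left; case: splitP => // j _; rewrite mxE eqxx. Qed.
Let fy_right a : homog (@wt_right m m) 1 (fy a).
Proof. by apply: homog_linform => i; rewrite mxE /wt_right; case: splitP => // j _; rewrite mxE eqxx. Qed.

Lemma fst_part_left : homog (@wt_left m m) 2 (fst_part Th).
Proof. by rewrite fst_partE; apply: homog_sum => j _; exact: (homogM (@fx_left _) (@fx_left _)). Qed.
Lemma fst_part_right : homog (@wt_right m m) 0 (fst_part Th).
Proof. by rewrite fst_partE; apply: homog_sum => j _; exact: (homogM (@fx_right _) (@fx_right _)). Qed.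
Lemma snd_part_left : homog (@wt_left m m) 0 (snd_part Th).
Proof. by rewrite snd_partE; apply: homog_sum => j _; exact: (homogM (@fy_left _) (@fy_left _)). Qed.
Lemma snd_part_right : homog (@wt_right m m) 2 (snd_part Th).
Proof. by rewrite snd_partE; apply: homog_sum => j _; exact: (homogM (@fy_right _) (@fy_right _)). Qed.
Lemma mix_part_left : homog (@wt_left m m) 1 (mix_part Th).
Proof.
rewrite mix_partE; apply: homog_sum => j _; apply: homogD.
  exact: (homogM (@fx_left _) (@fy_left _)).
exact: (homogM (@fy_left _) (@fx_left _)).
Qed.
Lemma mix_part_right : homog (@wt_right m m) 1 (mix_part Th).
Proof.
rewrite mix_partE; apply: homog_sum => j _; apply: homogD.
  exact: (homogM (@fx_right _) (@fy_right _)).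
exact: (homogM (@fy_right _) (@fx_right _)).
Qed.

Lemma two_form_degree : homog (fun=> 1%N) 2 Th.
Proof. by apply: homog_sum => j _; apply: (@homogM _ _ _ 1 1); apply: homog_linform. Qed.
End Mixed.

(** Having a form of rank at most d is used only through this factorization: the
    relations between the components of Th can then be checked by a degree count
    on a space of dimension d. *)
Definition pulled_from (k : numFieldType) (m d : nat) (Th : exterior k m) : Prop :=
  exists (B : 'M[k]_(m, d)) N (c c' : 'I_N -> 'cV[k]_d),
    Th = pull B (\sum_j linform (c j) * linform (c' j)).

Lemma pulled_deg2 (k : numFieldType) m d (x : exterior k m) : pulled_from d x -> homog (fun=> 1%N) 2 x.
Proof. by move=> [B [N [c [c' ->]]]]; apply: homog_deg_pull; exact: two_form_degree. Qed.

Lemma pulled_nilpotent (k : numFieldType) m r (x : exterior k m) : pulled_from (2 * r.+1) x -> x ^+ r.+2 = 0.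
Proof.
move=> [B [N [c [c' ->]]]]; rewrite -pullX.
rewrite (homog_above (homogX (n := r.+2) (@two_form_degree _ _ _ c c'))) ?linear0 //.
by rewrite weight_card cardsT card_ord; lia.
Qed.

Section Relations.
Variables (k : numFieldType) (m r : nat) (Th : exterior k m).
Hypothesis ThB : pulled_from (2 * r.+1) Th.

(** All the relations already hold on the space of dimension d = 2(r+1): the
    first five elements have left or right degree greater than d, and the
    last one is the pullback of Th^(r+2). *)
Lemma pulled_relations :
  [/\ fst_part Th ^+ r.+2 = 0, snd_part Th ^+ r.+2 = 0,
      mix_part Th * fst_part Th ^+ r.+1 = 0, mix_part Th * snd_part Th ^+ r.+1 = 0
    & mix_part Th ^+ 3 * fst_part Th ^+ r = 0] /\
  (fst_part Th + mix_part Th + snd_part Th) ^+ r.+2 = 0.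
Proof.
have [B [N [c [c' eTh]]]] := ThB; set d := (2 * r.+1)%N in B c c' eTh.
set th := \sum_j _ in eTh.
pose P : 'M[k]_(m + m, d + d) := block_mx B 0 0 B.
have eX : fst_part Th = pull P (fst_part th).
  rewrite /fst_part eTh !pull_comp; congr (pull _ _).
  by rewrite /P /pr1 mul_block_col mul_col_mx !(mulmx1, mulmx0, mul1mx, mul0mx, addr0, add0r).
have eY : snd_part Th = pull P (snd_part th).
  rewrite /snd_part eTh !pull_comp; congr (pull _ _).
  by rewrite /P /pr2 mul_block_col mul_col_mx !(mulmx1, mulmx0, mul1mx, mul0mx, addr0, add0r).
have eM : mix_part Th = pull P (mix_part th).
  rewrite /mix_part eX eY !pullB eTh !pull_comp; congr (pull _ _ - _ - _).
  by rewrite /P mul_block_col mul_col_mx !(mulmx1, mulmx0, mul1mx, mul0mx, addr0, add0r).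
have th0 : th ^+ r.+2 = 0.
  apply: (homog_above (homogX (n := r.+2) (@two_form_degree _ _ _ c c'))).
  by rewrite weight_card cardsT card_ord /d; lia.
have xl : homog (@wt_left _ _) 2 (fst_part th) := @fst_part_left _ _ _ c c';
have xr : homog (@wt_right _ _) 0 (fst_part th) := @fst_part_right _ _ _ c c'.
have yl : homog (@wt_left _ _) 0 (snd_part th) := @snd_part_left _ _ _ c c';
have yr : homog (@wt_right _ _) 2 (snd_part th) := @snd_part_right _ _ _ c c'.
have ml : homog (@wt_left _ _) 1 (mix_part th) := @mix_part_left _ _ _ c c';
have mr : homog (@wt_right _ _) 1 (mix_part th) := @mix_part_right _ _ _ c c'.
have p0 : pull P 0 = 0 by apply: linear0.
have Lw : weight (@wt_left d d) setT = d by rewrite -set_sumT weight_left cardsT card_ord.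
have Rw : weight (@wt_right d d) setT = d by rewrite -set_sumT weight_right cardsT card_ord.
split; last by rewrite parts_sum eTh -!pullX th0 !linear0.
split.
- by rewrite eX -[LHS]pullX (homog_above (homogX (n := r.+2) xl)) // Lw /d; lia.
- by rewrite eY -[LHS]pullX (homog_above (homogX (n := r.+2) yr)) // Rw /d; lia.
- rewrite eM eX -(pullX P (fst_part th)) -[LHS]pullM.
  by rewrite (homog_above (homogM ml (homogX (n := r.+1) xl))) // Lw /d; lia.
- rewrite eM eY -(pullX P (snd_part th)) -[LHS]pullM.
  by rewrite (homog_above (homogM mr (homogX (n := r.+1) yr))) // Rw /d; lia.
rewrite eM eX -(pullX P (fst_part th)) -(pullX P (mix_part th)) -[LHS]pullM.
by rewrite (homog_above (homogM (homogX (n := 3) ml) (homogX (n := r) xl))) // Lw /d; lia.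
Qed.
End Relations.

(** * Rational cohomology as a vector space over the totally real field *)

Section Generators.
Variables (L : fieldExtType rat) (m : nat) (eta : {rmorphism L -> 'M[rat]_m}).
Local Notation g := (\dim {:L}).
Implicit Types (v : nat -> 'rV[rat]_m) (a : nat -> L).

Definition module_comb k v (a : {ffun 'I_k -> L}) : 'rV[rat]_m := \sum_(j < k) v j *m eta (a j).

Lemma module_comb_is_linear k v : linear (@module_comb k v).
Proof.
move=> c a b; rewrite /module_comb scaler_sumr -big_split; apply: eq_bigr => j _ /=.
by rewrite !ffunE rmorphD (rat_linear (raddfB eta)) mulmxDr -scalemxAr.
Qed.
HB.instance Definition _ k v :=
  GRing.isLinear.Build rat {ffun 'I_k -> L} 'rV[rat]_m _ (@module_comb k v) (@module_comb_is_linear k v).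

Lemma module_comb_dim k v : (\dim (limg (linfun (@module_comb k v))) <= k * g)%N.
Proof.
have e := limg_ker_dim (linfun (@module_comb k v)) fullv.
apply: (@leq_trans (\dim {: {ffun 'I_k -> L}})); first by rewrite -e leq_addl.
by rewrite !dimvf /dim /= card_ord.
Qed.

(** A new vector is chosen outside the span of the previous ones.  Since that span
    is stable under L, a nonzero coefficient of the new vector could be divided
    out. *)
Lemma module_comb_free k : (k * g <= m)%N -> exists v, forall a : {ffun 'I_k -> L}, module_comb v a = 0 -> a = 0.
Proof.
elim: k => [|k IH] le; first by exists (fun=> 0) => a _; apply/ffunP=> -[].
have g0 : (0 < g)%N by rewrite adim_gt0.
have [|v vfree] := IH; first by apply: leq_trans le; rewrite leq_mul2r leqnSn orbT.
have [u uN] : exists u, u \notin limg (linfun (@module_comb k v)).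
  have : ~~ (fullv <= limg (linfun (@module_comb k v)))%VS.
    apply: contraTN le => /dimvS; rewrite dimvf /dim /= mul1n => le.
    have := leq_trans le (module_comb_dim k v); rewrite mulSn -ltnNge => le'.
    by rewrite (leq_ltn_trans le') // -{1}[(k * g)%N]add0n ltn_add2r.
  by case/subvPn=> u _ uN; exists u.
exists (fun j => if j == k then u else v j) => a.
set w := a ord_max.
have -> : module_comb (fun j => if j == k then u else v j) a =
    \sum_(j < k) v j *m eta (a (widen_ord (leqnSn k) j)) + u *m eta w.
  rewrite /module_comb big_ord_recr /= eqxx; congr (_ + _).
  by apply: eq_bigr => j _; rewrite ltn_eqF.
move=> e.
have w0 : w = 0.
  apply/eqP; apply: contraNT uN => wN0; apply/memv_imgP.
  exists [ffun j : 'I_k => - a (widen_ord (leqnSn k) j) / w]; rewrite ?memvf // lfunE /= /module_comb.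
  under eq_bigr => j _ do rewrite ffunE rmorphM rmorphN mulmxA.
  rewrite -mulmx_suml.
  have -> : \sum_(j < k) v j *m - eta (a (widen_ord (leqnSn k) j)) = u *m eta w.
    rewrite (eq_bigr (fun j : 'I_k => - (v j *m eta (a (widen_ord (leqnSn k) j))))).
      by rewrite sumrN; apply/eqP; rewrite eqr_oppLR -addr_eq0; apply/eqP.
    by move=> j _; rewrite mulmxN.
  by rewrite -mulmxA -[X in u *m X](rmorphM eta) mulfV // rmorph1 mulmx1.
move: e; rewrite w0 rmorph0 mulmx0 addr0 => e.
have := vfree [ffun j : 'I_k => a (widen_ord (leqnSn k) j)].
rewrite /module_comb; under eq_bigr => j _ do rewrite ffunE.
move=> /(_ e) /ffunP h; apply/ffunP=> j; rewrite [RHS]ffunE.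
have [ltj|] := ltnP j k.
  by have := h (Ordinal ltj); rewrite !ffunE => <-; congr (a _); apply: val_inj.
move=> lej; have -> : j = ord_max by apply: val_inj => /=; have := ltn_ord j; lia.
exact: w0.
Qed.

Lemma generators d : (d * g = m)%N -> exists (v : nat -> 'rV[rat]_m), forall u,
  exists a : 'I_d -> L, u = \sum_(j < d) v j *m eta (a j).
Proof.
move=> e; have [|v vfree] := @module_comb_free d; first by rewrite e.
exists v => u; pose f := linfun (@module_comb d v).
have ker0 : (lker f == 0)%VS.
  rewrite -subv0; apply/subvP=> a; rewrite memv_ker memv0 lfunE /= => /eqP/vfree ->.
  by rewrite eqxx.
have imT : limg f = fullv.
  apply/eqP; rewrite eqEdim subvf /=; have := limg_ker_dim f fullv.
  by rewrite capfv (eqP ker0) dimv0 add0n => ->; rewrite !dimvf /dim /= card_ord mul1n -e dimvf.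
have : u \in limg f by rewrite imT memvf.
by case/memv_imgP=> a _ ->; exists a; rewrite lfunE.
Qed.
End Generators.

(** Dedekind's argument: in a relation, subtracting f_s0(a) times the relation at x
    from the relation at a x removes the term s0 and, if f_s1(a) <> f_s0(a), keeps
    the term s1. *)
Lemma dedekind_independence (L M : fieldType) (S : finType) (f : S -> {rmorphism L -> M}) :
    (forall s t, f s =1 f t -> s = t) -> forall c : S -> M,
  (forall x, \sum_s c s * f s x = 0) -> forall s, c s = 0.
Proof.
move=> fI c; have [n] := ubnP #|[set s | c s != 0]|; elim: n c => // n IH c; rewrite ltnS => lec h s0.
apply/eqP; apply/negPn/negP=> cs0.
have only s1 : s1 != s0 -> c s1 = 0.
  move=> ne; apply/eqP; apply/negPn/negP=> cs1.
  have [a aP] : exists a, f s1 a != f s0 a.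
    apply: contrapT => /forallNP fe; case/eqP: ne; apply: fI => a.
    by apply/eqP; apply/negPn/negP/fe.
  pose c' s := c s * (f s a - f s0 a).
  have : c' s1 = 0.
    apply: IH => [|x].
      apply: leq_trans lec; apply: proper_card; apply/properP; split.
        by apply/subsetP=> s; rewrite !inE /c' mulf_eq0 negb_or => /andP[].
      by exists s0; rewrite !inE // /c' subrr mulr0 eqxx.
    rewrite (eq_bigr (fun s => c s * f s (a * x) - f s0 a * (c s * f s x))).
      by rewrite sumrB h -mulr_sumr h mulr0 subr0.
    by move=> s _; rewrite /c' rmorphM; ring.
  by move/eqP; rewrite mulf_eq0 subr_eq0 (negbTE cs1) (negbTE aP).
have := h 1; rewrite (bigD1 s0) //= big1 => [|s /only ->]; last by rewrite mul0r.
by rewrite rmorph1 mulr1 addr0 => /eqP; rewrite (negbTE cs0).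
Qed.

(** By independence, the matrix of the values of the embeddings on a rational basis
    of L has independent rows. *)
Lemma embeddings_le (L : fieldExtType rat) (M : numFieldType) (S : finType) (f : S -> {rmorphism L -> M}) :
  (forall s t, f s =1 f t -> s = t) -> (#|S| <= \dim {:L})%N.
Proof.
move=> fI; pose b := vbasis {:L}.
pose A : 'M[M]_(#|S|, \dim {:L}) := \matrix_(s, i) f (enum_val s) (b`_i).
suff : row_free A by move=> /eqP <-; apply: rank_leq_col.
rewrite -kermx_eq0; apply/rowV0P => u /sub_kermxP uA.
have cu := dedekind_independence fI (c := fun s => u 0 (enum_rank s)).
apply/rowP=> i; rewrite mxE -(enum_valK i); apply: cu => x.
rewrite (coord_vbasis (memvf x)).
under eq_bigr => s _ do rewrite rmorph_sum mulr_sumr.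
rewrite exchange_big big1 //= => j _.
have fZ s : f s (coord b j x *: b`_j) = ratr (coord b j x) * f s b`_j.
  by rewrite -mulr_algl rmorphM alg_num_field fmorph_rat.
under eq_bigr => s _ do rewrite fZ mulrCA.
rewrite -mulr_sumr; apply/eqP; rewrite mulf_eq0; apply/orP; right; apply/eqP.
have := congr1 (fun z : 'rV_ _ => z 0 j) uA; rewrite !mxE => e; rewrite -[RHS]e.
rewrite (reindex (@enum_val S predT)) /=; last by apply: onW_bij; apply: enum_val_bij.
by apply: eq_bigr => s _; rewrite mxE enum_valK.
Qed.

(** * Secant lines and their images *)

Lemma top_pairing_vanish (k : fieldType) (m a b : nat) (w Q : exterior k (m + m)) :
    homog (@wt_left m m) a Q -> homog (@wt_right m m) b Q ->
    (forall A B : {set 'I_m}, (#|A| + a = m)%N -> (#|B| + b = m)%N -> w (set_sum A B) = 0) ->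
  (w * Q) setT = 0.
Proof.
move=> hl hr h; rewrite wedgeE big1 // => U _.
have [A [B ->]] := set_sumP U; rewrite setTD set_sumC.
have [->|Q0] := eqVneq (Q (set_sum (~: A) (~: B))) 0; first by rewrite !mulr0.
have := hl _ Q0; have := hr _ Q0; rewrite weight_left weight_right => eB eA.
rewrite h ?mul0r ?mulr0 //; first by rewrite -eA cardsC card_ord.
by rewrite -eB cardsC card_ord.
Qed.

(** On the degree 2j the operator tau is (-1)^j. *)
Lemma tau_ext_exp (k : numFieldType) m (z : exterior k m) : homog (fun=> 1%N) 2 z ->
  tau (ext_exp z) = ext_exp (- z) :> exterior k m.
Proof.
move=> hz; apply/ffunP=> A; rewrite ffunE !ext_expE /trunc_exp !ext_sumE mulr_sumr.
apply: eq_bigr => j _.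
have -> : (- z) ^+ j = (-1) ^+ j *: z ^+ j by rewrite -scaleN1r exprZn.
rewrite !extZE mulrCA; congr (_ * _).
have [->|nz] := eqVneq ((z ^+ j) A) 0; first by rewrite !mulr0.
have := homogX (n := j) hz nz; rewrite weight_card => ->.
congr (_ * _); rewrite -signr_odd -[RHS]signr_odd; congr (_ ^+ nat_of_bool _).
rewrite muln2 -doubleMl doubleK oddM.
by case: (nat_of_ord j) => [//|l]; rewrite doubleS /= odd_double andbT.
Qed.

Section BlockForms.
Variables (k : numFieldType) (m n r : nat) (I : finType) (Th : I -> exterior k m).
Hypothesis ThP : forall s, pulled_from (2 * r.+1) (Th s).
Hypothesis m2n : m = (2 * n)%N.
Hypothesis nE : n = (r.+1 * #|I|)%N.
Hypothesis top0 : (\sum_s Th s) ^+ n != 0.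

Lemma Th_deg2 s : homog (fun=> 1%N) 2 (Th s).
Proof. exact: pulled_deg2 (ThP s). Qed.

Lemma Th_even s : Th s \in @even_pred k m.
Proof. exact: (homog_even (Th_deg2 (s := s))). Qed.

Definition Th_ev s : even_exterior k m := EvenExterior (Th_even s).

Lemma Th_ev_pow s : Th_ev s ^+ r.+2 = 0.
Proof. by apply: ev_inj; rewrite evX ev0 /= pulled_nilpotent. Qed.

Lemma Th_sum_top : (\sum_s Th s) ^+ n = ((\sum_s Th s) ^+ n) setT *: (ebase k setT : exterior k m).
Proof.
apply: homog_top.
have := homogX (n := n) (homog_sum (r := index_enum I) (P := xpredT) (F := Th) (fun s _ => @Th_deg2 s)).
by rewrite mulnC -m2n.
Qed.

Lemma Th_sum_top_neq0 : ((\sum_s Th s) ^+ n) setT != 0.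
Proof. by apply: contraNneq top0 => e0; rewrite Th_sum_top e0 scale0r. Qed.

Lemma fst_deg2 s : homog (fun=> 1%N) 2 (fst_part (Th s)).
Proof. exact: homog_deg_pull (@Th_deg2 s). Qed.
Lemma snd_deg2 s : homog (fun=> 1%N) 2 (snd_part (Th s)).
Proof. exact: homog_deg_pull (@Th_deg2 s). Qed.
Lemma mix_deg2 s : homog (fun=> 1%N) 2 (mix_part (Th s)).
Proof.
apply: homogD; first apply: homogD; last exact: homogN (@snd_deg2 s).
  exact: homog_deg_pull (@Th_deg2 s).
exact: homogN (@fst_deg2 s).
Qed.

Definition Xe s : even_exterior k (m + m) := EvenExterior (homog_even (@fst_deg2 s) isT).
Definition Ye s : even_exterior k (m + m) := EvenExterior (homog_even (@snd_deg2 s) isT).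
Definition Me s : even_exterior k (m + m) := EvenExterior (homog_even (@mix_deg2 s) isT).

Let rel s := pulled_relations (ThP s).

Lemma Xe_pow s : Xe s ^+ r.+2 = 0.
Proof. by apply: ev_inj; rewrite evX ev0; have [[? _ _ _ _] _] := rel s. Qed.
Lemma Ye_pow s : Ye s ^+ r.+2 = 0.
Proof. by apply: ev_inj; rewrite evX ev0; have [[_ ? _ _ _] _] := rel s. Qed.
Lemma MXe s : Me s * Xe s ^+ r.+1 = 0.
Proof. by apply: ev_inj; rewrite evM evX ev0; have [[_ _ ? _ _] _] := rel s. Qed.
Lemma MYe s : Me s * Ye s ^+ r.+1 = 0.
Proof. by apply: ev_inj; rewrite evM evX ev0; have [[_ _ _ ? _] _] := rel s. Qed.
Lemma M3Xe s : Me s ^+ 3 * Xe s ^+ r = 0.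
Proof. by apply: ev_inj; rewrite evM !evX ev0; have [[_ _ _ _ ?] _] := rel s. Qed.
Lemma XMYe s : (Xe s + Me s + Ye s) ^+ r.+2 = 0.
Proof. by apply: ev_inj; rewrite evX !evD ev0; have [_ ?] := rel s. Qed.

Local Notation SX := (\sum_s Xe s).
Local Notation SY := (\sum_s Ye s).
Local Notation SM := (\sum_s Me s).

Lemma vol_neq0 : ev (SX ^+ n * SY ^+ n) setT != 0.
Proof.
have e : ev (SX ^+ n * SY ^+ n) = tensor ((\sum_s Th s) ^+ n) ((\sum_s Th s) ^+ n).
  by rewrite evM !evX !ev_sum /tensor !pullX !pull_sum.
by rewrite e -set_sumT tensorE -expr2 expf_neq0 // Th_sum_top_neq0.
Qed.

Variable t : k.
Hypothesis t0 : t != 0.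

Definition exp_form (z : I -> k) : exterior k m := ext_exp (\sum_s z s *: Th s).

Lemma lin_deg2 (z : I -> k) : homog (fun=> 1%N) 2 (\sum_s z s *: Th s).
Proof. by apply: homog_sum => s _; apply: homogZ; apply: Th_deg2. Qed.

Lemma lin_even (z : I -> k) : \sum_s z s *: Th s \in @even_pred k m.
Proof. exact: (homog_even (@lin_deg2 z)). Qed.

Lemma exp_form_mul z z' : exp_form z * exp_form z' = exp_form (fun s => z s + z' s).
Proof.
rewrite /exp_form -ext_exp_add ?lin_even //; try exact: (homog_deg_ge (j := 2) isT (@lin_deg2 _)).
by congr ext_exp; rewrite -big_split; apply: eq_bigr => s _; rewrite scalerDl.
Qed.

(** The top part of the exponential is a multiple of (sum_s z_s Theta_s)^n, and n is
    the largest exponent for which this power is not zero, so that it is a multiple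
    of the product of the (z_s Theta_s)^(r+1). *)
Lemma exp_form_top : exists2 c : k, c != 0 & forall z, exp_form z setT = c * \prod_s z s ^+ r.+1.
Proof.
have [c c0 cE] := sum_pow_full (even_exterior k m) I r.
exists ((n`!%:R)^-1 * (((\sum_s Th s) ^+ n) setT)) => [|z].
  by rewrite mulf_neq0 ?Th_sum_top_neq0 // invr_eq0 pnatr_eq0 -lt0n fact_gt0.
have := ext_exp_top (j := n) (@lin_deg2 z) (@homog1 k m (fun=> 1%N)).
rewrite addn0 !mulr1 -m2n => /(_ erefl) ->; rewrite -mulrA; congr (_ * _).
have -> : (\sum_s z s *: Th s) ^+ n = ev ((\sum_s z s *: Th_ev s) ^+ n).
  by rewrite evX ev_sum; congr (_ ^+ n); apply: eq_bigr => s _; rewrite evZ.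
have -> : (\sum_s Th s) ^+ n = ev ((\sum_s Th_ev s) ^+ n) by rewrite evX ev_sum.
rewrite nE !cE => [|s|s]; last first.
- by rewrite exprZn Th_ev_pow scaler0.
- by rewrite Th_ev_pow.
rewrite !evZ !extZE -mulrA; congr (_ * _).
have -> : \prod_s (z s *: Th_ev s) ^+ r.+1 = (\prod_s z s ^+ r.+1) *: \prod_s Th_ev s ^+ r.+1.
  rewrite -scaler_prod; apply: eq_bigr => s _; exact: exprZn.
by rewrite evZ extZE mulrC.
Qed.

(** The set D stands for the CM type that agrees with T1 exactly at the elements of
    D; so [secant setT] is l_T1 and [secant set0] is its conjugate. *)
Definition cm_sign (D : {set I}) (s : I) : k := if s \in D then t else - t.
Definition secant D := exp_form (cm_sign D).
Local Notation L := secant.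

Lemma two_t : t + t != 0.
Proof. by rewrite -mulr2n mulrn_eq0 negb_or. Qed.

Lemma cm_sign_add0 D E s : (cm_sign D s + cm_sign E s == 0) = ((s \in D) != (s \in E)).
Proof.
rewrite /cm_sign; case: (s \in D); case: (s \in E); rewrite ?addrN ?addNr ?eqxx //.
  by rewrite (negbTE two_t).
by rewrite -opprD oppr_eq0 (negbTE two_t).
Qed.

Lemma secant_pairing_off D E : D != E -> (L D * L E) setT = 0.
Proof.
move=> ne; rewrite exp_form_mul; have [c _ ->] := exp_form_top.
have [s sP] : exists s, (s \in D) != (s \in E).
  apply/existsP; apply: contraNT ne; rewrite negb_exists => /forallP h.
  by apply/eqP/setP => s; apply/eqP; rewrite -[_ == _]negbK h.
rewrite (bigD1 s) //=; move: sP; rewrite -cm_sign_add0 => /eqP ->.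
by rewrite expr0n mul0r mulr0.
Qed.

Lemma secant_pairing_diag D : (L D * L D) setT != 0.
Proof.
rewrite exp_form_mul; have [c c0 ->] := exp_form_top; rewrite mulf_neq0 //.
by apply/prodf_neq0 => s _; rewrite expf_neq0 // cm_sign_add0 negbK.
Qed.

Lemma secant_pairing_sum (c : {set I} -> k) E :
  ((\sum_D c D *: L D) * L E) setT = c E * (L E * L E) setT.
Proof.
rewrite mulr_suml ext_sumE (bigD1 E) //= big1 ?addr0 => [|D ne].
  by rewrite -scalerAl extZE.
by rewrite -scalerAl extZE secant_pairing_off ?mulr0.
Qed.

(** The secant vectors are orthogonal and not isotropic for the pairing given by
    the top coefficient of a product. *)
Lemma secant_free (c : {set I} -> k) : \sum_D c D *: L D = 0 -> forall D, c D = 0.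
Proof.
move=> h D; have := secant_pairing_sum c D; rewrite h mul0r ext0E => /esym/eqP.
by rewrite mulf_eq0 (negbTE (secant_pairing_diag D)) orbF => /eqP.
Qed.

Lemma secant_tensor_free (c : {set I} -> {set I} -> k) :
  \sum_D \sum_E c D E *: tensor (L D) (L E) = 0 -> forall D E, c D E = 0.
Proof.
move=> h D E.
have e : \sum_D' c D' E *: L D' = 0.
  apply/ffunP=> A; rewrite ext0E ext_sumE.
  have h2 : \sum_E' (\sum_D' c D' E' * L D' A) *: L E' = 0.
    apply/ffunP=> B; have hB := congr1 (fun z : exterior k (m + m) => z (set_sum A B)) h.
    rewrite /= ext0E in hB; rewrite ext0E -[RHS]hB !ext_sumE.
    under [RHS]eq_bigr => D' _ do rewrite ext_sumE.
    rewrite [RHS]exchange_big; apply: eq_bigr => E' _; rewrite extZE mulr_suml.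
    by apply: eq_bigr => D' _; rewrite extZE tensorE mulrA.
  rewrite -[RHS](secant_free h2 E); apply: eq_bigr => D' _; exact: extZE.
exact: (secant_free e).
Qed.

Definition sheared D E : exterior k (m + m) := pull (mu_mx k m) (tensor (L D) (tau (L E))).

Lemma deg_ge_lin z : deg_ge 1 (\sum_s z s *: Th s).
Proof. exact: (homog_deg_ge (j := 2) isT (@lin_deg2 z)). Qed.

(** The pullback along mu sends x to x + y and y to y, and tau turns
    exp z into exp (-z); the exponents then add up, because 2-forms commute. *)
Lemma sheared_exp D E : sheared D E =
  ext_exp (ev (\sum_s (cm_sign D s *: (Xe s + Me s) + (cm_sign D s - cm_sign E s) *: Ye s))).
Proof.
have -> : \sum_s (cm_sign D s *: (Xe s + Me s) + (cm_sign D s - cm_sign E s) *: Ye s) =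
   \sum_s cm_sign D s *: (Xe s + Me s + Ye s) + \sum_s - cm_sign E s *: Ye s.
  rewrite -big_split; apply: eq_bigr => s _ /=.
  by rewrite [X in _ = X + _]scalerDr scalerBl scaleNr addrA.
set U := \sum_s cm_sign D s *: _; set V := \sum_s - _ *: _.
have eU : ev U = pull (col_mx 1%:M 1%:M : 'M[k]_(m + m, m)) (\sum_s cm_sign D s *: Th s).
  rewrite ev_sum pull_sum; apply: eq_bigr => s _.
  by rewrite evZ pullZ -parts_sum !evD.
have eV : ev V = pull (pr2 k m m) (\sum_s - cm_sign E s *: Th s).
  rewrite ev_sum pull_sum; apply: eq_bigr => s _; by rewrite evZ pullZ.
have lU : deg_ge 1 (ev U).
  rewrite eU; apply: (homog_deg_ge (j := 2)) => //; apply: homog_deg_pull; exact: lin_deg2.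
have lV : deg_ge 1 (ev V).
  rewrite eV; apply: (homog_deg_ge (j := 2)) => //; apply: homog_deg_pull; exact: lin_deg2.
have expU : ext_exp (ev U) = pull (col_mx 1%:M 1%:M : 'M[k]_(m + m, m)) (L D).
  by rewrite /secant /exp_form pull_ext_exp -?eU //; apply: deg_ge_lin.
have expV : ext_exp (ev V) = pull (pr2 k m m) (ext_exp (\sum_s - cm_sign E s *: Th s)).
  by rewrite pull_ext_exp -?eV //; apply: deg_ge_lin.
rewrite evD ext_exp_add ?evP // expU expV.
rewrite /sheared /tensor pullM !pull_comp {2}/secant {1}/exp_form [tau _]tau_ext_exp; last exact: lin_deg2.
have -> : mu_mx k m *m pr1 k m m = col_mx 1%:M 1%:M.
  by rewrite /mu_mx /pr1 mul_block_col !(mulmx1, mulmx0, mul1mx, mul0mx, addr0, add0r).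
have -> : mu_mx k m *m pr2 k m m = pr2 k m m.
  by rewrite /mu_mx /pr2 mul_block_col !(mulmx1, mulmx0, mul1mx, mul0mx, addr0, add0r).
have -> // : - (\sum_s cm_sign E s *: Th s) = \sum_s - cm_sign E s *: Th s.
by rewrite -sumrN; apply: eq_bigr => s _; rewrite scaleNr.
Qed.

Local Notation N := (r.+1 * #|I|.-1)%N.
Local Notation XC s := (\sum_(i | i != s) Xe i).
Local Notation YC s := (\sum_(i | i != s) Ye i).

(** These functionals see the components of w of bidegree (0, 2n), (0, 2n - d) and
    (1, 2n - d + 1).  The last two bidegrees belong to the part of degree d of
    check_phi. *)
Definition probe_top (w : exterior k (m + m)) := (w * ev (SX ^+ n)) setT.
Definition probe_deg0 s (w : exterior k (m + m)) := (w * ev (SX ^+ n * Ye s ^+ r.+1)) setT.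
Definition probe_deg1 s (w : exterior k (m + m)) :=
  (w * ev (Me s * (Xe s ^+ r * XC s ^+ N) * Ye s ^+ r)) setT.

Lemma ev_homogX (z : even_exterior k (m + m)) w j a : homog w a (ev z) -> homog w (j * a) (ev (z ^+ j)).
Proof. by move=> h; rewrite evX; apply: homogX. Qed.
Lemma ev_homogM (z z' : even_exterior k (m + m)) w a b : homog w a (ev z) -> homog w b (ev z') ->
  homog w (a + b) (ev (z * z')).
Proof. by move=> h h'; rewrite evM; apply: homogM. Qed.
Lemma ev_homog_sum (F : I -> even_exterior k (m + m)) (P : pred I) w a :
  (forall s, homog w a (ev (F s))) -> homog w a (ev (\sum_(s | P s) F s)).
Proof. by move=> h; rewrite ev_sum; apply: homog_sum. Qed.

Lemma exponent_deg2 a b : homog (fun=> 1%N) 2 (ev (\sum_s (a s *: (Xe s + Me s) + b s *: Ye s))).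
Proof.
apply: ev_homog_sum => s; rewrite evD !evZ evD.
apply: homogD; apply: homogZ; last exact: snd_deg2.
by apply: homogD; [exact: fst_deg2 | exact: mix_deg2].
Qed.

Lemma probe_top_sheared (D E : {set I}) s : (s \in D) = (s \in E) -> probe_top (sheared D E) = 0.
Proof.
move=> sDE; rewrite /probe_top sheared_exp.
have hX : homog (fun=> 1%N) (n * 2) (ev (SX ^+ n)).
  by apply: ev_homogX; apply: ev_homog_sum => i; exact: fst_deg2.
rewrite (ext_exp_top (j := n) (@exponent_deg2 _ _) hX); last by move: m2n; clear; lia.
rewrite -evX -evM nE (top_degenerate Xe_pow Ye_pow MXe _ (s := s)) ?ev0 ?ext0E ?mulr0 //.
by rewrite /cm_sign sDE subrr.
Qed.

(** For D = setT or set0 the sign is constant, and if D and E agree exactly at s,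
    then cm_sign D i - cm_sign E i is twice that sign except at s, where it is 0. *)
Lemma one_agreement_exponent (D E : {set I}) s u :
    (forall i, cm_sign D i = u) -> (forall i, (i \in D) == (i \in E) = (i == s)) ->
  \sum_i (cm_sign D i *: (Xe i + Me i) + (cm_sign D i - cm_sign E i) *: Ye i) =
  u *: (SX + SM + 2%:R *: YC s).
Proof.
move=> eD eDE; rewrite big_split /= [RHS]scalerDr; congr (_ + _).
  by rewrite -big_split scaler_sumr; apply: eq_bigr => i _; rewrite eD.
rewrite scalerA scaler_sumr [RHS]big_mkcond; apply: eq_bigr => i _ /=.
have := eDE i; rewrite -(eD i) /cm_sign; case: (i == s) => /=.
  by move/eqP ->; rewrite subrr scale0r.
by case: (i \in D); case: (i \in E) => //= _; congr (_ *: _); ring.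
Qed.

Lemma I_gt0 (s : I) : (0 < #|I|)%N.
Proof. by apply/card_gt0P; exists s. Qed.

Lemma probe_deg0_sheared : exists2 c : k, c != 0 & forall (D E : {set I}) s s' u,
  (forall i, cm_sign D i = u) -> (forall i, (i \in D) == (i \in E) = (i == s)) ->
  probe_deg0 s' (sheared D E) = c * u ^+ N * (s == s')%:R.
Proof.
have [c c0 cE] := degree0_detector Xe_pow Ye_pow MXe.
exists ((N`!%:R)^-1 * c * ev (SX ^+ n * SY ^+ n) setT).
  by rewrite !mulf_neq0 ?vol_neq0 // invr_eq0 pnatr_eq0 -lt0n fact_gt0.
move=> D E s s' u eD eDE; rewrite /probe_deg0 sheared_exp.
have hQ : homog (fun=> 1%N) (n * 2 + r.+1 * 2) (ev (SX ^+ n * Ye s' ^+ r.+1)).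
  apply: ev_homogM; apply: ev_homogX; last exact: snd_deg2.
  by apply: ev_homog_sum => i; exact: fst_deg2.
have I0 := I_gt0 s.
rewrite (ext_exp_top (j := N) (@exponent_deg2 _ _) hQ); last first.
  by move: m2n nE; rewrite -(prednK I0) /=; clear; lia.
rewrite (one_agreement_exponent eD eDE) -evX -evM exprZn -scalerAl [in SX ^+ n * Ye _ ^+ _]nE cE -nE !evZ !extZE.
by ring.
Qed.

Lemma probe_deg1_sheared : exists2 c : k, c != 0 & forall (D E : {set I}) s s' u,
  (forall i, cm_sign D i = u) -> (forall i, (i \in D) == (i \in E) = (i == s)) ->
  probe_deg1 s' (sheared D E) = c * u ^+ N.+1 * (s == s')%:R.
Proof.
have [|I0] := posnP #|I|.
  move=> I0; exists 1; first exact: oner_neq0.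
  by move=> D E s; have := I_gt0 s; rewrite I0.
have [c c0 cE] := degree1_detector Xe_pow Ye_pow MXe MYe M3Xe XMYe I0.
exists ((N.+1`!%:R)^-1 * c * ev (SX ^+ n * SY ^+ n) setT).
  by rewrite !mulf_neq0 ?vol_neq0 // invr_eq0 pnatr_eq0 -lt0n fact_gt0.
move=> D E s s' u eD eDE; rewrite /probe_deg1 sheared_exp.
have hQ : homog (fun=> 1%N) (2 + (r * 2 + N * 2) + r * 2) (ev (Me s' * (Xe s' ^+ r * XC s' ^+ N) * Ye s' ^+ r)).
  apply: ev_homogM; last by apply: ev_homogX; exact: snd_deg2.
  apply: ev_homogM; first exact: mix_deg2.
  apply: ev_homogM; apply: ev_homogX; first exact: fst_deg2.
  by apply: ev_homog_sum => i; exact: fst_deg2.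
rewrite (ext_exp_top (j := N.+1) (@exponent_deg2 _ _) hQ); last first.
  by move: m2n nE; rewrite -(prednK I0) /=; clear; lia.
rewrite (one_agreement_exponent eD eDE) -evX -evM exprZn -scalerAl cE -nE !evZ !extZE.
by ring.
Qed.

Lemma Th_two_form s : exists N (c c' : 'I_N -> 'cV[k]_m), Th s = \sum_j linform (c j) * linform (c' j).
Proof.
have [B [l [c [c' ->]]]] := ThP s.
exists l, (fun j => B *m c j), (fun j => B *m c' j).
by rewrite pull_sum; apply: eq_bigr => j _; rewrite pullM !pull_linform.
Qed.

Lemma Xe_left s : homog (@wt_left m m) 2 (ev (Xe s)).
Proof. by have [l [c [c' e]]] := Th_two_form s; rewrite /= e; apply: fst_part_left. Qed.
Lemma Xe_right s : homog (@wt_right m m) 0 (ev (Xe s)).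
Proof. by have [l [c [c' e]]] := Th_two_form s; rewrite /= e; apply: fst_part_right. Qed.
Lemma Ye_left s : homog (@wt_left m m) 0 (ev (Ye s)).
Proof. by have [l [c [c' e]]] := Th_two_form s; rewrite /= e; apply: snd_part_left. Qed.
Lemma Ye_right s : homog (@wt_right m m) 2 (ev (Ye s)).
Proof. by have [l [c [c' e]]] := Th_two_form s; rewrite /= e; apply: snd_part_right. Qed.
Lemma Me_left s : homog (@wt_left m m) 1 (ev (Me s)).
Proof. by have [l [c [c' e]]] := Th_two_form s; rewrite /= e; apply: mix_part_left. Qed.
Lemma Me_right s : homog (@wt_right m m) 1 (ev (Me s)).
Proof. by have [l [c [c' e]]] := Th_two_form s; rewrite /= e; apply: mix_part_right. Qed.

Lemma cardsC_m (B : {set 'I_m}) : (#|B| + #|~: B| = m)%N.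
Proof. by rewrite cardsC card_ord. Qed.

(** The set B indexes the monomial before the exchange of e_B and e_(~B), so the
    condition says that the corresponding class on X x X^ has no part of degree
    d. *)
Definition degree_d_vanishes (w : exterior k (m + m)) := forall A B : {set 'I_m},
  (#|A| + #|~: B| = 2 * r.+1)%N -> w (set_sum A B) = 0.

Lemma probe_deg0_eq0 w s : degree_d_vanishes w -> probe_deg0 s w = 0.
Proof.
move=> w0; apply: (@top_pairing_vanish _ _ (n * 2 + r.+1 * 0) (n * 0 + r.+1 * 2)).
- apply: ev_homogM; apply: ev_homogX; last exact: Ye_left.
  by apply: ev_homog_sum => i; exact: Xe_left.
- apply: ev_homogM; apply: ev_homogX; last exact: Ye_right.
  by apply: ev_homog_sum => i; exact: Xe_right.
by move=> A B cA cB; apply: w0; move: (cardsC_m B) m2n cA cB; clear; lia.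
Qed.

Lemma probe_deg1_eq0 w s : degree_d_vanishes w -> probe_deg1 s w = 0.
Proof.
have I0 := I_gt0 s.
move=> w0; apply: (@top_pairing_vanish _ _ (1 + (r * 2 + N * 2) + r * 0) (1 + (r * 0 + N * 0) + r * 2)).
- apply: ev_homogM; last by apply: ev_homogX; exact: Ye_left.
  apply: ev_homogM; first exact: Me_left.
  apply: ev_homogM; apply: ev_homogX; first exact: Xe_left.
  by apply: ev_homog_sum => i; exact: Xe_left.
- apply: ev_homogM; last by apply: ev_homogX; exact: Ye_right.
  apply: ev_homogM; first exact: Me_right.
  apply: ev_homogM; apply: ev_homogX; first exact: Xe_right.
  by apply: ev_homog_sum => i; exact: Xe_right.
move=> A B cA cB; apply: w0; move: (cardsC_m B) m2n nE cA cB.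
by rewrite -(prednK I0) /=; clear; lia.
Qed.

Lemma probe_top_coef (w : exterior k (m + m)) : w (set_sum set0 setT) != 0 -> probe_top w != 0.
Proof.
rewrite /probe_top evX ev_sum => w0.
have -> : \sum_i ev (Xe i) = pull (pr1 k m m) (\sum_s Th s) by rewrite pull_sum.
rewrite -pullX Th_sum_top pullZ -scalerAr extZE pull_pr1_ebase.
have -> : @lshift m m @: setT = set_sum setT set0 by rewrite /set_sum imset0 setU0.
by rewrite mul_ebase_top set_sumC setC0 setCT !mulf_neq0 ?shuffle_sign_neq0 // Th_sum_top_neq0.
Qed.

Lemma comb_mul_top (f : I -> k) (F : I -> exterior k (m + m)) (Q : exterior k (m + m)) :
  ((\sum_u f u *: F u) * Q) setT = \sum_u f u * (F u * Q) setT.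
Proof.
rewrite mulr_suml ext_sumE; apply: eq_bigr => u _.
by rewrite -scalerAl extZE.
Qed.

Lemma add_mul_top (x y Q : exterior k (m + m)) :
  ((x + y) * Q) setT = (x * Q) setT + (y * Q) setT.
Proof. by rewrite mulrDl extDE. Qed.

(** The pairs (T1, {s}) have sign t and their conjugates have sign -t.  The two
    probes at s pick the terms with index s, with factors u^N and u^(N+1), where
    u is the sign; as (-1)^N and (-1)^(N+1) differ, the two equations are
    independent. *)
Lemma degree_d_part_injective (b b' : I -> k) :
  degree_d_vanishes (\sum_s b s *: sheared setT [set s] + \sum_s b' s *: sheared set0 (~: [set s])) ->
  forall s, b s = 0 /\ b' s = 0.
Proof.
set w := _ + _ => w0 s.
have [c c0 cE] := probe_deg0_sheared; have [c' c'0 c'E] := probe_deg1_sheared.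
have epsT i : cm_sign setT i = t by rewrite /cm_sign inE.
have eps0 i : cm_sign set0 i = - t by rewrite /cm_sign inE.
have hT (u i : I) : (i \in [set: I]) == (i \in [set u]) = (i == u) by rewrite !inE.
have h0 (u i : I) : (i \in (set0 : {set I})) == (i \in ~: [set u]) = (i == u).
  by rewrite !inE; case: (i == u).
have lin (Q : exterior k (m + m)) : (w * Q) setT =
    \sum_u b u * (sheared setT [set u] * Q) setT + \sum_u b' u * (sheared set0 (~: [set u]) * Q) setT.
  exact: (etrans (add_mul_top _ _ Q) (congr2 +%R (comb_mul_top b _ Q) (comb_mul_top b' _ Q))).
have pick (f : I -> k) (e : k) : \sum_u f u * (e * (u == s)%:R) = f s * e.
  rewrite (bigD1 s) //= eqxx mulr1 big1 ?addr0 // => u /negbTE ->.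
  by rewrite !mulr0.
have eA : b s * (c * t ^+ N) + b' s * (c * (- t) ^+ N) = 0.
  rewrite -(probe_deg0_eq0 s w0) /probe_deg0 lin -[X in X + _](pick b) -[X in _ + X](pick b'); congr (_ + _).
    by apply: eq_bigr => u _; rewrite -(cE _ _ u s t epsT (hT u)).
  by apply: eq_bigr => u _; rewrite -(cE _ _ u s (- t) eps0 (h0 u)).
have eB : b s * (c' * t ^+ N.+1) + b' s * (c' * (- t) ^+ N.+1) = 0.
  rewrite -(probe_deg1_eq0 s w0) /probe_deg1 lin -[X in X + _](pick b) -[X in _ + X](pick b'); congr (_ + _).
    by apply: eq_bigr => u _; rewrite -(c'E _ _ u s t epsT (hT u)).
  by apply: eq_bigr => u _; rewrite -(c'E _ _ u s (- t) eps0 (h0 u)).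
have Nt : - t != 0 by rewrite oppr_eq0.
have b'0 : b' s = 0.
  (* eliminate b s: the factors of b' s add up, by opposite parities of N, N.+1 *)
  have : (b' s * (c * c' * (- t) ^+ N)) * (t + t) = 0.
    have -> : b' s * (c * c' * (- t) ^+ N) * (t + t) =
       c' * t * (b s * (c * t ^+ N) + b' s * (c * (- t) ^+ N))
       - c * (b s * (c' * t ^+ N.+1) + b' s * (c' * (- t) ^+ N.+1)) by rewrite !exprS; ring.
    by rewrite eA eB !mulr0 subrr.
  move/eqP; rewrite mulf_eq0 (negbTE two_t) orbF mulf_eq0.
  by rewrite (negbTE (mulf_neq0 (mulf_neq0 c0 c'0) (expf_neq0 _ Nt))) orbF => /eqP.
split=> //; move: eA; rewrite b'0 mul0r addr0 => /eqP.
by rewrite mulf_eq0 (negbTE (mulf_neq0 c0 (expf_neq0 _ t0))) orbF => /eqP.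
Qed.
End BlockForms.

(** * Extension of scalars and descent *)

Lemma tau_ebase (k : fieldType) m (B : {set 'I_m}) :
  tau (ebase k B) = (-1) ^+ (#|B| * #|B|.-1)./2 *: (ebase k B : exterior k m).
Proof.
apply/ffunP=> C; rewrite ffunE extZE ebaseE; have [->//|_] := eqVneq C B.
by rewrite !mulr0.
Qed.

Lemma id_tens_tau_coef (k : fieldType) p m (x : exterior k (p + m)) A B :
  id_tens (p := p) (@tau k m) x (set_sum A B) = (-1) ^+ (#|B| * #|B|.-1)./2 * x (set_sum A B).
Proof. exact: (id_tens_monomial (s := id) x A B (fun _ _ e => e) (@tau_ebase k m)). Qed.

Lemma id_tens_tau_tensor (k : fieldType) p m (x : exterior k p) (y : exterior k m) :
  id_tens (p := p) (@tau k m) (tensor x y) = tensor x (tau y) :> exterior k (p + m).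
Proof.
apply: ext_eq_set_sum => A B; rewrite id_tens_tau_coef !tensorE mulrCA; congr (_ * _).
by rewrite ffunE.
Qed.

Lemma extmap_id_tens_tau (k l : fieldType) (f : {rmorphism k -> l}) p m (x : exterior k (p + m)) :
  extmap f (id_tens (p := p) (@tau k m) x) = id_tens (p := p) (@tau l m) (extmap f x).
Proof.
apply: ext_eq_set_sum => A B; rewrite extmapE !id_tens_tau_coef rmorphM extmapE.
by rewrite rmorphXn rmorphN rmorph1.
Qed.

Lemma extmap_mu (k l : fieldType) (f : {rmorphism k -> l}) m : map_mx f (mu_mx k m) = mu_mx l m.
Proof. by rewrite map_block_mx !map_mx1 map_mx0. Qed.

Lemma pulled_extmap (k l : numFieldType) (f : {rmorphism k -> l}) m d (x : exterior k m) :
  pulled_from d x -> pulled_from d (extmap f x).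
Proof.
move=> [B [N [c [c' ->]]]]; exists (map_mx f B), N, (fun j => map_mx f (c j)), (fun j => map_mx f (c' j)).
rewrite extmap_pull rmorph_sum; congr (pull _ _); apply: eq_bigr => j _.
by rewrite rmorphM /= !extmap_linform.
Qed.

(** An eigenform is determined by its values on generators v_j of H_1(X, Q) over
    L: if e_i = sum_j a_ij v_j, then its value at e_i is the sum over j of s(a_ij)
    times its value at v_j.  So all eigenforms for s are pulled back along the
    matrix of the s(a_ij). *)
Lemma eigen_pulled (R : realType) n (L : fieldExtType rat) (eta : {rmorphism L -> 'M[rat]_(n.*2)})
    (s : {rmorphism L -> R}) d (x : exterior R n.*2) : (d * \dim {:L} = n.*2)%N ->
  in_wedge2_H1_eigen eta s x -> pulled_from d x.
Proof.
move=> dE [N [xi [xi' [h ->]]]]; have [v vP] := generators eta dE.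
have [a aP] := choice (fun i : 'I_(n.*2) => vP (delta_mx 0 i)).
pose B := \matrix_(i < n.*2, j < d) s (a i j).
pose c (z : 'cV[R]_(n.*2)) : 'cV[R]_d := \col_j (map_mx (@ratr R) (v j) *m z) 0 0.
have key z : in_H1_eigen eta s z -> z = B *m c z.
  move=> hz; apply/colP=> i; rewrite !mxE.
  have -> : z i 0 = (map_mx (@ratr R) (delta_mx 0 i : 'rV[rat]_(n.*2)) *m z) 0 0.
    by rewrite map_delta_mx -rowE mxE.
  rewrite aP map_mx_sum mulmx_suml summxE; apply: eq_bigr => j _.
  by rewrite map_mxM -mulmxA hz -scalemxAr !mxE.
exists B, N, (fun j => c (xi j)), (fun j => c (xi' j)).
rewrite pull_sum; apply: eq_bigr => j _; have [h1 h2] := h j.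
by rewrite pullM !pull_linform -!key.
Qed.

Section Descent.
Variables (R : realType) (m : nat).
Implicit Types (U V : {vspace ext rat m}) (v : ext rat m).

Lemma to_CE v : to_C R v = extmap (@ratr R[i]) (v : exterior rat m).
Proof. by []. Qed.

Lemma mem_tensor_C U v : v \in U -> to_C R v \in tensor_C R U.
Proof.
move=> vU; rewrite (coord_vbasis vU) /tensor_C.
have -> : to_C R (\sum_i coord (vbasis U) i v *: (vbasis U)`_i) =
    \sum_i ratr (coord (vbasis U) i v) *: to_C R (vbasis U)`_i.
  apply/ffunP=> A; rewrite ffunE [X in ratr X](ext_sumE _ _ (fun i => _ : exterior rat m)).
  rewrite [RHS](ext_sumE _ _ (fun i => _ : exterior _ m)) rmorph_sum; apply: eq_bigr => i _.
  by rewrite !ffunE rmorphM.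
apply: memv_suml => i _; apply: memvZ; apply: memv_span; apply: map_f.
by apply: mem_nth; rewrite size_tuple.
Qed.

Lemma tensor_C_sub U V : (U <= V)%VS -> (tensor_C R U <= tensor_C R V)%VS.
Proof.
move=> sUV; apply/span_subvP=> w /mapP[x xU ->]; apply: mem_tensor_C.
exact: (subvP sUV _ (vbasis_mem xU)).
Qed.

(** A rational projection with kernel U extends to the complex numbers, where it
    kills U (x) C. *)
Lemma tensor_C_descent U v : to_C R v \in tensor_C R U -> v \in U.
Proof.
move=> h; pose p := daddv_pi (U^C)%VS U.
have dUC : (U :&: U^C)%VS = 0%VS by apply/eqP; rewrite capv_compl.
have split w : p w + daddv_pi U (U^C)%VS w = w.
  by rewrite addrC daddv_pi_add // addv_complf memvf.
have pU w : w \in U -> p w = 0.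
  by move=> wU; have := split w; rewrite (daddv_pi_id dUC wU) => /eqP; rewrite -subr_eq0 addrK => /eqP.
pose pC (x : exterior R[i] m) : exterior R[i] m :=
    \sum_A x A *: extmap (@ratr R[i]) (p (ebase rat A) : exterior rat m).
have pCE w : pC (to_C R w) = to_C R (p w).
  have e : (p w : exterior rat m) = \sum_A w A *: (p (ebase rat A) : exterior rat m).
    by rewrite {1}(ext_basis (w : exterior rat m)) linear_sum; apply: eq_bigr => A _; rewrite linearZ.
  rewrite [RHS]to_CE e extmap_sum; apply: eq_bigr => A _.
  by rewrite to_CE extmapE extmapZ.
have pC_lin : linear pC.
  move=> a x y; rewrite /pC scaler_sumr -big_split; apply: eq_bigr => A _ /=.
  by rewrite extDE extZE scalerA scalerDl.
pose Lin := GRing.isLinear.Build R[i] (exterior R[i] m) (exterior R[i] m) _ pC pC_lin.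
pose f : {linear exterior R[i] m -> exterior R[i] m} := HB.pack pC Lin.
have sub : (tensor_C R U <= lker (linfun f))%VS.
  apply/span_subvP=> w /mapP[x xU ->]; rewrite memv_ker lfunE /= pCE pU ?vbasis_mem //.
  by apply/eqP; exact: extmap0.
have := subvP sub _ h; rewrite memv_ker lfunE /= pCE => /eqP e.
have p0 : p v = 0 by apply: (extmap_inj (f := @ratr R[i])); rewrite extmap0.
by rewrite -(split v) p0 add0r memv_pi.
Qed.
End Descent.

(** The index is pushed forward along h because a CM type enters only through the
    subset that records it. *)
Lemma span_expand (C : fieldType) (V : vectType C) (J : finType) (T : eqType) (f : T -> V) (G : J -> V)
    (h : T -> J) (s : seq T) : (forall x, x \in s -> f x = G (h x)) ->
  forall v, v \in <<[seq f x | x <- s]>>%VS ->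
  exists2 c : J -> C, v = \sum_D c D *: G D & forall D, c D != 0 -> exists2 x, x \in s & h x = D.
Proof.
elim: s => [|x s IH] hf v.
  rewrite span_nil memv0 => /eqP ->; exists (fun=> 0) => [|D]; last by rewrite eqxx.
  by rewrite big1 // => D _; rewrite scale0r.
rewrite /= span_cons => /memv_addP[u /vlineP[a ->] [w ws ->]].
have [|c -> cP] := IH _ w ws; first by move=> y ys; apply: hf; rewrite inE ys orbT.
exists (fun D => a * (D == h x)%:R + c D) => [|D].
  under [RHS]eq_bigr => D _ do rewrite scalerDl.
  rewrite big_split /=; congr (_ + _); rewrite (bigD1 (h x)) //= eqxx mulr1 big1 ?addr0.
    by rewrite hf ?mem_head.
  by move=> D /negbTE ->; rewrite mulr0 scale0r.
have [->|ne] := eqVneq D (h x); first by move=> _; exists x; rewrite ?mem_head.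
rewrite mulr0 add0r => /cP[y ys <-]; exists y => //.
by rewrite inE ys orbT.
Qed.

Lemma shear_linear (k : fieldType) m :
  linear (fun x : exterior k (m + m) => pull (mu_mx k m) (id_tens (p := m) (@tau k m) x)).
Proof. by move=> a x y; rewrite -linearP; congr (pull _ _); apply: id_tens_linear. Qed.

(** By [check_phi_coef] this is check_phi up to the exchange of e_B and e_(~B) in the
    second factor and scalars. *)
Definition shear (k : fieldType) m (x : exterior k (m + m)) : exterior k (m + m) :=
  pull (mu_mx k m) (id_tens (p := m) (@tau k m) x).
HB.instance Definition _ (k : fieldType) m :=
  GRing.isLinear.Build k (exterior k (m + m)) (exterior k (m + m)) _ (@shear k m) (@shear_linear k m).

Lemma shear_sum (k : fieldType) m (T : Type) (s : seq T) (F : T -> exterior k (m + m)) :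
  shear (\sum_(i <- s) F i) = \sum_(i <- s) shear (F i).
Proof. exact: linear_sum. Qed.
Lemma shearZ (k : fieldType) m a (x : exterior k (m + m)) :
  shear (a *: x) = a *: shear x.
Proof. exact: linearZ. Qed.
Lemma shearD (k : fieldType) m (x y : exterior k (m + m)) :
  shear (x + y) = shear x + shear y.
Proof. exact: linearD. Qed.

Section Detection.
Variables (R : realType) (n r : nat) (I : finType) (J : 'M[R]_(n.*2)).
Local Notation C := R[i].
Variable Th : I -> exterior C n.*2.
Hypothesis ThP : forall s, pulled_from (2 * r.+1) (Th s).
Hypothesis nE : n = (r.+1 * #|I|)%N.
Hypothesis top0 : (\sum_s Th s) ^+ n != 0.
Variable t : C.
Hypothesis t0 : t != 0.
Local Notation m := n.*2.
Local Notation toC := (extmap (@ratr C)).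
Local Notation L := (@secant C m I Th t).
Local Notation sheared := (@sheared C m I Th t).

Let m2n : m = (2 * n)%N. Proof. by rewrite mul2n. Qed.

Lemma toC_shear (x : exterior rat (m + m)) :
  toC (shear x) = shear (toC x).
Proof. by rewrite /shear extmap_pull extmap_mu; congr (pull _ _); apply: extmap_id_tens_tau. Qed.

Lemma shear_secants D E : shear (tensor (L D) (L E)) = sheared D E.
Proof. by rewrite /shear id_tens_tau_tensor. Qed.

Lemma tensor_expand (a b : {set I} -> C) :
  tensor (\sum_D a D *: L D) (\sum_E b E *: L E) = \sum_D \sum_E (a D * b E) *: tensor (L D) (L E).
Proof.
rewrite tensor_suml; apply: eq_bigr => D _; rewrite tensor_sumr; apply: eq_bigr => E _.
by rewrite tensorZl tensorZr scalerA.
Qed.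

(** The coefficient at (set0, setT) is the one that gives the degree 0 part of
    check_phi. *)
Lemma sheared_cross (D E : {set I}) s : (s \in D) = (s \in E) -> sheared D E (set_sum set0 setT) = 0.
Proof.
move=> sDE; apply/eqP; apply: contraTT isT => h.
have := probe_top_coef ThP m2n top0 h; by rewrite (probe_top_sheared ThP m2n nE t sDE) eqxx.
Qed.

Lemma cross_terms_vanish (al be : exterior rat m) (a b : {set I} -> C) :
    toC al = \sum_D a D *: L D -> (forall D, a D != 0 -> D = set0 \/ D = setT) ->
    toC be = \sum_E b E *: L E -> (forall E, b E != 0 -> (0 < #|E| < #|I|)%N) ->
  check_phi J (tensor al be) set0 = 0.
Proof.
move=> alE aP beE bP; have [u u0 uE] := check_phi_coef rat J.
have := uE (tensor al be) set0 set0; rewrite set_sum0 setC0 -/(shear _) => e.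
apply: (mulfI (u0 set0)); rewrite mulr0 -e.
apply: (fmorph_inj (@ratr C)); rewrite rmorph0 -extmapE toC_shear extmap_tensor alE beE.
rewrite tensor_expand shear_sum ext_sumE big1 // => D _.
rewrite shear_sum ext_sumE big1 // => E _.
rewrite shearZ extZE shear_secants.
have [->|aD] := eqVneq (a D) 0; first by rewrite !mul0r.
have [->|bE] := eqVneq (b E) 0; first by rewrite mulr0 mul0r.
have /andP[E0 ET] := bP _ bE.
have [s sDE] : exists s, (s \in D) = (s \in E).
  case: (aP _ aD) => ->.
    have [s sE] : exists s, s \in ~: E.
      by apply/card_gt0P; move: ET; rewrite -(cardsC E) -{1}[#|E|]addn0 ltn_add2l.
    by exists s; move: sE; rewrite !inE => /negbTE.
  by have [s sE] := card_gt0P E0; exists s; rewrite sE inE.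
by rewrite (sheared_cross sDE) mulr0.
Qed.

Lemma check_phi_degree_d_injective (x : exterior rat (m + m)) (b b' : I -> C) :
    toC x = \sum_s b s *: tensor (L setT) (L [set s]) + \sum_s b' s *: tensor (L set0) (L (~: [set s])) ->
    degree_part (2 * r.+1) (check_phi J x) = 0 :> exterior rat (m + m) ->
  forall s, b s = 0 /\ b' s = 0.
Proof.
move=> xE y0; apply: (degree_d_part_injective ThP m2n nE top0 t0) => A B cAB.
have [u u0 uE] := check_phi_coef rat J.
have y0' : check_phi J x (set_sum A (~: B)) = 0.
  have := congr1 (fun z : exterior rat (m + m) => z (set_sum A (~: B))) y0.
  rewrite /= ext0E ffunE -(weight_card (set_sum _ _)) weight_set_sum !weight_card cAB.
  by rewrite eqxx.
have -> : \sum_s b s *: sheared setT [set s] + \sum_s b' s *: sheared set0 (~: [set s]) = toC (shear x).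
  rewrite toC_shear xE shearD; congr (_ + _).
    by rewrite [RHS]shear_sum; apply: eq_bigr => s _; rewrite shearZ shear_secants.
  by rewrite [RHS]shear_sum; apply: eq_bigr => s _; rewrite shearZ shear_secants.
by have e := uE x A (~: B); rewrite setCK in e; rewrite extmapE /shear e y0' mulr0 rmorph0.
Qed.
End Detection.

Lemma extmap_ext_exp (k l : numFieldType) (f : {rmorphism k -> l}) m (z : exterior k m) :
  extmap f (ext_exp z) = ext_exp (extmap f z).
Proof.
rewrite !ext_expE /trunc_exp extmap_sum; apply: eq_bigr => j _.
by rewrite extmapZ fmorphV rmorph_nat extmapX.
Qed.

Section Reality.
Variables (R : realType) (m : nat) (I : finType) (Th : I -> exterior R m) (t : R[i]).
Hypothesis conj_t : conjc t = - t.
Local Notation ThC := (fun s => extmap (real_complex R) (Th s)).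
Local Notation L := (@secant R[i] m I ThC t).

Lemma extmap_conj_real (x : exterior R m) : extmap (@conjc R) (extmap (real_complex R) x) = extmap (real_complex R) x.
Proof. by apply/ffunP=> A; rewrite !extmapE /=; apply: conjc_real. Qed.

Lemma extmap_conj_rat (x : exterior rat m) : extmap (@conjc R) (extmap (@ratr R[i]) x) = extmap (@ratr R[i]) x.
Proof. by apply/ffunP=> A; rewrite !extmapE fmorph_rat. Qed.

(** The Theta_s are real and the conjugate of t is - t, so conjugation exchanges the
    two signs. *)
Lemma conj_secant D : extmap (@conjc R) (L D) = L (~: D).
Proof.
rewrite /secant /exp_form extmap_ext_exp extmap_sum; congr ext_exp; apply: eq_bigr => s _.
rewrite extmapZ extmap_conj_real; congr (_ *: _); rewrite /cm_sign inE.
by case: (s \in D); rewrite /= ?rmorphN /= conj_t ?opprK.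
Qed.
End Reality.

(** With Theta^n <> 0 this bounds the number of embeddings of F from below; no
    existence theorem for embeddings is involved. *)
Lemma pulled_sum_pow (k : numFieldType) m r (I : finType) (Th : I -> exterior k m) j :
    (forall s, pulled_from (2 * r.+1) (Th s)) -> (\sum_s Th s) ^+ j != 0 -> (j <= r.+1 * #|I|)%N.
Proof.
move=> ThP; apply: contraNleq => lt.
have [c _ h] := pow_sum (even_exterior k m) r.+1 #|I|.
pose z s : even_exterior k m := EvenExterior (homog_even (pulled_deg2 (ThP s)) isT).
have [||_ z0] := h _ (index_enum I) z; first by rewrite cardT enumT.
  by move=> s; apply: ev_inj; rewrite evX ev0 /= pulled_nilpotent.
have : (\sum_s z s) ^+ j = 0 by rewrite -(subnKC lt) exprD z0 mul0r.
by move/(congr1 (@ev _ _)); rewrite evX ev_sum ev0 => ->.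
Qed.

Lemma polarization_pow (R : realType) n (X : abelian_variety R n) (Theta : ext rat n.*2) :
  is_polarization (cs X) Theta -> (extmap (@ratr R) (Theta : exterior rat n.*2)) ^+ n != 0.
Proof.
move=> [deg2 _ pos]; apply: nondegenerate_pow; last by rewrite mul2n.
  move=> A; rewrite extmapE -deg2 ffunE weight_card; case: (#|A| =P 2%N) => // _.
  by rewrite rmorph0 eqxx.
by move=> u u0; exists (u *m cs X); rewrite gt_eqF // pos.
Qed.

Section Component.
Variables (m N : nat) (V : nat -> {vspace ext rat m}).

Lemma component_mem i v : component N V i v \in V i.
Proof. exact: memv_sum_pi. Qed.

Lemma component_sum v : v \in (\sum_(0 <= j < N.+1) V j)%VS ->
  \sum_(0 <= j < N.+1) component N V j v = v.
Proof. by move=> h; apply: (sumv_pi_uniq_sum (erefl _)) => //; rewrite filter_predT iota_uniq. Qed.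
End Component.

Lemma mem_sum_range (m N : nat) (V : nat -> {vspace ext rat m}) i : (i <= N)%N ->
  (V i <= \sum_(0 <= j < N.+1) V j)%VS.
Proof. by move=> le; rewrite big_mkord (sumv_sup (Ordinal (le : (i < N.+1)%N))). Qed.

Lemma span_linear_image (k : fieldType) (V V' : vectType k) (f : V -> V') (X : seq V) (U : {vspace V'}) :
    linear f -> (forall a, a \in X -> f a \in U) -> forall x, x \in <<X>>%VS -> f x \in U.
Proof.
move=> flin h x xX.
pose Lin := GRing.isLinear.Build k V V' _ f flin.
pose g : {linear V -> V'} := HB.pack f Lin.
have : (<<X>> <= linfun g @^-1: U)%VS by apply/span_subvP=> a aX; rewrite -memv_preim lfunE h.
by move/subvP/(_ x xX); rewrite -memv_preim lfunE.
Qed.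

Lemma tensor_span (k : fieldType) p q (X : seq (exterior k p)) (Y : seq (exterior k q))
    (U : {vspace exterior k (p + q)}) x y :
    (forall a b, a \in X -> b \in Y -> tensor a b \in U) ->
  x \in <<X>>%VS -> y \in <<Y>>%VS -> tensor x y \in U.
Proof.
move=> h xX yY.
apply: (span_linear_image (f := fun x => tensor x y) _ _ xX) => [c a b|a aX].
  by rewrite tensorDl tensorZl.
apply: (span_linear_image (f := tensor a) _ _ yY) => [c b b'|b bY]; last exact: h.
by rewrite tensorDr tensorZr.
Qed.

(** * CM types as sets of embeddings *)

Section NumberField.
Variables (R : realType) (K : fieldExtType rat) (F : {subfield K}) (sq : K) (q : rat).
Hypothesis hsq : sq ^+ 2 = - q%:A.
Hypothesis hK : <<F; sq>>%VS = {:K}%VS.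

Lemma embedding_sqr (f : {rmorphism K -> R[i]}) : f sq ^+ 2 = - ratr q.
Proof. by rewrite -rmorphXn hsq rmorphN alg_num_field fmorph_rat. Qed.

Lemma embedding_eq (M : fieldType) (f g : {rmorphism K -> M}) :
  (forall a : subvs_of F, f (vsval a) = g (vsval a)) -> f sq = g sq -> f =1 g.
Proof.
move=> fgF fgs x.
have xK : x \in <<F; sq>>%VS by rewrite hK memvf.
rewrite -(Fadjoin_poly_eq xK) !horner_coef !rmorph_sum; apply: eq_bigr => i _.
rewrite !rmorphM !rmorphXn fgs; congr (_ * _).
have /polyOverP/(_ i) cF := Fadjoin_polyOver F sq x.
by have := fgF (vsproj F (Fadjoin_poly F sq x)`_i); rewrite vsprojK.
Qed.
End NumberField.

Local Open Scope complex_scope.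
(** An embedding sends sqrt(-q) to one of two opposite numbers, and it is determined
    by this choice and by its restriction to F.  The imaginary parts being
    positive, T1 makes the same choice t everywhere. *)
Lemma cm_type_signs
  (R : realType)
  (K : fieldExtType rat) (F : {subfield K})
  (q : rat) (sq : K) (hsq : sq ^+ 2 = - q%:A)
  (hK : <<F; sq>>%VS = {:K}%VS)
  (S : finType) (emb : S -> {rmorphism K -> R[i]})
  (hemb : lists_embeddings emb)
  (hS : finType) (embF : hS -> {rmorphism subvs_of F -> R})
  (T1 : {ffun hS -> S}) (hT1 : CM_type emb embF T1)
  (hT1sq : forall s, 0 < complex.Im (emb (T1 s) sq)) (s0 : hS) :
  let t := emb (T1 s0) sq in
  let D (T : {ffun hS -> S}) := [set s | T s == T1 s] in
  [/\ t != 0, conjc t = - t,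
      forall T, CM_type emb embF T -> forall s, emb (T s) sq = cm_sign t (D T) s
    & forall T T', CM_type emb embF T -> CM_type emb embF T' ->
        forall s, (T s == T' s) = ((s \in D T) == (s \in D T'))].
Proof.
move=> t D.
have sqr (f : {rmorphism K -> R[i]}) : f sq ^+ 2 = - ratr q by apply: (embedding_sqr hsq).
have imN (z : R[i]) : complex.Im (- z) = - complex.Im z by case: z.
have tE s : emb (T1 s) sq = t.
  have /eqP := sqr (emb (T1 s)); rewrite -(sqr (emb (T1 s0))) eqf_sqr -/t => /orP[/eqP //|/eqP h].
  by have := hT1sq s; rewrite h imN oppr_gt0 => /lt_trans/(_ (hT1sq s0)); rewrite ltxx.
have tN0 : t != 0.
  by apply: contraTneq (hT1sq s0) => t0; rewrite -/t t0 ltxx.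
have conjt : conjc t = - t.
  have : conjc t ^+ 2 == t ^+ 2.
    by rewrite -rmorphXn /= /t sqr rmorphN /= fmorph_rat.
  rewrite eqf_sqr => /orP[/eqP h|/eqP //].
  have : complex.Im t = - complex.Im t by rewrite -{1}h; case: (t).
  by have := hT1sq s0; rewrite -/t => h1 h2; have := h1; rewrite h2 oppr_gt0 => /(lt_trans h1); rewrite ltxx.
have onF T T' : CM_type emb embF T -> CM_type emb embF T' ->
    forall s (a : subvs_of F), emb (T s) (vsval a) = emb (T' s) (vsval a).
  by move=> /asboolP h /asboolP h' s a; rewrite h h'.
have embE T T' s : CM_type emb embF T -> CM_type emb embF T' -> emb (T s) sq = emb (T' s) sq -> T s = T' s.
  move=> hT hT' h; apply: hemb.1; apply: (embedding_eq hK) => // a.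
  exact: onF.
have DE T : CM_type emb embF T -> forall s, emb (T s) sq = cm_sign t (D T) s.
  move=> hT s; rewrite /cm_sign inE; have [->|ne] := eqVneq (T s) (T1 s); first exact: tE.
  have /eqP := sqr (emb (T s)); rewrite -(sqr (emb (T1 s))) eqf_sqr tE => /orP[/eqP h|/eqP //].
  by case/eqP: ne; apply: embE => //; rewrite tE.
split=> // T T' hT hT' s.
have := DE T hT s; have := DE T' hT' s; rewrite /cm_sign.
have tNt : t != - t by rewrite -addr_eq0 -mulr2n mulrn_eq0.
case: (boolP (s \in D T)) => sT; case: (boolP (s \in D T')) => sT' h' h /=.
- by apply/eqP; apply: embE => //; rewrite h h'.
- by apply: contra_neqF tNt => /eqP eT; rewrite -{1}h eT h'.
- by apply: contra_neqF tNt => /eqP eT; rewrite -{1}h' -eT h.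
by apply/eqP; apply: embE => //; rewrite h h'.
Qed.

(** * Comparison of coefficients *)

Lemma dimension_arith e g d n : e = (2 * g)%N -> (4 * n = d * e)%N -> (0 < d)%N -> ~~ odd d ->
  exists r, d = (2 * r.+1)%N /\ n = (r.+1 * g)%N.
Proof.
move=> -> h d0 dodd; have dE : d = (2 * (d./2.-1).+1)%N by lia.
exists (d./2.-1); split=> //; apply/eqP.
by rewrite -(eqn_pmul2l (m := 4)) // h {1}dE mulnACA.
Qed.

Lemma check_phiD (R : realType) (k : numFieldType) m (J : 'M[R]_m) (x y : exterior k (m + m)) :
  check_phi J (x + y) = check_phi J x + check_phi J y :> exterior k (m + m).
Proof.
rewrite /check_phi -[RHS]linearD; congr (phi k J _).
have := id_tens_linear (p := m) (@tau k m) 1 x y.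
by rewrite !scale1r.
Qed.

Lemma sum_over_singletons (V : nmodType) (I : finType) (F : {set I} -> V) :
  (forall E : {set I}, #|E| != 1%N -> F E = 0) -> \sum_E F E = \sum_s F [set s].
Proof.
move=> F0; rewrite (bigID (fun E : {set I} => #|E| == 1%N)) /= [X in _ + X]big1 ?addr0; last by move=> E /F0.
rewrite -(big_imset (h := @set1 I) F) /=; last by move=> s s' _ _; apply: set1_inj.
apply: eq_bigl => E; apply/cards1P/imsetP => [[s ->]|[s _ ->]]; by exists s.
Qed.

(** The subspaces B_i + B_(g-i) with i <= g/2 have disjoint supports, so a size that
    occurs for i = 1 occurs for no other i; for g = 1 the sizes 1 and g - 1 = 0
    would belong to i = 0. *)
Lemma complementary_sizes g j x : (1 < g)%N -> (j <= g %/ 2)%N ->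
  x = 1%N \/ x = (g - 1)%N -> x = j \/ x = (g - j)%N -> j = 1%N.
Proof. lia. Qed.

Section Agreement.
Variable I : finType.

Definition agreement (D E : {set I}) := #|[set s | (s \in D) == (s \in E)]|.

Lemma agreementT E : agreement setT E = #|E|.
Proof. by apply: eq_card => s; rewrite !inE; case: (s \in E). Qed.

Lemma agreement0 E : agreement set0 E = #|~: E|.
Proof. by apply: eq_card => s; rewrite !inE; case: (s \in E). Qed.

(** A set agrees with setT exactly once when it is a singleton, and with set0 exactly
    once when its complement is one. *)
Lemma row_sums (k : fieldType) (V : lmodType k) (G : {set I} -> {set I} -> V)
    (f : {set I} * {set I} -> k) (a b : {set I} -> k) : (0 < #|I|)%N ->
    (forall D E, f (D, E) = if agreement D E == 1%N then a D * b E else 0) ->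
    (forall D, a D != 0 -> D = set0 \/ D = setT) ->
  \sum_p f p *: G p.1 p.2 = \sum_s (a setT * b [set s]) *: G setT [set s] +
    \sum_s (a set0 * b (~: [set s])) *: G set0 (~: [set s]).
Proof.
move=> I0 fE aP.
pose row D := \sum_E f (D, E) *: G D E.
have -> : \sum_p f p *: G p.1 p.2 = \sum_D row D.
  by rewrite pair_bigA; apply: eq_bigr => -[].
have ne0T : set0 != setT :> {set I}.
  by apply: contraTneq I0 => h; rewrite -cardsT -h cards0.
rewrite (bigD1 setT) //= (bigD1 set0) //=.
rewrite [X in _ + (_ + X)]big1 ?addr0 => [|D /andP[DT D0]]; last first.
  rewrite /row big1 // => E _; rewrite fE; case: ifP => _; last by rewrite scale0r.
  have [->|/aP[h|h]] := eqVneq (a D) 0; first by rewrite mul0r scale0r.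
    by rewrite h eqxx in D0.
  by rewrite h eqxx in DT.
congr (_ + _); rewrite /row.
  rewrite sum_over_singletons => [|E ne].
    by apply: eq_bigr => s _; rewrite fE agreementT cards1.
  by rewrite fE agreementT (negbTE ne) scale0r.
rewrite (reindex_inj (@setC_inj _)) /= sum_over_singletons => [|E ne].
  by apply: eq_bigr => s _; rewrite fE agreement0 setCK cards1.
by rewrite fE agreement0 setCK (negbTE ne) scale0r.
Qed.
End Agreement.

Section Coefficients.
Variables (R : realType) (n r : nat) (I : finType) (J : 'M[R]_(n.*2)).
Local Notation C := R[i].
Local Notation m := n.*2.
Variable Th : I -> exterior R m.
Local Notation ThC := (fun s => extmap (real_complex R) (Th s)).
Hypothesis ThP : forall s, pulled_from (2 * r.+1) (ThC s).
Hypothesis nE : n = (r.+1 * #|I|)%N.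
Hypothesis top0 : (\sum_s ThC s) ^+ n != 0.
Variable t : C.
Hypothesis t0 : t != 0.
Hypothesis conj_t : conjc t = - t.
Local Notation toC := (extmap (@ratr C)).
Local Notation L := (@secant C m I ThC t).
Local Notation g := #|I|.

Let m2n : m = (2 * n)%N. Proof. by rewrite mul2n. Qed.
Let free := secant_free ThP m2n nE top0 t0.
Let freeLL := secant_tensor_free ThP m2n nE top0 t0.

Lemma secant_coef_eq (a b : {set I} -> C) : \sum_E a E *: L E = \sum_E b E *: L E -> a =1 b.
Proof.
move=> e E; apply/eqP; rewrite -subr_eq0; apply/eqP; apply: (free (c := fun E => a E - b E)).
under eq_bigr => E' _ do rewrite scalerBl.
by rewrite sumrB e subrr.
Qed.

(** A rational class is fixed by conjugation, which exchanges the secant vectors of D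
    and of ~D. *)
Lemma real_coefficients (al : exterior rat m) (a : {set I} -> C) :
  toC al = \sum_E a E *: L E -> forall E, a E = conjc (a (~: E)).
Proof.
move=> alE; apply: secant_coef_eq; rewrite -alE -(extmap_conj_rat R al) alE extmap_sum.
rewrite (reindex_inj (@setC_inj _)) /=; apply: eq_bigr => E _.
rewrite (extmapZ (@conjc R) (a (~: E)) (L (~: E))); congr (_ *: _).
by rewrite -[in RHS](setCK E); apply: (conj_secant Th conj_t).
Qed.

(* The components of be and of al (x) be are given with their expansions: bes j
   lies in B_j + B_(g-j) and ces j in BB_j. *)
Variables (al be : exterior rat m) (a b : {set I} -> C).
Hypothesis al0 : al != 0.
Hypothesis alE : toC al = \sum_E a E *: L E.
Hypothesis aP : forall E, a E != 0 -> #|E| = 0%N \/ #|E| = g.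
Variables (bes : nat -> exterior rat m) (bb : nat -> {set I} -> C).
Hypothesis beE : be = \sum_(0 <= j < (g %/ 2).+1) bes j.
Hypothesis besE : forall j, (j <= g %/ 2)%N -> toC (bes j) = \sum_E bb j E *: L E.
Hypothesis bbP : forall j E, (j <= g %/ 2)%N -> bb j E != 0 -> #|E| = j \/ #|E| = (g - j)%N.
Variables (ces : nat -> exterior rat (m + m)) (cc : nat -> {set I} * {set I} -> C).
Hypothesis ceE : tensor al be = \sum_(0 <= j < g.+1) ces j.
Hypothesis cesE : forall j, (j <= g)%N -> toC (ces j) = \sum_p cc j p *: tensor (L p.1) (L p.2).
Hypothesis ccP : forall j p, (j <= g)%N -> cc j p != 0 -> agreement p.1 p.2 = j.
Hypothesis g2 : (1 < g)%N.

Lemma a_support E : a E != 0 -> E = set0 \/ E = setT.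
Proof.
move=> /aP[/eqP|h]; first by rewrite cards_eq0 => /eqP; left.
by right; apply/eqP; rewrite eqEcard subsetT cardsT h leqnn.
Qed.

(** The two coefficients of al are conjugate, so if one vanished, al would. *)
Lemma a_neq0 : a setT != 0 /\ a set0 != 0.
Proof.
have aT0 : a setT = conjc (a set0) by rewrite (real_coefficients alE) setCT.
suff h : a set0 != 0 by rewrite aT0 conjc_eq0.
apply: contraNneq al0 => a0; apply/eqP; apply: (extmap_inj (f := @ratr C)).
rewrite alE extmap0 big1 // => E _.
have [->|/a_support[->|->]] := eqVneq (a E) 0; first by rewrite scale0r.
  by rewrite a0 scale0r.
by rewrite aT0 a0 conjc0 scale0r.
Qed.

(** The types in the support of bes j for j > 0 are neither setT nor set0, so they
    agree somewhere with both. *)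
Lemma check_phi_degree0 :
  check_phi J (tensor al (bes 0%N)) set0 != 0 -> check_phi J (tensor al be) set0 != 0.
Proof.
have -> : tensor al be = tensor al (bes 0%N) + tensor al (\sum_(1 <= j < (g %/ 2).+1) bes j).
  by rewrite beE big_ltn // tensorDr.
rewrite check_phiD extDE.
have -> : check_phi J (tensor al (\sum_(1 <= j < (g %/ 2).+1) bes j)) set0 = 0; last by rewrite addr0.
apply: (cross_terms_vanish J ThP nE top0 (t := t) (a := a) (b := fun E => \sum_(1 <= j < (g %/ 2).+1) bb j E)) => //.
- exact: a_support.
- rewrite extmap_sum; under [RHS]eq_bigr => E _ do rewrite scaler_suml.
  rewrite exchange_big; apply: eq_big_nat => j /andP[_]; rewrite ltnS => jg.
  exact: besE.
move=> E; apply: contraR => nE'; rewrite big_nat_cond big1 // => j /andP[/andP[j1]].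
rewrite ltnS => jg _; apply/eqP; apply: contraR nE' => /(bbP jg) h.
have jg2 : (j < g)%N by apply: leq_ltn_trans jg _; rewrite ltn_Pdiv // (ltn_trans _ g2).
case: h => ->; first by rewrite j1.
by rewrite subn_gt0 jg2 ltn_subrL j1 (ltn_trans _ g2).
Qed.

Let b_ E := \sum_(0 <= j < (g %/ 2).+1) bb j E.

Lemma toC_be : toC be = \sum_E b_ E *: L E.
Proof.
rewrite beE extmap_sum /b_; under [RHS]eq_bigr => E _ do rewrite scaler_suml.
rewrite exchange_big; apply: eq_big_nat => j /andP[_]; rewrite ltnS => jg.
exact: besE.
Qed.

Lemma tensor_coef_sum D E : \sum_(0 <= j < g.+1) cc j (D, E) = a D * b_ E.
Proof.
apply/eqP; rewrite -subr_eq0; apply/eqP; move: D E; apply: freeLL.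
have e1 : \sum_D \sum_E (a D * b_ E) *: tensor (L D) (L E) = toC (tensor al be).
  by rewrite extmap_tensor alE toC_be tensor_expand.
have e2 : \sum_D \sum_E (\sum_(0 <= j < g.+1) cc j (D, E)) *: tensor (L D) (L E) = toC (tensor al be).
  rewrite ceE extmap_sum pair_big /=.
  under [LHS]eq_bigr => p _ do rewrite scaler_suml -surjective_pairing.
  rewrite exchange_big; apply: eq_big_nat => j /andP[_]; rewrite ltnS => jg.
  exact: esym (cesE jg).
transitivity (toC (tensor al be) - toC (tensor al be)); last exact: subrr.
rewrite -{1}e2 -e1 -sumrB; apply: eq_bigr => D _; rewrite -sumrB; apply: eq_bigr => E _.
exact: scalerBl.
Qed.

(** The pairs that agree exactly once occur only in the component with index 1. *)
Lemma component1_coef D E : cc 1%N (D, E) = if agreement D E == 1%N then a D * b_ E else 0.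
Proof.
have g1 : (1 <= g)%N by apply: ltnW.
case: eqP => [h|h]; last first.
  by apply/eqP; apply: contra_notT h => /(ccP g1).
rewrite -tensor_coef_sum (bigD1_seq 1%N) ?iota_uniq ?mem_index_iota //= big_nat_cond big1 ?addr0 //.
move=> j /andP[/andP[_]]; rewrite ltnS => jg ne.
apply/eqP; apply: contraNT ne => /(ccP jg) /=; rewrite h => <-; exact: eqxx.
Qed.

Lemma component1_expand : toC (ces 1%N) =
  \sum_s (a setT * b_ [set s]) *: tensor (L setT) (L [set s]) +
  \sum_s (a set0 * b_ (~: [set s])) *: tensor (L set0) (L (~: [set s])).
Proof.
have g1 : (1 <= g)%N by apply: ltnW.
rewrite (cesE g1) (row_sums (V := exterior C (m + m)) (fun D E => tensor (L D) (L E)) _ component1_coef a_support) //.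
Qed.

Lemma check_phi_degree_d : bes 1%N != 0 ->
  degree_part (2 * r.+1) (check_phi J (ces 1%N)) != 0 :> exterior rat (m + m).
Proof.
move=> be1; apply/eqP => /(check_phi_degree_d_injective ThP nE top0 t0 component1_expand) h.
have h1g : (1 <= g %/ 2)%N by rewrite divn_gt0.
have [aT a0] := a_neq0.
case/eqP: be1; apply: (extmap_inj (f := @ratr C)); rewrite (besE h1g) extmap0 big1 // => E _.
have [->|bbE] := eqVneq (bb 1%N E) 0; first by rewrite scale0r.
have cE := bbP h1g bbE.
have bE : b_ E = bb 1%N E.
  rewrite /b_ (bigD1_seq 1%N) ?iota_uniq ?mem_index_iota ?ltnS //= big_nat_cond big1 ?addr0 //.
  move=> j /andP[/andP[_]]; rewrite ltnS => jg ne; apply/eqP; apply: contraNT ne => /(bbP jg) cE'.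
  by apply/eqP; apply: (complementary_sizes g2 jg cE cE').
suff : b_ E = 0 by rewrite bE => ->; rewrite scale0r.
have [/eqP/cards1P[s Es]|cE1] := cE.
  have [/eqP] := h s; rewrite mulf_eq0 (negbTE aT) /= -Es => /eqP -> _.
  by [].
have /cards1P[s Es] : #|~: E| == 1%N.
  by rewrite -(eqn_add2l (g - 1)) -{1}cE1 cardsC subnK // ltnW.
have [_ /eqP] := h s; rewrite mulf_eq0 (negbTE a0) /= -Es setCK => /eqP -> .
by [].
Qed.
End Coefficients.

Theorem lemma11p2p9
  (R : realType)
  (K : fieldExtType rat) (F : {subfield K}) (hCM : CM_field R F)
  (e : nat) (he : \dim {:K} = e)
  (hF : \dim F = (e %/ 2)%N) (e2_gt1 : (1 < e %/ 2)%N)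
  (q : rat) (q_gt0 : 0 < q) (sq : K) (hsq : sq ^+ 2 = - q%:A)
  (hK : <<F; sq>>%VS = {:K}%VS)
  (S : finType) (emb : S -> {rmorphism K -> R[i]})
  (hemb : lists_embeddings emb)
  (hS : finType) (embF : hS -> {rmorphism subvs_of F -> R})
  (hembF : lists_embeddings embF)
  (d : nat) (d_gt0 : (0 < d)%N) (d_even : ~~ odd d)
  (n : nat) (hn : (4 * n = d * e)%N)
  (X : abelian_variety R n) (hX : simple_av X)
  (eta : {rmorphism subvs_of F -> 'M[rat]_(n.*2)}) (heta : iso_EndQ X eta)
  (Theta : ext rat n.*2) (hTheta : is_polarization (cs X) Theta)
  (hThetaF : F_bilinear eta Theta)
  (Theta_ : hS -> ext R n.*2)
  (hTheta_ : forall s, in_wedge2_H1_eigen eta (embF s) (Theta_ s))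
  (hThetaD : ext_map (@ratr R) Theta = \sum_(s : hS) Theta_ s)
  (T1 : {ffun hS -> S}) (hT1 : CM_type emb embF T1)
  (hT1sq : forall s, 0 < complex.Im (emb (T1 s) sq)) :
  let l := ell emb sq Theta_ in
  let CMT := [seq T <- enum {: {ffun hS -> S}} | CM_type emb embF T] in
  let BC i := <<[seq l T | T <- CMT & meet_number T T1 == i]>>%VS in
  forall
  (B : {vspace ext rat n.*2})
  (hB : tensor_C R B = <<[seq l T | T <- CMT]>>%VS)
  (BS : nat -> {vspace ext rat n.*2})
  (hBS : forall i, (i <= e %/ 4)%N ->
           tensor_C R (BS i) = (BC i + BC (e %/ 2 - i)%N)%VS)
  (BB : nat -> {vspace ext rat (n.*2 + n.*2)})
  (hBB : forall k, (k <= e %/ 2)%N ->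
           tensor_C R (BB k) =
             <<[seq tens (l TT.1) (l TT.2) | TT <- [seq (T, T') | T <- CMT, T' <- CMT]
                                     & meet_number TT.1 TT.2 == k]>>%VS)
  (alpha0 beta : ext rat n.*2),
  let beta_ i := component (e %/ 4) BS i beta in
  let c := tens alpha0 beta in
  let c_ k := component (e %/ 2) BB k c in
  let KB1 (x : ext rat (n.*2 + n.*2)) :=
    x \in BB 1%N /\ degree_part d (check_phi (cs X) x) = 0 in
  alpha0 != 0 -> to_C R alpha0 \in (BC 0%N + BC (e %/ 2)%N)%VS ->
  beta \in B ->
  beta_ 0%N != 0 -> beta_ 1%N != 0 ->
  check_phi (cs X) (tens alpha0 (beta_ 0%N)) set0 != 0 ->
  check_phi (cs X) c set0 != 0 /\ ~ KB1 (c_ 1%N).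
Proof.
move=> l CMT BC B hB BS hBS BB hBB alpha0 beta beta_ c c_ KB1 al0 alP beB be0 be1 chi0.
have [_ _ dimK _] := hCM.
set g := \dim F in hF dimK.
have eE : e = (2 * g)%N by rewrite -he dimK.
have e2E : (e %/ 2 = g)%N by [].
have e4E : (e %/ 4 = g %/ 2)%N by rewrite eE -[4%N]/(2 * 2)%N divnMl.
have g2 : (1 < g)%N by rewrite -e2E.
have [r [dE nE]] := dimension_arith eE hn d_gt0 d_even.
have dimF : \dim {:subvs_of F} = g by rewrite dimvf.
(* The bound on the rank of each Theta_s and the nonvanishing of Theta^n together
   force the number of embeddings of F to be its degree. *)
have ThR s : pulled_from (2 * r.+1) (Theta_ s : exterior R n.*2).
  apply: (eigen_pulled _ (hTheta_ s)); rewrite dimF -mulnA -nE mul2n //.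
have topR : (\sum_s (Theta_ s : exterior R n.*2)) ^+ n != 0.
  by have := polarization_pow hTheta; rewrite [extmap _ _]hThetaD.
have hS_g : #|hS| = g.
  apply/eqP; rewrite eqn_leq -dimF (embeddings_le hembF.1) /= dimF.
  by have := pulled_sum_pow ThR topR; rewrite {1}nE leq_pmul2l.
pose ThC s : exterior R[i] n.*2 := extmap (real_complex R) (Theta_ s : exterior R n.*2).
have ThP s : pulled_from (2 * r.+1) (ThC s) by apply: pulled_extmap.
have topC : (\sum_s ThC s) ^+ n != 0.
  rewrite -extmap_sum -extmapX; apply: contraNneq topR => h; apply/eqP.
  by apply: (extmap_inj (f := real_complex R)); rewrite extmap0.
have nE' : n = (r.+1 * #|hS|)%N by rewrite hS_g.
have m2n : n.*2 = (2 * n)%N by rewrite mul2n.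
have [s0 _] : exists s : hS, s \in hS by apply/card_gt0P; rewrite hS_g ltnW.
have [] := cm_type_signs hsq hK hemb hT1 hT1sq s0.
set t := emb (T1 s0) sq; set D := fun T : {ffun hS -> S} => [set s | T s == T1 s].
move=> /= tN0 conjt embD agreeD.
pose Lc := (secant ThC t).
have lE T : T \in CMT -> l T = Lc (D T).
  rewrite mem_filter => /andP[hT _]; rewrite /l /ell /Lc /secant /exp_form; congr ext_exp.
  by apply: eq_bigr => s _; rewrite embD.
have expBC i v : v \in BC i -> exists2 cf : {set hS} -> R[i],
    v = \sum_E cf E *: Lc E & forall E, cf E != 0 -> #|E| = i.
  move=> h; have [|cf cfE cfP] := span_expand (G := Lc) (h := D) _ h.
    by move=> T; rewrite mem_filter => /andP[_]; apply: lE.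
  exists cf => // E /cfP[T]; rewrite mem_filter => /andP[/eqP <- _] <-.
  by [].
have expBC2 i j v : v \in (BC i + BC j)%VS -> exists2 cf : {set hS} -> R[i],
    v = \sum_E cf E *: Lc E & forall E, cf E != 0 -> #|E| = i \/ #|E| = j.
  move=> /memv_addP[v1 /expBC[c1 e1 h1] [v2 /expBC[c2 e2 h2] ->]].
  exists (fun E => c1 E + c2 E) => [|E].
    rewrite e1 e2 -big_split; apply: eq_bigr => E _; exact: esym (scalerDl _ _ _).
  have [->|/h1 -> _] := eqVneq (c1 E) 0; last by left.
  by rewrite add0r => /h2 ->; right.
have meetTT (T T' : {ffun hS -> S}) : (meet_number T T' <= g)%N.
  by rewrite -hS_g max_card.
have l_mem T : T \in CMT -> l T \in BC (meet_number T T1).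
  by move=> hT; apply: memv_span; apply: map_f; rewrite mem_filter eqxx.
(* The component is a projection of the sum of the BS j; that beta lies in this sum
   is a statement over the complex numbers, where B is spanned by the l T. *)
have beta_sum : \sum_(0 <= j < (g %/ 2).+1) beta_ j = beta.
  rewrite -e4E; apply: component_sum; apply: (@tensor_C_descent R).
  apply: (subvP _ _ (mem_tensor_C R beB)); rewrite hB.
  apply/span_subvP => v /mapP[T hT ->].
  have [le|lt] := leqP (meet_number T T1) (e %/ 4).
    apply: (subvP (tensor_C_sub R (mem_sum_range BS le))).
    by rewrite hBS // (subvP (addvSl _ _)) // l_mem.
  (* A type that meets T1 in more than half of the places belongs to the second
     summand of its BS j. *)
  have le : (g - meet_number T T1 <= e %/ 4)%N by rewrite e4E in lt *; move: lt (meetTT T T1); clear; lia.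
  apply: (subvP (tensor_C_sub R (mem_sum_range BS le))).
  by rewrite hBS // e2E subKn // (subvP (addvSr _ _)) // l_mem.
have comp_exp : forall j, exists cf : {set hS} -> R[i], (j <= g %/ 2)%N ->
    to_C R (beta_ j) = \sum_E cf E *: Lc E /\ forall E, cf E != 0 -> #|E| = j \/ #|E| = (g - j)%N.
  move=> j; have [le|_] := leqP j (g %/ 2); last by exists (fun=> 0).
  have := mem_tensor_C R (component_mem (e %/ 4) BS j beta).
  have le' : (j <= e %/ 4)%N by rewrite e4E.
  by rewrite (hBS _ le') e2E => /expBC2[cf cfE cfP]; exists cf.
have [bb bbP] := choice comp_exp.
have [a aE aP] := expBC2 _ _ _ alP.
have c_sum : \sum_(0 <= j < g.+1) c_ j = c.
  rewrite -e2E; apply: component_sum; apply: (@tensor_C_descent R).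
  have -> : to_C R c = tensor (to_C R alpha0) (to_C R beta) by exact: extmap_tensor.
  apply: (@tensor_span _ _ _ [seq l T | T <- CMT] [seq l T | T <- CMT]) => [x y /mapP[T hT ->] /mapP[T' hT' ->]||].
  - have le : (meet_number T T' <= e %/ 2)%N by rewrite e2E.
    apply: (subvP (tensor_C_sub R (mem_sum_range BB le))).
    rewrite (hBB _ le); apply: memv_span.
    apply/mapP; exists (T, T') => //; rewrite mem_filter eqxx /=.
    by apply/allpairsP; exists (T, T').
  - move: alP; apply: subvP; rewrite subv_add; apply/andP; split; apply: sub_span => v /mapP[T];
    by rewrite mem_filter => /andP[_ hT] ->; apply: map_f.
  by rewrite -hB mem_tensor_C.
have cc_exp : forall j, exists cf : {set hS} * {set hS} -> R[i], (j <= g)%N ->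
    to_C R (c_ j) = \sum_p cf p *: tensor (Lc p.1) (Lc p.2) /\ forall p, cf p != 0 -> agreement p.1 p.2 = j.
  move=> j; have [le|_] := leqP j g; last by exists (fun=> 0).
  have := mem_tensor_C R (component_mem (e %/ 2) BB j c).
  have le' : (j <= e %/ 2)%N by rewrite e2E.
  rewrite (hBB _ le') => h.
  have [|cf cfE cfP] := span_expand (G := fun p => tensor (Lc p.1) (Lc p.2)) (h := fun TT => (D TT.1, D TT.2)) _ h.
    move=> TT; rewrite mem_filter => /andP[_ /allpairsP[[T T'] /= [hT hT' ->]]] /=.
    by rewrite !lE.
  exists cf => _; split=> // p /cfP[TT]; rewrite mem_filter => /andP[/eqP <- /allpairsP[[T T'] /= [hT hT' ->]]] <- /=.
  move: hT hT'; rewrite !mem_filter => /andP[hT _] /andP[hT' _].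
  by apply: eq_card => s; rewrite [LHS]inE [RHS]inE agreeD.
have [cc ccP] := choice cc_exp.
have besE j (le : (j <= g %/ 2)%N) := (bbP j le).1.
have bbS j E (le : (j <= g %/ 2)%N) := (bbP j le).2 E.
have cesE j (le : (j <= g)%N) := (ccP j le).1.
have ccS j p (le : (j <= g)%N) := (ccP j le).2 p.
have c_sum' : tensor (alpha0 : exterior rat n.*2) beta = \sum_(0 <= j < g.+1) (c_ j : exterior rat (n.*2 + n.*2)).
  exact: esym c_sum.
have g2' : (1 < #|hS|)%N by rewrite hS_g.
have aS E : a E != 0 -> #|E| = 0%N \/ #|E| = g by move=> /aP; rewrite e2E.
rewrite -hS_g in aS beta_sum besE bbS c_sum' cesE ccS.
split.
  exact: (check_phi_degree0 ThP nE' topC aE aS (esym beta_sum) besE bbS g2').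
move=> [_ y0].
have nonzero := check_phi_degree_d (cs X) ThP nE' topC tN0 conjt al0 aE aS
  (esym beta_sum) besE bbS c_sum' cesE ccS g2' be1.
by move/eqP: nonzero; apply; rewrite -dE; exact: y0.
Qed.
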